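(* Let $\omega_1=\sum_{i=1}^N\delta_i$, $\omega_k=\frac{\sum_{i=k}^N\delta_i}{\sum_{i=k-1}^N\delta_i}$ for $2\le k\le N$, $\omega_{N+1}=\frac{1}{q\delta_N}$, and $\tilde\omega_{N-d+1}=\omega_1\omega_2\cdots\omega_{N-d+1}$. (1) For every $(X_1,\dots,X_N)\in\mathrm{Pref}_{\chi_1,\dots,\chi_N}(\Omega)$ there is a unique vector $t\in[1,m_d^{\omega_{N+1}d}]^{\Gamma_{(X_1,\dots,X_N)}(\Omega)}$ such that for all $\ell\ge0$ and all $(X_1,\dots,X_{N+\ell d})\in\Gamma_{(X_1,\dots,X_N)}(\Omega)$, $$ \left(t_{X_1\cdots X_{N+\ell d}}\right)^{\frac{1}{\tilde\omega_{N-d+1}\omega_{N+1}}}=\sum_{X'_{N+\ell d+1}}\bigg(\sum_{X'_{N+\ell d+2}}\bigg(\cdots\bigg(\sum_{X'_{N+(\ell+1)d}}t_{X_1\cdots X_{N+\ell d}X'_{N+\ell d+1}\cdots X'_{N+(\ell+1)d}}\bigg)^{\omega_N}\cdots\bigg)^{\omega_{N-d+3}}\bigg)^{\omega_{N-d+2}}. $$ (2) Define $$ t_\varnothing=\sum_{X'_1}\bigg(\sum_{X'_2}\bigg(\cdots\bigg(\sum_{X'_{N-1}}\bigg(\sum_{X'_N}t_{X'_1\cdots X'_N}\bigg)^{\omega_N}\bigg)^{\omega_{N-1}}\cdots\bigg)^{\omega_3}\bigg)^{\omega_2}. $$ There is a unique Borel probability measure $\mu$ on $\Omega$ maximizing $S(\Omega,\mu)$,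 and it is given, for all $\ell\ge0$ and $(X_1,\dots,X_{N+\ell d})\in\mathrm{Pref}_{\chi_1,\dots,\chi_{N+\ell d}}(\Omega)$, by $$ \mu([X_1\cdots X_{N+\ell d}])=\frac{t_{X_1\cdots X_N}}{t_\varnothing}\prod_{p=2}^N A_p(X_1\cdots X_{p-1})^{\omega_p-1}\cdot\prod_{k=1}^\ell\left[t_{X_1\cdots X_{N+kd}}\ t_{X_1\cdots X_{N+(k-1)d}}^{-\frac{1}{\tilde\omega_{N-d+1}\omega_{N+1}}}\ \prod_{p=2}^d A^{(k)}_p(X_1\cdots X_{N+(k-1)d+p-1})^{\omega_{N-d+p}-1}\right], $$ where $$A_p(X_1\cdots X_{p-1})=\sum_{X'_p}\bigg(\sum_{X'_{p+1}}\bigg(\cdots\bigg(\sum_{X'_N}t_{X_1\cdots X_{p-1}X'_p\cdots X'_N}\bigg)^{\omega_N}\cdots\bigg)^{\omega_{p+2}}\bigg)^{\omega_{p+1}},$$ $$A^{(k)}_p(X_1\cdots X_{N+(k-1)d+p-1})=\sum_{X'_{N+(k-1)d+p}}\bigg(\cdots\bigg(\sum_{X'_{N+kd}}t_{X_1\cdots X_{N+(k-1)d+p-1}X'_{N+(k-1)d+p}\cdots X'_{N+kd}}\bigg)^{\omega_N}\cdots\bigg)^{\omega_{N-d+p+1}}$$ (so $A_N=\sum_{X'_N}t_{X_1\cdots X_{N-1}X'_N}$ and $A^{(k)}_d=\sum_{X'_{N+kd}}t_{X_1\cdots X_{N+kd-1}X'_{N+kd}}$). For this $\mu$, the Hausdorff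 dimension of $\mathbb{P}_\mu$ equals $\omega_1\log_{m_d}(t_\varnothing)$.
   Context: Setting. Let $d\ge2$, $q\ge2$ and $m_1\ge\cdots\ge m_d\ge2$ be integers, $\mathcal{A}_k=\{0,\dots,m_k-1\}$, $\mathbb{N}^*=\{1,2,\dots\}$, $\Sigma=(\mathcal{A}_1\times\cdots\times\mathcal{A}_d)^{\mathbb{N}^*}$, with elements $x=(x_i)_{i\ge1}$, $x_i=(x_i^1,\dots,x_i^d)$. Let $\Omega\subset\Sigma$ be nonempty and closed (product topology), $X_\Omega=\{x\in\Sigma:(x_{iq^\ell})_{\ell\ge0}\in\Omega\ \forall i\ge1,\ q\nmid i\}$. For a Borel probability measure $\mu$ on $\Omega$, $\mathbb{P}_\mu$ is the unique Borel probability measure on $\Sigma$ (supported on $X_\Omega$) with $\mathbb{P}_\mu([x_1\cdots x_n])=\prod_{i\le n,\ q\nmid i}\mu([x_ix_{qi}\cdots x_{q^ri}])$, where $q^ri\le n<q^{r+1}i$ and $[w]$ is the set of sequences beginning with $w$. Balls. For $2\le i\le d$ let $\gamma_i=\log(m_i)/\log(m_{i-1})$ and $L_i(n)=\lceil n/\gamma_i\rceil$; $L_1$ is the identity. Let $B_n(x)=\{u\in\Sigma:\forall 1\le k\le d,\ \forall 1\le i\le(L_k\circ\cdots\circ L_1)(n),\ u_i^k=x_i^k\}$; $\Sigma$ carries the metric for which these are the closed balls of radius $m_1^{-n}$ (distance $m_1^{-\sup\{n\ge0:u\in B_n(x)\}}$ between $x$ and $u$), and Hausdorff dimension refers to it.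 For a measure $\nu$ with $-\frac1n\log_{m_1}\nu(B_n(x))\to D$ for $\nu$-a.e. $x$ (exact dimensional measure), $\dim_H(\nu)=D$; every $\mathbb{P}_\mu$ is of this type. Parameters. For $1\le k\le d-1$ let $p_k$ be the non-negative integer with $q^{p_k}\le\frac{1}{\gamma_d\gamma_{d-1}\cdots\gamma_{k+1}}<q^{p_k+1}$, and $a_k=q^{p_k}\prod_{i=k+1}^d\gamma_i$. For $1\le s\le d-1$ let $\sigma_s$ be the permutation of $\{s,\dots,d-1\}$ for which $(a_{\sigma_s(t)})_{s\le t\le d-1}$ is non-decreasing, ties being ordered by increasing index. For $1\le s\le d-1$, $s-1\le t\le d-1$, $s\le k\le d-1$ let $p_k^{s,t}=p_k+1$ if $k\in\sigma_s(\{s,\dots,t\})$ and $p_k^{s,t}=p_k$ otherwise. Weights. For $p\ge1$: $\delta_p^{d,d-1}=\frac{(q-1)^2}{q^{p+1}}$; and for $1\le s\le d-1$: $\delta_p^{s,s-1}=\frac{(q\,a_{\sigma_s(s)}-1)(q-1)}{q^{p+1}}$, $\delta_p^{s,t}=\frac{(a_{\sigma_s(t+1)}-a_{\sigma_s(t)})(q-1)}{q^p}$ for $s\le t\le d-2$, $\delta_p^{s,d-1}=\frac{(1-a_{\sigma_s(d-1)})(q-1)}{q^p}$. The functional $S$. For $1\le k\le d$, $p\ge0$, $\alpha_p^k$ is the partition of $\Omega$ according to the values of $(x_i^l)_{1\le i\le p,\ d-k+1\le l\le d}$ (trivial if $p=0$); $H^\mu_{m_d}(\mathcal{P})=-\sum_{C\in\mathcal{P}}\mu(C)\log_{m_d}\mu(C)$.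 For $1\le s\le d$ put $\widetilde{H}^\mu_{s,p}=\sum_{t=s-1}^{d-1}\delta_p^{s,t}H^\mu_{m_d}(\alpha_p^1\lor\alpha^2_{p-p^{s,t}_{d-1}}\lor\alpha^3_{p-p^{s,t}_{d-2}}\lor\cdots\lor\alpha^{d-s+1}_{p-p_s^{s,t}})$ (for $s=d$: $\delta_p^{d,d-1}H^\mu_{m_d}(\alpha_p^1)$), and $$S(\Omega,\mu)=\sum_{p=1}^{p_{d-1}}\widetilde{H}^\mu_{d,p}+\sum_{s=2}^{d-1}\sum_{p=p_s+1}^{p_{s-1}}\widetilde{H}^\mu_{s,p}+\sum_{p=p_1+1}^\infty\widetilde{H}^\mu_{1,p},$$ which is the dimension of $\mathbb{P}_\mu$. Coordinate functions $\chi_i$ and weights $\delta_i$. For $p\ge1$ let $s(p)=d$ if $p\le p_{d-1}$, $s(p)=s$ if $2\le s\le d-1$ and $p_s+1\le p\le p_{s-1}$, and $s(p)=1$ if $p\ge p_1+1$. List all pairs $(p,t)$ with $p\ge1$ and $s(p)-1\le t\le d-1$ by increasing $p$ and, for fixed $p$, by decreasing $t$ (from $d-1$ down to $s(p)-1$). If $(p,t)$ is the $i$-th pair and $s=s(p)$, let $\chi_i$ be the coordinate function $\chi_i(x)=x_p^d$ if $t=d-1$, and $\chi_i(x)=x^{k}_{p-p_k}$ with $k=\sigma_s(t+1)$ if $t\le d-2$. (Thus the partition of $\Omega$ according to $(\chi_1,\dots,\chi_i)$ is the $i$-th partition appearing in $S(\Omega,\mu)$, from coarsest to finest.) Let $N=p_1+1+\sum_{k=1}^{d-1}(p_1+1-p_k)$;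 the $N$-th pair is $(p_1+1,0)$. For $1\le i\le N-1$, with $(p,t)$ the $i$-th pair, let $\delta_i=\delta_p^{s(p),t}$; and let $\delta_N=\delta^{1,0}_{p_1+1}+\sum_{p=p_1+2}^\infty\sum_{t=0}^{d-1}\delta_p^{1,t}$. Prefixes. $\mathrm{Pref}_{\chi_1,\dots,\chi_n}(\Omega)=\{(\chi_1(x),\dots,\chi_n(x)):x\in\Omega\}$ and $[X_1\cdots X_n]=\{x\in\Omega:\chi_i(x)=X_i,\ 1\le i\le n\}$. For $(X_1,\dots,X_N)\in\mathrm{Pref}_{\chi_1,\dots,\chi_N}(\Omega)$, $\Gamma_{(X_1,\dots,X_N)}(\Omega)$ denotes (the vertex set of) the tree rooted at $(X_1,\dots,X_N)$ whose vertices are the elements of $\bigcup_{\ell\ge0}\mathrm{Pref}_{\chi_1,\dots,\chi_{N+\ell d}}(\Omega)$ that extend $(X_1,\dots,X_N)$, with an edge from $X_1\cdots X_{N+\ell d}$ to each extension $X_1\cdots X_{N+(\ell+1)d}$. All sums over primed letters run over those letters for which the resulting word is in the corresponding set of prefixes of $\Omega$. Letting $(X_1,\dots,X_N)$ vary, part (1) defines $t$ on all of $\bigcup_{\ell\ge0}\mathrm{Pref}_{\chi_1,\dots,\chi_{N+\ell d}}(\Omega)$. *)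

(* Defs.v *)
From HB Require Import structures.
From mathcomp Require Import all_boot all_order all_algebra.
From mathcomp Require Import all_classical all_reals all_analysis.

Import Order.TTheory GRing.Theory Num.Theory.
Import numFieldNormedType.Exports.

Local Open Scope classical_set_scope.
Local Open Scope ring_scope.

Section Space.

Variables (d : nat) (m : nat -> nat).

(* Positions and coordinates are numbered from 1 in the mathematics and from 0
   in the types: x_i^k is x i.-1 (k - 1).  The alphabet A_k has (m k).-1.+1
   letters, that is m k since m k >= 2; this form gives it an element for every
   m. *)
Definition Sigma : Type :=
  prod_topology (fun _ : nat =>
    prod_topology (fun k : 'I_d => discrete_topology 'I_(m k.+1).-1.+1)).

HB.instance Definition _ := Topological.on Sigma.
HB.instance Definition _ := isPointed.Build Sigma (fun _ _ => ord0).

Definition SigmaB : Type := g_sigma_algebraType (@open Sigma).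

HB.instance Definition _ := Measurable.on SigmaB.

(* x_i^k as a natural number, for i >= 1 and 1 <= k <= d *)
Definition coord (x : Sigma) (i k : nat) : nat :=
  if (insub k.-1 : option 'I_d) is Some j then
    nat_of_ord (x i.-1 j : 'I_(m j.+1).-1.+1)
  else 0%N.

End Space.

Arguments coord {d m} x i k.

Section Sponge.

Variables (R : realType) (d q : nat) (m : nat -> nat).

Definition gamma (i : nat) : R := ln (m i)%:R / ln (m i.-1)%:R.

Definition gamma_prod (k : nat) : R := \prod_(k.+1 <= i < d.+1) gamma i.

Definition p_ (k : nat) : nat :=
  get [set p : nat | (q ^ p)%:R <= (gamma_prod k)^-1 < (q ^ p.+1)%:R].

Definition a_ (k : nat) : R := (q ^ p_ k)%:R * gamma_prod k.

(* [sort] is stable, so that ties are ordered by increasing index *)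
Definition sigma (s t : nat) : nat :=
  nth 0%N (sort (fun i j => a_ i <= a_ j) (iota s (d - s))) (t - s).

Definition p_st (s t k : nat) : nat :=
  if k \in [seq sigma s u | u <- iota s (t.+1 - s)] then (p_ k).+1 else p_ k.

Definition delta (p s t : nat) : R :=
  if s == d then (q%:R - 1) ^+ 2 / q%:R ^+ p.+1
  else if t == s.-1 then
    (q%:R * a_ (sigma s s) - 1) * (q%:R - 1) / q%:R ^+ p.+1
  else if t == d.-1 then
    (1 - a_ (sigma s d.-1)) * (q%:R - 1) / q%:R ^+ p
  else (a_ (sigma s t.+1) - a_ (sigma s t)) * (q%:R - 1) / q%:R ^+ p.

Definition s_of (p : nat) : nat :=
  if (p <= p_ d.-1)%N then d
  else if (p_ 1 < p)%N then 1%N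
  else head 1%N [seq s <- iota 2 (d - 2) | (p_ s < p <= p_ s.-1)%N].

Definition pairs_at (p : nat) : seq (nat * nat) :=
  [seq (p, t) | t <- rev (iota (s_of p).-1 (d - s_of p).+1)].

(* the i-th pair, i >= 1; every p contributes at least one pair, hence the
   first i values of p are enough *)
Definition pair_ (i : nat) : nat * nat :=
  nth (0%N, 0%N) (flatten [seq pairs_at p | p <- iota 1 i]) i.-1.

Definition chi (i : nat) (x : Sigma d m) : nat :=
  let: (p, t) := pair_ i in
  if t == d.-1 then coord x p d
  else let k := sigma (s_of p) t.+1 in coord x (p - p_ k) k.

Definition N_ : nat := (p_ 1 + 1 + \sum_(1 <= k < d) (p_ 1 + 1 - p_ k))%N.

Definition delta_ (i : nat) : R :=
  if i == N_ then
    delta (p_ 1).+1 1 0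
    + limn (fun n => \sum_((p_ 1).+2 <= p < n) \sum_(0 <= t < d) delta p 1 t)
  else let: (p, t) := pair_ i in delta p (s_of p) t.

Definition omega (k : nat) : R :=
  if k == 1%N then \sum_(1 <= i < N_.+1) delta_ i
  else if k == N_.+1 then (q%:R * delta_ N_)^-1
  else (\sum_(k <= i < N_.+1) delta_ i) / (\sum_(k.-1 <= i < N_.+1) delta_ i).

Definition omega_tilde : R := \prod_(1 <= k < (N_ - d + 1).+1) omega k.

(* 1 / (omega_tilde_(N-d+1) omega_(N+1)) *)
Definition tree_exponent : R := (omega_tilde * omega N_.+1)^-1.

Section Subshift.

Variable Omega : set (Sigma d m).

Definition word (n : nat) (x : Sigma d m) : seq nat :=
  [seq chi i x | i <- iota 1 n].

Definition cyl (w : seq nat) : set (Sigma d m) :=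
  [set x | Omega x /\ word (size w) x = w].

(* w belongs to Pref_{chi_1, ..., chi_n}(Omega), where n = size w *)
Definition Pref (w : seq nat) : Prop :=
  exists2 x, Omega x & word (size w) x = w.

Definition Gamma (X : seq nat) : set (seq nat) :=
  [set w | [/\ exists l, size w = (N_ + l * d)%N, Pref w & prefix X w]].

(* The nested sum over the r letters following w, whose value at the leaves is
   t.  The sum over the letter that is the r'-th from the end (the last one
   being the first) is raised to the power omega_(N - r' + 1), except for the
   outermost one.  All letters are smaller than m 1, the largest m k. *)
Fixpoint nested_sum (t : seq nat -> R) (r : nat) (w : seq nat) : R :=
  if r is r'.+1 then
    \sum_(c < m 1 | `[< Pref (rcons w c) >])
      (if r' == 0%N then t (rcons w c)
       else nested_sum t r' (rcons w c) `^ omega (N_ - r' + 1))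
  else t w.

Definition tree_solution (X : seq nat) (t : seq nat -> R) : Prop :=
  (forall w, Gamma X w -> 1 <= t w <= (m d)%:R `^ (omega N_.+1 * d%:R)) /\
  (forall w, Gamma X w -> t w `^ tree_exponent = nested_sum t d w).

Definition t_empty (t : seq nat -> R) : R := nested_sum t N_ [::].

(* A_p(X_1 ... X_(p-1)) and A^(k)_p(X_1 ... X_(N+(k-1)d+p-1)), for a word w
   that extends their argument *)
Definition A_ (t : seq nat -> R) (p : nat) (w : seq nat) : R :=
  nested_sum t (N_ - p + 1) (take p.-1 w).

Definition Ak (t : seq nat -> R) (k p : nat) (w : seq nat) : R :=
  nested_sum t (d - p + 1) (take (N_ + k.-1 * d + p.-1) w).

Definition mu_cyl (t : seq nat -> R) (l : nat) (w : seq nat) : R :=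
  t (take N_ w) / t_empty t
  * (\prod_(2 <= p < N_.+1) A_ t p w `^ (omega p - 1))
  * \prod_(1 <= k < l.+1)
      (t (take (N_ + k * d) w)
       * t (take (N_ + k.-1 * d) w) `^ (- tree_exponent)
       * \prod_(2 <= p < d.+1) Ak t k p w `^ (omega (N_ - d + p) - 1)).

(* Partitions of Omega are sets of subsets of Omega. *)
Definition alpha (k p : nat) : set (set (Sigma d m)) :=
  [set C | exists2 x, Omega x & C = [set u | Omega u /\
     forall i l, (1 <= i <= p)%N -> (d - k + 1 <= l <= d)%N ->
       coord u i l = coord x i l]].

Definition join (P Q : set (set (Sigma d m))) : set (set (Sigma d m)) :=
  [set C | C !=set0 /\ exists A B, [/\ P A, Q B & C = A `&` B]].

Definition log_ (b : nat) (x : R) : R := ln x / ln b%:R.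

(* Borel probability measures on the closed set Omega are represented by the
   Borel probability measures mu on Sigma such that mu Omega = 1. *)
Definition entropy (mu : probability (SigmaB d m) R)
    (P : set (set (Sigma d m))) : R :=
  - \sum_(C \in P) (fine (mu C) * log_ (m d) (fine (mu C))).

Definition H_tilde (mu : probability (SigmaB d m) R) (s p : nat) : R :=
  \sum_(s.-1 <= t < d) delta p s t *
    entropy mu (join (alpha 1 p)
      (\big[join/[set Omega]]_(2 <= j < (d - s + 1).+1)
          alpha j (p - p_st s t (d - j + 1)))).

Definition S_ (mu : probability (SigmaB d m) R) : \bar R :=
  ((\sum_(1 <= p < (p_ d.-1).+1) H_tilde mu d p
    + \sum_(2 <= s < d) \sum_((p_ s).+1 <= p < (p_ s.-1).+1) H_tilde mu s p)%:E
   + \sum_((p_ 1).+1 <= p <oo) (H_tilde mu 1 p)%:E)%E.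

Definition is_maximizer (mu : probability (SigmaB d m) R) : Prop :=
  mu Omega = 1%E /\
  forall nu : probability (SigmaB d m) R, nu Omega = 1%E -> (S_ nu <= S_ mu)%E.

End Subshift.

(* P is the measure P_mu.  The word of the cylinder is x_1 ... x_n; the
   conditions i q^l <= n range over l = 0, ..., r. *)
Definition is_P_mu (mu P : probability (SigmaB d m) R) : Prop :=
  forall (n : nat) (x : Sigma d m),
    P [set u : Sigma d m | forall i, (1 <= i <= n)%N -> u i.-1 = x i.-1]
    = (\prod_(1 <= i < n.+1 | ~~ (q %| i)%N)
         fine (mu [set y : Sigma d m | forall l, (i * q ^ l <= n)%N ->
                                         y l = x (i * q ^ l).-1]))%:E.

Definition L_ (k n : nat) : nat :=
  if k == 1%N then n else `|Num.ceil (n%:R / gamma k : R)|%N.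

(* (L_k o ... o L_1)(n) *)
Definition L_comp (k n : nat) : nat := foldl (fun r j => L_ j r) n (iota 1 k).

Definition Bn (n : nat) (x : Sigma d m) : set (Sigma d m) :=
  [set u | forall k i, (1 <= k <= d)%N -> (1 <= i <= L_comp k n)%N ->
             coord u i k = coord x i k].

(* The infimum is m_1 ^ - sup {n | u \in B_n(x)}, and it is 0 if the supremum
   is infinite. *)
Definition dist (x u : Sigma d m) : R :=
  inf [set (m 1)%:R ^- n | n in [set n | Bn n x u]].

Definition diam (U : set (Sigma d m)) : R :=
  sup [set r | exists x y, [/\ U x, U y & r = dist x y]].

Definition diam_pow (s : R) (U : set (Sigma d m)) : R :=
  if `[< U = set0 >] then 0 else diam U `^ s.

Definition hausdorff_pre (s eps : R) (E : set (Sigma d m)) : \bar R :=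
  ereal_inf [set (\sum_(i <oo) (diam_pow s (U i))%:E)%E |
    U in [set U : nat -> set (Sigma d m) |
           E `<=` \bigcup_i U i /\ forall i, diam (U i) <= eps]].

Definition hausdorff_measure (s : R) (E : set (Sigma d m)) : \bar R :=
  ereal_sup [set hausdorff_pre s eps E | eps in [set eps | 0 < eps]].

Definition hausdorff_dim (E : set (Sigma d m)) : \bar R :=
  ereal_inf [set s%:E | s in [set s | 0 <= s /\ hausdorff_measure s E = 0%E]].

Definition measure_dim (nu : probability (SigmaB d m) R) : \bar R :=
  ereal_inf [set hausdorff_dim E |
    E in [set E : set (SigmaB d m) | measurable E /\ nu E = 1%E]].

Definition exact_dimensional (nu : probability (SigmaB d m) R) (D : R) : Prop :=
  {ae nu, forall x : SigmaB d m,
    (fun n : nat => - (n%:R^-1 * log_ (m 1) (fine (nu (Bn n x))))) @ \oo --> D}.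

End Sponge.

(* Main.v *)
(* The list chi_1, chi_2, ... turns S(Omega, mu) into the sum over i of
   (w_i - w_(i+1)) H(chi_1, ..., chi_i), for a nonincreasing sequence of weights
   w_i, and each exponent of the theorem is a ratio w_(i+1) / w_i.  With Z(u) the
   nested sum over the letters following a prefix u of length i, one has
   Z(u) = sum_c Z(uc) ^ (w_(i+2) / w_(i+1)), and the summands divided by Z(u) are
   the transition probabilities of a measure beta on Omega.  Summation by parts
   gives, up to a boundary term that tends to 0 for mu = beta and has the right
   sign in general,
     sum_i (w_i - w_(i+1)) H_i(mu)
       = w_1 ln Z(empty) - sum_i (w_i - w_(i+1)) KL_i(mu | beta),
   so beta is the only maximizer.  In the tree equation the right-hand side is
   monotone in t, which gives a solution, and passing to it contracts logarithms
   by 1/q once the exponent of the left-hand side is inverted, which gives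
   uniqueness.

   P_mu is a product measure along the chains {i q^l}.  The ball of radius
   m_1 ^ - n is, up to bounded shifts of n, a product of cylinders of beta whose
   lengths depend on i / n; Chernoff's bound and Borel-Cantelli give its
   logarithmic size.  As two balls are nested or disjoint, the Hausdorff dimension
   equals this local dimension. *)
From HB Require Import structures.
Require Import Defs.
From mathcomp Require Import all_boot all_order all_algebra.
From mathcomp Require Import all_classical all_reals all_analysis.
From mathcomp Require Import ring lra zify.
Import Order.TTheory GRing.Theory Num.Theory.
Import numFieldNormedType.Exports.
Local Open Scope classical_set_scope.
Local Open Scope ring_scope.

(** * Weights of the coordinate functions *)

(** If [chi_i] reads coordinate k at depth l of a chain, its weight is
    [w_i = (q - 1) ln m_d / (q^l ln m_k)]: this is what the definition of [a_k] amounts to. The same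
    number governs the geometry: a ball of radius [m_1^-n] sees [chi_i] along the chain of j iff
    [j q^(l-1) ln m_k <= n ln m_1], that is, iff j is at most n times a constant multiple of [w_i].
    So the list is ordered as balls see the letters, and one Abel sum gives both [S] and the local
    dimension. From index N - d + 1 on the list is d-periodic with [w_(i+d) = w_i / q]; this leaves
    finitely many exponents, yields the contraction by 1/q and forces the boundary terms to vanish.
    Ties between the [a_k] make consecutive weights equal, so the divergence from beta is controlled
    only at the lengths where the weight drops. It drops at the end of each row (the pairs with the
    same p), hence at arbitrarily large lengths, and additivity gives the shorter ones. *)

Section Combinatorics.
#[local] Set Default Proof Using "hd hq hm hmd".
Variables (R : realType) (d q : nat) (m : nat -> nat).
Hypotheses (hd : (2 <= d)%N) (hq : (2 <= q)%N)
  (hm : forall k, (1 <= k < d)%N -> (m k.+1 <= m k)%N) (hmd : (2 <= m d)%N).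

Local Notation pk := (p_ R d q m).
Local Notation ak := (a_ R d q m).
Local Notation sg := (sigma R d q m).
Local Notation so := (s_of R d q m).
Local Notation lnm k := (ln (m k)%:R : R).

Lemma m_le j k : (1 <= j)%N -> (j <= k)%N -> (k <= d)%N -> (m k <= m j)%N.
Proof.
move=> j1; elim: k => [|k IH]; first by rewrite leqn0 => /eqP ->.
rewrite leq_eqVlt => /orP[/eqP -> //|jk] kd.
by apply: leq_trans (IH jk (ltnW kd)); apply: hm; rewrite kd (leq_trans j1).
Qed.

Lemma m_ge2 k : (1 <= k)%N -> (k <= d)%N -> (2 <= m k)%N.
Proof. by move=> k1 kd; exact: leq_trans hmd (m_le k d k1 kd (leqnn d)). Qed.

Lemma lnm_gt0 k : (1 <= k)%N -> (k <= d)%N -> 0 < lnm k.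
Proof. by move=> k1 kd; rewrite ln_gt0// ltr1n m_ge2. Qed.

Lemma lnm_le j k : (1 <= j)%N -> (j <= k)%N -> (k <= d)%N -> lnm k <= lnm j.
Proof.
move=> j1 jk kd; rewrite ler_ln ?posrE ?ltr0n ?ler_nat ?m_le//.
- by apply: ltnW; apply: m_ge2 => //; exact: leq_trans jk.
- by apply: ltnW; apply: m_ge2 => //; exact: leq_trans jk kd.
Qed.

Lemma gamma_prodE k : (1 <= k)%N -> (k <= d)%N ->
  gamma_prod R d m k = lnm d / lnm k.
Proof.
move=> k1; rewrite leq_eqVlt => /orP[/eqP ->|kd].
  by rewrite /gamma_prod big_geq// divff// gt_eqF// lnm_gt0//; lia.
rewrite /gamma_prod big_add1/=.
apply: (telescope_prodf_eq (fun i => lnm i)) => // i /andP[ki id'].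
by rewrite gt_eqF// lnm_gt0//; lia.
Qed.

Lemma q_gt0 : 0 < q%:R :> R. Proof. by rewrite ltr0n; lia. Qed.
Lemma q_gt1 : 1 < q%:R :> R. Proof. by rewrite ltr1n. Qed.
Lemma q_neq0 : q%:R != 0 :> R. Proof. by rewrite gt_eqF// q_gt0. Qed.

(** [p_] is chosen by [get], so its property rests on existence: the product of the [gamma_i]
    telescopes to [ln m_d / ln m_k <= 1], and the least n with [ln m_k / ln m_d < q^(n+1)]
    qualifies. *)
Lemma p_P k : (1 <= k)%N -> (k <= d)%N ->
  (q ^ pk k)%:R <= lnm k / lnm d < (q ^ (pk k).+1)%:R.
Proof.
move=> k1 kd; rewrite /p_ gamma_prodE//.
have := @getPex _ [set p : nat | (q ^ p)%:R <= (lnm d / lnm k)^-1 < (q ^ p.+1)%:R].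
rewrite /= invf_div; apply.
have d0 : 0 < lnm d by apply: lnm_gt0; lia.
set x := lnm k / lnm d.
have x1 : 1 <= x by rewrite ler_pdivlMr// mul1r lnm_le.
have ex : exists n, x < (q ^ n.+1)%:R.
  exists (Num.truncn x).
  apply: lt_le_trans (truncnS_gt x) _; rewrite ler_nat.
  by apply: ltnW; apply: ltn_expl.
exists (ex_minn ex); case: ex_minnP => n nx nmin; rewrite nx andbT.
case: n nx nmin => [|n] nx nmin; first by rewrite expn0.
by rewrite leNgt; apply/negP => /nmin; rewrite ltnn.
Qed.

Lemma a_E k : (1 <= k)%N -> (k <= d)%N -> ak k = (q ^ pk k)%:R * (lnm d / lnm k).
Proof. by move=> k1 kd; rewrite /a_ gamma_prodE. Qed.

Lemma a_le1 k : (1 <= k)%N -> (k <= d)%N -> ak k <= 1.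
Proof.
move=> k1 kd; rewrite a_E// -ler_pdivlMr ?divr_gt0 ?lnm_gt0//; last lia.
by rewrite mul1r invf_div; case/andP: (p_P k k1 kd).
Qed.

Lemma a_gt k : (1 <= k)%N -> (k <= d)%N -> 1 < q%:R * ak k.
Proof.
move=> k1 kd; rewrite a_E// mulrA -natrM -expnS -ltr_pdivrMr ?divr_gt0 ?lnm_gt0//; last lia.
by rewrite mul1r invf_div; case/andP: (p_P k k1 kd).
Qed.

Lemma a_gt0 k : (1 <= k)%N -> (k <= d)%N -> 0 < ak k.
Proof. by move=> k1 kd; have := a_gt k k1 kd; rewrite -(pmulr_rgt0 (ak k) q_gt0); apply: lt_trans. Qed.

Lemma p_le j k : (1 <= j)%N -> (j <= k)%N -> (k <= d)%N -> (pk k <= pk j)%N.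
Proof.
move=> j1 jk kd.
have /andP[h1 _] := p_P k (leq_trans j1 jk) kd.
have /andP[_ h2] := p_P j j1 (leq_trans jk kd).
have h3 : lnm k / lnm d <= lnm j / lnm d.
  by rewrite ler_pM2r ?lnm_le// invr_gt0 lnm_gt0//; lia.
have := le_lt_trans (le_trans h1 h3) h2.
by rewrite ltr_nat ltn_exp2l.
Qed.

Lemma p_d : pk d = 0%N.
Proof.
have d0 : (1 <= d)%N by lia.
have /andP[h1 _] := p_P d d0 (leqnn d); move: h1.
rewrite divff ?gt_eqF ?lnm_gt0//.
case: (pk d) => // n; rewrite lern1 expnS => h.
have : (2 <= q * q ^ n)%N by rewrite (leq_trans hq)// leq_pmulr// expn_gt0; lia.
lia.
Qed.

Lemma a_d : ak d = 1.
Proof. by rewrite a_E ?p_d ?divff ?mulr1//; [rewrite gt_eqF// lnm_gt0//; lia|lia]. Qed.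

(* With equal [p_], the order of the [a_] is that of the indices, ties included *)
Lemma a_le k k' : (1 <= k)%N -> (k <= k')%N -> (k' <= d)%N -> pk k = pk k' ->
  ak k <= ak k'.
Proof.
move=> k1 kk kd e.
have k0 : 0 < lnm k by apply: lnm_gt0 => //; lia.
have k0' : 0 < lnm k' by apply: lnm_gt0 => //; lia.
have d0 : 0 < lnm d by apply: lnm_gt0 => //; lia.
rewrite !a_E ?e//; [|lia..].
rewrite ler_pM2l; last by rewrite ltr0n expn_gt0; lia.
by rewrite ler_pM2l// lef_pV2 ?posrE// lnm_le.
Qed.

Local Definition srt s := sort (fun i j => ak i <= ak j) (iota s (d - s)).

Local Lemma mem_srt s k : (k \in srt s) = (s <= k < s + (d - s))%N.
Proof. by rewrite mem_sort mem_iota. Qed.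

Local Lemma size_srt s : size (srt s) = (d - s)%N.
Proof. by rewrite size_sort size_iota. Qed.

Local Lemma a_total : total (fun i j => ak i <= ak j).
Proof. by move=> i j; exact: le_total. Qed.

Lemma sigma_in s u : (s <= u < d)%N -> (s <= sg s u < d)%N.
Proof.
move=> /andP[su ud].
have : sg s u \in srt s by apply: mem_nth; rewrite size_srt; lia.
rewrite mem_srt; lia.
Qed.

Lemma sigma_inj s u v : (s <= u < d)%N -> (s <= v < d)%N ->
  sg s u = sg s v -> u = v.
Proof.
move=> /andP[su ud] /andP[sv vd] /eqP.
rewrite /sigma nth_uniq ?size_srt ?sort_uniq ?iota_uniq//; [|lia..].
move=> /eqP; lia.
Qed.

Lemma sigma_surj s k : (s <= k < d)%N -> exists2 u, (s <= u < d)%N & sg s u = k.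
Proof.
move=> skd; have ks : k \in srt s by rewrite mem_srt; lia.
exists (s + index k (srt s))%N.
  by move: ks; rewrite -index_mem size_srt; lia.
by rewrite /sigma addKn nth_index.
Qed.

Lemma a_sigma s u v : (s <= u)%N -> (u <= v)%N -> (v < d)%N ->
  ak (sg s u) <= ak (sg s v).
Proof.
move=> su uv vd; rewrite /sigma.
have tr : transitive (fun i j => ak i <= ak j) by move=> y x z; exact: le_trans.
have := sorted_leq_nth tr (fun i => lexx (ak i)) 0%N (sort_sorted a_total (iota s (d - s))).
by apply; rewrite ?inE ?size_srt; lia.
Qed.

(** Stability of [sort]: its result is sorted for the lexicographic order on ([a_], index), so among
    equal values the smaller index comes first. *)
Lemma sigma_index s k k' u v : (s <= u < d)%N -> (s <= v < d)%N ->
  sg s u = k -> sg s v = k' -> (k < k')%N -> ak k <= ak k' -> (u < v)%N.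
Proof.
move=> usd vsd <- <- kk aa.
have trl : transitive ltn by move=> y x z; exact: ltn_trans.
have := sort_stable a_total trl (iota_ltn_sorted s (d - s)).
set r := SimplRel _ => srtd.
have rt : transitive r.
  move=> y x z /=/andP[xy /implyP h1] /andP[yz /implyP h2].
  rewrite (le_trans xy yz)/=; apply/implyP => zx.
  apply: ltn_trans (h1 (le_trans yz zx)) (h2 (le_trans zx xy)).
rewrite ltnNge; apply/negP; rewrite leq_eqVlt => /orP[/eqP e|vu].
  by move: kk; rewrite e ltnn.
have := sorted_ltn_nth rt 0%N srtd.
move=> /(_ (v - s)%N (u - s)%N).
rewrite !inE !size_srt => /(_ _ _ _)/andP[]; [lia..|].
rewrite -!/(sg s _) => h /implyP/(_ aa) h'.
by move: kk h'; rewrite /sigma /=; lia.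
Qed.

Lemma s_of_le p : (so p <= d)%N /\ (1 <= so p)%N.
Proof.
rewrite /s_of; case: ifP => _; first lia.
case: ifP => _; first lia.
set f := [seq _ <- _ | _].
have : all (fun s => (1 <= s <= d)%N) f.
  apply/allP => s; rewrite mem_filter mem_iota; lia.
by case: f => [|s f] /=; [lia|case/andP; lia].
Qed.

(** As [p_k] is nonincreasing in k, s(p) is the least k with [p_k < p], where [p_d = 0]. This form
    replaces the case distinction of the definition. *)
Lemma s_ofP p k : (1 <= p)%N -> (1 <= k)%N -> (k < d)%N ->
  (so p <= k)%N = (pk k < p)%N.
Proof.
move=> p1 k1 kd; rewrite /s_of; case: ifP => h1.
  have := p_le k d.-1; rewrite k1 => /(_ isT); lia.
case: ifP => h2.
  have := p_le 1 k; lia.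
have kex : exists s, (1 <= s < d)%N && (pk s < p)%N by exists d.-1; lia.
set f := [seq _ <- _ | _].
have fP s : s \in f -> [/\ (2 <= s < d)%N, (pk s < p)%N & (p <= pk s.-1)%N].
  rewrite mem_filter mem_iota => /andP[/andP[-> ->]]; split => //; lia.
have : head 1%N f \in f.
  have [s /andP[sd sp] smin] := ex_minnP kex.
  have s1 : s <> 1%N by move=> e; rewrite e h2 in sp.
  have : s \in f.
    rewrite mem_filter mem_iota sp/=; apply/andP; split; last lia.
    rewrite leqNgt; apply/negP => sp'.
    have := smin s.-1; rewrite sp' andbT => /(_ _) h; have := h ltac:(lia); lia.
  by case: f fP => //= a l _ _; rewrite inE eqxx.
move=> /fP; set s := head 1%N f => -[sd sp sp'].
case: (leqP s k) => sk.
  by symmetry; apply: leq_ltn_trans sp; apply: p_le => //; lia.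
symmetry; apply/negbTE; rewrite -leqNgt (leq_trans sp')//.
apply: p_le => //; lia.
Qed.

Definition pair_coord (p t : nat) : nat :=
  if t == d.-1 then d else sigma R d q m (s_of R d q m p) t.+1.

(** The quantity whose successive differences along the list are the [delta]; the value [a_d = 1]
    covers the pairs with t = d - 1. *)
Definition pair_weight (p t : nat) : R :=
  (q%:R - 1) * a_ R d q m (pair_coord p t) / q%:R ^+ p.

(** Number of pairs in the rows before p; the pair (p, t) has index [pair_rank p + (d - t)]. *)
Definition pair_rank (p : nat) : nat :=
  \sum_(1 <= p' < p) (d - s_of R d q m p' + 1).

Definition weight (i : nat) : R :=
  pair_weight (pair_ R d q m i).1 (pair_ R d q m i).2.

Definition valid (p t : nat) : bool :=
  [&& (1 <= p)%N, (so p <= t.+1)%N & (t < d)%N].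

Lemma pair_rankS p : (1 <= p)%N -> pair_rank p.+1 = (pair_rank p + (d - so p + 1))%N.
Proof. by move=> p1; rewrite /pair_rank big_nat_recr. Qed.

Lemma pair_rank1 : pair_rank 1 = 0%N.
Proof. by rewrite /pair_rank big_geq. Qed.

Lemma pair_rank_ge p : (p.-1 <= pair_rank p)%N.
Proof.
elim: p => // p IH; case: (posnP p) => [->//|p0].
rewrite pair_rankS//=; lia.
Qed.

Local Lemma size_pairs_at p : size (pairs_at R d q m p) = (d - so p + 1)%N.
Proof. rewrite /pairs_at size_map size_rev size_iota; lia. Qed.

Lemma pair_E p t : valid p t ->
  pair_ R d q m (pair_rank p + (d - t)) = (p, t).
Proof.
case/and3P=> p1 st td.
have [sd s1] := s_of_le p.
rewrite /pair_; set i := (pair_rank p + (d - t))%N.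
have ip : (p <= i)%N by have := pair_rank_ge p; rewrite /i; lia.
have -> : iota 1 i = iota 1 p.-1 ++ iota p (i - p.-1).
  by rewrite (_ : i = p.-1 + (i - p.-1))%N ?iotaD; [congr (_ ++ iota _ _); lia|lia].
have -> : (i - p.-1 = (i - p).+1)%N by lia.
rewrite map_cat flatten_cat /= nth_cat.
have sz : size (flatten [seq pairs_at R d q m p' | p' <- iota 1 p.-1]) = pair_rank p.
  rewrite size_flatten /shape -map_comp /pair_rank /index_iota subn1 sumnE big_map.
  by apply: eq_bigr => j _ /=; rewrite size_pairs_at.
have i1 : (i.-1 = pair_rank p + (d - t.+1))%N by rewrite /i; lia.
rewrite sz i1 ltnNge leq_addr/= addKn nth_cat size_pairs_at.
rewrite ifT; last lia.
rewrite /pairs_at (nth_map 0%N) ?size_rev ?size_iota; last lia.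
rewrite nth_rev ?size_iota; last lia.
by rewrite nth_iota; [congr (_, _); lia|lia].
Qed.

Lemma pair_surj i : (1 <= i)%N ->
  exists p t, valid p t /\ i = (pair_rank p + (d - t))%N.
Proof.
move=> i1.
have ex : exists p, (i <= pair_rank p.+1)%N.
  by exists i; rewrite (leq_trans _ (pair_rank_ge _)).
have [p ip pmin] := ex_minnP ex.
have p1 : (1 <= p)%N by case: p ip {pmin} => //; rewrite pair_rank1; lia.
have ltp : (pair_rank p < i)%N.
  rewrite ltnNge; apply/negP; move: p1 pmin; case: p {ip} => // p _ pmin /pmin.
  by rewrite ltnn.
have [sd s1] := s_of_le p.
move: ip; rewrite pair_rankS// => ip.
exists p, (d - (i - pair_rank p))%N; rewrite /valid p1/=; split; lia.
Qed.

Variant pair_spec (i : nat) : nat * nat -> Prop :=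
  PairSpec p t of valid p t & i = (pair_rank p + (d - t))%N : pair_spec i (p, t).

Lemma pair_P i : (1 <= i)%N -> pair_spec i (pair_ R d q m i).
Proof.
by move=> /pair_surj[p [t [v ->]]]; rewrite pair_E//; exact: PairSpec.
Qed.

Lemma pair_succ_same p t i : pair_ R d q m i = (p, t) -> (1 <= i)%N ->
  (so p <= t)%N -> pair_ R d q m i.+1 = (p, t.-1).
Proof.
move=> + i1; case: (pair_P i i1) => p' t' v -> [e1 e2] st; subst p' t'.
have [sd s1] := s_of_le p.
case/and3P: v => p1 _ td.
rewrite -addnS (_ : (d - t).+1 = d - t.-1)%N; last lia.
by apply: pair_E; rewrite /valid p1; lia.
Qed.

Lemma pair_succ_next p t i : pair_ R d q m i = (p, t) -> (1 <= i)%N ->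
  (t < so p)%N -> pair_ R d q m i.+1 = (p.+1, d.-1).
Proof.
move=> + i1; case: (pair_P i i1) => p' t' v -> [e1 e2] ts; subst p' t'.
have [sd s1] := s_of_le p.
case/and3P: v => p1 st td.
have [sd' s1'] := s_of_le p.+1.
have -> : ((pair_rank p + (d - t)).+1 = pair_rank p.+1 + (d - d.-1))%N.
  by rewrite pair_rankS//; lia.
apply: pair_E; rewrite /valid; lia.
Qed.

Lemma pair_coord_range p t : valid p t -> (so p <= pair_coord p t <= d)%N.
Proof.
case/and3P=> p1 st td; have [sd s1] := s_of_le p; rewrite /pair_coord.
case: eqP => [_|tn]; first by rewrite sd leqnn.
have /andP[-> /ltnW ->//] := sigma_in (so p) t.+1 ltac:(lia).
Qed.

Lemma pair_coord_ge1 p t : valid p t -> (1 <= pair_coord p t <= d)%N.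
Proof. by move=> /pair_coord_range; have := s_of_le p; lia. Qed.

Lemma pair_coord_p p t : valid p t -> (pk (pair_coord p t) < p)%N.
Proof.
move=> v; have := pair_coord_range _ _ v; case/and3P: v => p1 st td.
move=> /andP[h1]; rewrite leq_eqVlt => /orP[/eqP ->|h2]; first by rewrite p_d.
by rewrite -s_ofP//; have := s_of_le p; lia.
Qed.

Lemma chi_E p t i x : pair_ R d q m i = (p, t) ->
  chi R d q m i x = Defs.coord x (p - pk (pair_coord p t)) (pair_coord p t).
Proof.
by move=> e; rewrite /chi e /pair_coord; case: eqP => // _; rewrite p_d subn0.
Qed.

(** Depth l of coordinate k is read in row [p = l + p_k], where [p_k < p] gives [s(p) <= k]; so k is
    [sigma_s(u)] for some u, and t = u - 1. With [pair_coord_inj], every entry of a sequence is read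
    by exactly one [chi_i]. *)
Lemma coord_pair l k : (1 <= l)%N -> (1 <= k)%N -> (k <= d)%N ->
  exists i p t, [/\ (1 <= i)%N, pair_ R d q m i = (p, t), valid p t,
    pair_coord p t = k & (p - pk k = l)%N].
Proof.
move=> l1 k1; rewrite leq_eqVlt => /orP[/eqP ->|kd].
  have v : valid l d.-1.
    by rewrite /valid l1; have := s_of_le l; lia.
  exists (pair_rank l + (d - d.-1))%N, l, d.-1.
  rewrite pair_E// /pair_coord eqxx p_d; split => //; lia.
have p1 : (1 <= l + pk k)%N by lia.
have sk : (so (l + pk k) <= k)%N by rewrite s_ofP//; lia.
have [u usd uk] := sigma_surj (so (l + pk k)) k ltac:(lia).
have s1 := s_of_le (l + pk k).
have v : valid (l + pk k) u.-1 by rewrite /valid; lia.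
exists (pair_rank (l + pk k) + (d - u.-1))%N, (l + pk k)%N, u.-1.
rewrite pair_E// /pair_coord; split => //; [lia| |lia].
rewrite ifF; last lia.
by rewrite prednK//; lia.
Qed.

Lemma pair_coord_inj p t p' t' : valid p t -> valid p' t' ->
  pair_coord p t = pair_coord p' t' ->
  (p - pk (pair_coord p t) = p' - pk (pair_coord p' t'))%N ->
  p = p' /\ t = t'.
Proof.
move=> v v' e; rewrite e => e'.
have pp : p = p'.
  by have := pair_coord_p _ _ v; have := pair_coord_p _ _ v'; rewrite e; lia.
split => //; subst p'.
case/and3P: v => p1 st td; case/and3P: v' => _ st' td'; have [sd s1] := s_of_le p.
move: e; rewrite /pair_coord; case: eqP => h1; case: eqP => h2 //.
- by rewrite h1 h2.
- by have := sigma_in (so p) t'.+1 ltac:(lia); lia.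
- by have := sigma_in (so p) t.+1 ltac:(lia); lia.
- by move=> /sigma_inj h; have := h ltac:(lia) ltac:(lia); lia.
Qed.

Local Notation N := (N_ R d q m).
Local Notation pair := (pair_ R d q m).
Local Notation w := weight.

Lemma pair_weight_gt0 p t : valid p t -> 0 < pair_weight p t.
Proof.
move=> v; have /andP[k1 kd] := pair_coord_ge1 _ _ v.
by rewrite /pair_weight divr_gt0 ?exprn_gt0 ?q_gt0// mulr_gt0 ?subr_gt0 ?q_gt0 ?q_gt1// a_gt0.
Qed.

Lemma weight_gt0 i : (1 <= i)%N -> 0 < w i.
Proof. by rewrite /weight => /pair_P[p t v _]; exact: pair_weight_gt0. Qed.

Lemma pair_weight_last p : pair_weight p d.-1 = (q%:R - 1) / q%:R ^+ p.
Proof. by rewrite /pair_weight /pair_coord eqxx a_d mulr1. Qed.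

(** Within a row t decreases by 1 and the difference is one of consecutive values of [a_]. At the
    end of a row the successor is (p + 1, d - 1), of weight [(q - 1) / q^(p+1)], which produces the
    factor [q a - 1]. *)
Lemma delta_weight i : (1 <= i)%N ->
  delta R d q m (pair i).1 (so (pair i).1) (pair i).2 = w i - w i.+1.
move=> i1; case e : (pair i) => [p t] /=.
have v : valid p t by move: e; case: (pair_P i i1) => p' t' v _ [<- <-].
case/and3P: v => p1 st td; have [sd s1] := s_of_le p.
have qp : q%:R ^+ p != 0 :> R by rewrite expf_neq0 ?q_neq0.
rewrite /weight e /= /delta.
case: (leqP (so p) t) => ts; last first.
  rewrite (pair_succ_next p t)//= pair_weight_last.
  have -> : t = (so p).-1 by lia.
  rewrite eqxx /pair_weight /pair_coord prednK//.
  case: eqP => sd'.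
    by rewrite sd' eqxx a_d [q%:R ^+ p.+1]exprS; field; rewrite q_neq0 qp.
  rewrite ifF; last lia.
  by rewrite exprS; field; rewrite q_neq0 qp.
rewrite (pair_succ_same p t)//=.
rewrite ifF; last lia.
rewrite ifF; last lia.
rewrite /pair_weight /pair_coord (_ : (t.-1 == d.-1) = false); last lia.
rewrite prednK; last lia.
by case: (t =P d.-1) => [->|_]; rewrite ?a_d; field.
Qed.

Lemma weight_le i : (1 <= i)%N -> w i.+1 <= w i.
Proof.
move=> i1; rewrite -subr_ge0 -delta_weight//; case: (pair_P i i1) => p t v _ /=.
case/and3P: v => p1 st td; have [sd s1] := s_of_le p.
rewrite /delta; case: ifP => sd'.
  by rewrite divr_ge0 ?exprn_ge0 ?subr_ge0 1?ltW ?q_gt0 ?q_gt1.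
case: ifP => st'.
  have /andP[h1 h2] := sigma_in (so p) (so p) ltac:(lia).
  rewrite divr_ge0 ?exprn_ge0 1?ltW ?q_gt0// mulr_gt0 ?subr_gt0 ?q_gt0 ?q_gt1//.
  by apply: a_gt; lia.
case: ifP => td'.
  have /andP[h1 h2] := sigma_in (so p) d.-1 ltac:(lia).
  apply: divr_ge0; [apply: mulr_ge0|]; rewrite ?exprn_ge0 ?subr_ge0 ?(ltW q_gt0) ?(ltW q_gt1)//.
  by apply: a_le1; lia.
apply: divr_ge0; [apply: mulr_ge0|]; rewrite ?exprn_ge0 ?subr_ge0 ?(ltW q_gt0) ?(ltW q_gt1)//.
by apply: a_sigma; lia.
Qed.

(** At the end of a row the drop is strict because [q a_k > 1]. Uniqueness of the maximizer is read
    off at these indices. *)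
Lemma weight_lt p t i : pair i = (p, t) -> (1 <= i)%N -> t = (so p).-1 -> w i.+1 < w i.
Proof.
move=> e i1 et; rewrite -subr_gt0 -delta_weight// e /= /delta.
have v : valid p t by move: e; case: (pair_P i i1) => p' t' v _ [<- <-].
case/and3P: v => p1 st td; have [sd s1] := s_of_le p.
case: ifP => sd'.
  by rewrite divr_gt0 ?exprn_gt0 ?subr_gt0 ?q_gt0 ?q_gt1.
rewrite et eqxx divr_gt0 ?exprn_gt0 ?q_gt0// mulr_gt0 ?subr_gt0 ?q_gt0 ?q_gt1//.
have /andP[h1 h2] := sigma_in (so p) (so p) ltac:(lia).
by apply: a_gt; lia.
Qed.

(** The factor [q^(p_k)] of [a_k] turns the row p into the depth [p - p_k]: the weight depends only
    on the coordinate and the depth that are read. *)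
Lemma pair_weight_ln p t : valid p t ->
  pair_weight p t * lnm (pair_coord p t) =
  (q%:R - 1) / q%:R ^+ (p - pk (pair_coord p t)) * lnm d.
Proof.
move=> v; have /andP[k1 kd] := pair_coord_ge1 _ _ v.
have h := pair_coord_p _ _ v.
rewrite /pair_weight a_E//.
have k0 : lnm (pair_coord p t) != 0 by rewrite gt_eqF ?lnm_gt0.
have -> : q%:R ^+ p = q%:R ^+ pk (pair_coord p t) * q%:R ^+ (p - pk (pair_coord p t)) :> R.
  by rewrite -exprD; congr (_ ^+ _); lia.
have A : q%:R ^+ pk (pair_coord p t) != 0 :> R by rewrite expf_neq0 ?q_neq0.
have B : q%:R ^+ (p - pk (pair_coord p t)) != 0 :> R by rewrite expf_neq0 ?q_neq0.
rewrite natrX; move: A B k0; move: (q%:R ^+ pk _) (q%:R ^+ (p - _)) (lnm d) (lnm _).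
by move=> x y z u x0 y0 u0; field; rewrite x0 y0 u0.
Qed.

Lemma s_of_gt p : (pk 1 < p)%N -> so p = 1%N.
Proof.
move=> h; have := s_ofP p 1; have := s_of_le p.
rewrite h => [[h1 h2]] /(_ ltac:(lia) isT ltac:(lia)); lia.
Qed.

(** Row p has one pair for d and one for each k < d with [p_k < p]. Counting these by k instead of
    by p shows that N is the end of row [p_1 + 1], the first row with s = 1 and hence with d
    pairs. *)
Lemma N_E : N = (pair_rank (pk 1).+1 + d)%N.
Proof.
rewrite /N_ /pair_rank.
have -> : \sum_(1 <= p' < (pk 1).+1) (d - so p' + 1)%N =
    (\sum_(1 <= p' < (pk 1).+1) \sum_(1 <= k < d) (pk k < p')%N + pk 1)%N.
  rewrite -[X in _ = (_ + X)%N](_ : \sum_(1 <= p' < (pk 1).+1) 1 = _)%N; last first.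
    by rewrite sum_nat_const_nat; lia.
  rewrite -big_split; apply: eq_big_nat => p /andP[p1 _]; congr addn.
  have [sd s1] := s_of_le p.
  rewrite (@big_cat_nat _ _ _ (so p)) //=.
  rewrite big_nat big1 ?add0n; last first.
    by move=> k /andP[k1 ks]; rewrite -s_ofP//; [lia|lia].
  rewrite (eq_big_nat _ _ (F2 := fun => 1%N)); last first.
    by move=> k /andP[k1 ks]; rewrite -s_ofP//; lia.
  by rewrite sum_nat_const_nat; lia.
rewrite exchange_big_nat/=.
have -> : \sum_(1 <= k < d) (pk 1 + 1 - pk k)%N =
    (\sum_(1 <= k < d) \sum_(1 <= p' < (pk 1).+1) (pk k < p')%N + (d - 1))%N.
  rewrite -[X in _ = (_ + X)%N](_ : \sum_(1 <= p' < d) 1 = _)%N; last first.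
    by rewrite sum_nat_const_nat; lia.
  rewrite -big_split; apply: eq_big_nat => k /andP[k1 kd] /=.
  have h : (pk k <= pk 1)%N by apply: p_le => //; lia.
  rewrite (@big_cat_nat _ _ _ (pk k).+1) //=.
  rewrite big_nat big1 ?add0n; last first.
    by move=> p /andP[p1 ks]; lia.
  rewrite (eq_big_nat _ _ (F2 := fun => 1%N)); last first.
    by move=> p /andP[p1 ks]; lia.
  by rewrite sum_nat_const_nat; lia.
lia.
Qed.

Lemma pair_rank_add p : (pk 1 < p)%N -> pair_rank p.+1 = (pair_rank p + d)%N.
Proof. by move=> h; rewrite pair_rankS ?s_of_gt//; lia. Qed.

Lemma pair_tail i : (pair_rank (pk 1).+1 < i)%N ->
  (pk 1 < (pair i).1)%N.
Proof.
move=> h; have i1 : (1 <= i)%N by lia.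
move: h; case: (pair_P i i1) => p t /and3P[p1 st td] -> /= h.
rewrite ltnNge; apply/negP => pp.
have : (pair_rank p.+1 <= pair_rank (pk 1).+1)%N.
  rewrite /pair_rank [leqRHS](@big_cat_nat _ _ _ p.+1)//=; lia.
rewrite pair_rankS//; lia.
Qed.

Lemma pair_add_d i : (N - d < i)%N ->
  pair (i + d) = ((pair i).1.+1, (pair i).2).
Proof.
rewrite N_E addnK => h; have := pair_tail i h.
have i1 : (1 <= i)%N by lia.
case: (pair_P i i1) => p t /and3P[p1 st td] -> /= hp.
rewrite addnAC -pair_rank_add//; apply: pair_E.
by rewrite /valid /= s_of_gt//; lia.
Qed.

(** Beyond row [p_1] always s = 1, so the same permutation [sigma_1] orders each row, and d steps
    only change p to p + 1. *)
Lemma weight_add_d i : (N - d < i)%N -> w (i + d) = w i / q%:R.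
Proof.
move=> h; rewrite /weight pair_add_d//.
have hp := pair_tail i; rewrite -[X in (X < i)%N](addnK d) -N_E in hp.
have {}hp := hp h.
rewrite /pair_weight /pair_coord !s_of_gt//=; last lia.
by rewrite exprS invfM mulrA mulrAC.
Qed.

Lemma pair_coord_add_d i : (N - d < i)%N ->
  pair_coord (pair (i + d)).1 (pair (i + d)).2 = pair_coord (pair i).1 (pair i).2.
Proof.
move=> h; rewrite pair_add_d//.
have hp := pair_tail i; rewrite -[X in (X < i)%N](addnK d) -N_E in hp.
have {}hp := hp h.
by rewrite /pair_coord !s_of_gt//=; last lia.
Qed.

Lemma N_ge : (d <= N)%N. Proof. by rewrite N_E leq_addl. Qed.

Lemma pair_N : pair N = ((pk 1).+1, 0%N).
Proof.
rewrite N_E -[X in (_ + X)%N](subn0 d); apply: pair_E.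
by rewrite /valid s_of_gt//; lia.
Qed.

Lemma sum_pairs p (F : nat -> R) : (1 <= p)%N ->
  \sum_((so p).-1 <= t < d) delta R d q m p (so p) t * F (pair_rank p + (d - t))%N =
  \sum_((pair_rank p).+1 <= i < (pair_rank p.+1).+1) (w i - w i.+1) * F i.
Proof.
move=> p1; have [sd s1] := s_of_le p.
have shift a b (G : nat -> R) : \sum_(a <= i < b) G i = \sum_(0 <= i < b - a) G (i + a)%N.
  by rewrite -{1}[a]add0n big_addn.
rewrite big_nat_rev /= shift [RHS]shift pair_rankS//.
rewrite (_ : (pair_rank p + (d - so p + 1)).+1 - (pair_rank p).+1 = d - (so p).-1)%N; last lia.
apply: eq_big_nat => i hi.
have v : valid p ((so p).-1 + d - (i + (so p).-1).+1) by rewrite /valid; lia.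
have e := pair_E _ _ v; set j := (pair_rank p + _)%N in e *.
have j1 : (1 <= j)%N by rewrite /j; lia.
have -> : (i + (pair_rank p).+1 = j)%N by rewrite /j; lia.
by rewrite -delta_weight// e.
Qed.

Lemma sum_delta p : (1 <= p)%N ->
  \sum_((so p).-1 <= t < d) delta R d q m p (so p) t =
  (q%:R - 1) / q%:R ^+ p - (q%:R - 1) / q%:R ^+ p.+1.
Proof.
move=> p1; have [sd s1] := s_of_le p.
have := sum_pairs p (fun => 1) p1.
under eq_bigr do rewrite mulr1.
move=> ->; under eq_bigr do rewrite mulr1.
have wp p' : (1 <= p')%N -> w (pair_rank p').+1 = (q%:R - 1) / q%:R ^+ p'.
  move=> p1'; have v : valid p' d.-1 by have := s_of_le p'; rewrite /valid; lia.
  by rewrite /weight (_ : (pair_rank p').+1 = pair_rank p' + (d - d.-1))%N ?pair_E ?pair_weight_last//; lia.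
rewrite -!wp//.
under eq_bigr do rewrite -opprB.
by rewrite sumrN telescope_sumr ?opprB// pair_rankS//; lia.
Qed.

(** Row p of the [delta] sums to [(q - 1) / q^p - (q - 1) / q^(p+1)]. The rows after [p_1 + 1]
    therefore add up to [w (N+1)], which cancels in the remaining term [w N - w (N+1)]. *)
Lemma delta_N : delta_ R d q m N = w N.
Proof.
have N1 : (1 <= N)%N by rewrite (leq_trans _ N_ge)//; lia.
rewrite /delta_ eqxx.
have := delta_weight N N1; rewrite pair_N /= s_of_gt// => ->.
suff -> : limn (fun n => \sum_((pk 1).+2 <= p < n) \sum_(0 <= t < d) delta R d q m p 1 t) = w N.+1.
  by rewrite subrK.
have wN : w N.+1 = (q%:R - 1) / q%:R ^+ (pk 1).+2.
  by rewrite /weight (pair_succ_next (pk 1).+1 0) ?pair_N ?s_of_gt//= pair_weight_last.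
apply: cvg_lim => //.
have lim0 : (q%:R ^+ n)^-1 @[n --> \oo] --> (0 : R).
  have := @cvg_geometric R 1 (q%:R^-1); rewrite ger0_norm ?invr_ge0 ?(ltW q_gt0)//.
  move=> /(_ ltac:(by rewrite invf_lt1 ?q_gt0 ?q_gt1)) h.
  by apply: cvg_trans h; apply: near_eq_cvg; near=> n; rewrite /= mul1r exprVn.
rewrite wN.
have -> : (q%:R - 1) / q%:R ^+ (pk 1).+2 = (q%:R - 1) / q%:R ^+ (pk 1).+2 - (q%:R - 1) * (0 : R).
  by rewrite mulr0 subr0.
have L : ((q%:R - 1) / q%:R ^+ (pk 1).+2 - (q%:R - 1) * (q%:R ^+ n)^-1) @[n --> \oo]
    --> (q%:R - 1) / q%:R ^+ (pk 1).+2 - (q%:R - 1) * (0 : R).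
  by apply: cvgB; [exact: cvg_cst|apply: cvgM; [exact: cvg_cst|exact: lim0]].
apply: cvg_trans L; apply: near_eq_cvg; near=> n => /=.
have hn : ((pk 1).+2 <= n)%N by near: n; exists (pk 1).+2.
rewrite (eq_big_nat _ _ (F2 := fun p => - ((q%:R - 1) / q%:R ^+ p.+1 - (q%:R - 1) / q%:R ^+ p))).
  by rewrite sumrN telescope_sumr// opprB.
move=> p hp; rewrite opprB -sum_delta ?s_of_gt//; lia.
Unshelve. all: by end_near. Qed.

Lemma delta_i i : (1 <= i)%N -> (i < N)%N -> delta_ R d q m i = w i - w i.+1.
Proof.
move=> i1 iN; rewrite /delta_ ifF; last lia.
by rewrite -delta_weight//; case: (pair i).
Qed.

Lemma sum_delta_ k : (1 <= k)%N -> (k <= N)%N ->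
  \sum_(k <= i < N.+1) delta_ R d q m i = w k.
Proof.
move=> k1 kN; rewrite big_nat_recr//= delta_N.
rewrite (eq_big_nat _ _ (F2 := fun p => - (w p.+1 - w p))).
  by rewrite sumrN telescope_sumr//= opprB subrK.
by move=> i hi; rewrite delta_i ?opprB//; lia.
Qed.

Lemma omega_1 : omega R d q m 1 = w 1.
Proof. by rewrite /omega eqxx sum_delta_// (leq_trans _ N_ge)//; lia. Qed.

Lemma omega_E k : (2 <= k)%N -> (k <= N)%N -> omega R d q m k = w k / w k.-1.
Proof.
move=> k2 kN; rewrite /omega ifF; last lia.
rewrite ifF; last lia.
by rewrite !sum_delta_//; lia.
Qed.

Lemma omega_N1 : omega R d q m N.+1 = (q%:R * w N)^-1.
Proof.
have := N_ge => h.
rewrite /omega ifF; last lia.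
by rewrite eqxx delta_N.
Qed.

Lemma omega_tilde_E : omega_tilde R d q m = w (N - d + 1).
Proof.
have := N_ge => h.
rewrite /omega_tilde big_nat_recl ?addn1//= omega_1.
case: (posnP (N - d)) => [->|Nd]; first by rewrite big_geq// mulr1.
rewrite (@telescope_prodf_eq _ 1 (N - d).+1 (fun i => w i)) //.
- by rewrite mulrC divfK// gt_eqF// weight_gt0.
- by move=> k hk; rewrite gt_eqF// weight_gt0//; lia.
- by move=> k hk; rewrite omega_E//; lia.
Qed.

Lemma tree_exponent_E : tree_exponent R d q m = q%:R * w N / w (N - d + 1).
Proof. by rewrite /tree_exponent omega_tilde_E omega_N1 invfM invrK mulrC. Qed.

End Combinatorics.

(** * The tree equation *)

Lemma powR_le2 (R : realType) (x y r : R) : 0 <= r -> 0 <= x -> x <= y ->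
  x `^ r <= y `^ r.
Proof.
by move=> r0 x0 xy; apply: ge0_ler_powR; rewrite // nnegrE ?(le_trans x0 xy).
Qed.

Lemma powR_ge1 (R : realType) (x r : R) : 0 <= r -> 1 <= x -> 1 <= x `^ r.
Proof. by move=> r0 x1; rewrite -(powRr0 x); apply: ler_powR. Qed.

Section Words.
Variables (R : realType) (d q : nat) (m : nat -> nat).
Hypotheses (hd : (2 <= d)%N) (hq : (2 <= q)%N)
  (hm : forall k, (1 <= k < d)%N -> (m k.+1 <= m k)%N) (hmd : (2 <= m d)%N).
Variable Omega : set (Sigma d m).
#[local] Set Default Proof Using "hd hq hm hmd".
Local Notation "$ l" := (l R d q m hd hq hm hmd) (at level 0).

Local Notation word := (word R d q m).
Local Notation Pref := (Pref R d q m Omega).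
Local Notation pair := (pair_ R d q m).
Local Notation kk i := (pair_coord R d q m (pair i).1 (pair i).2).

Lemma coord_lt (x : Sigma d m) l k : (1 <= k <= d)%N -> (Defs.coord x l k < m k)%N.
Proof.
move=> kd; rewrite /Defs.coord; case: insubP => [j _ ej|]; last lia.
have -> : k = j.+1 by move: ej => /= ->; lia.
have mj : (2 <= m j.+1)%N by apply: (m_ge2 d q m hd hq hm hmd) => //; exact: ltn_ord.
by apply: leq_trans (ltn_ord _) _; lia.
Qed.

Lemma chi_lt x i : (1 <= i)%N -> (chi R d q m i x < m (kk i))%N.
Proof.
move=> i1; case e : (pair i) => [p t]; rewrite ($chi_E p t)//.
apply: coord_lt; apply: ($pair_coord_ge1) => //.
by move: e; case: ($pair_P i i1) => p' t' v _ [<- <-].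
Qed.

Lemma kk_range i : (1 <= i)%N -> (1 <= kk i <= d)%N.
Proof.
move=> i1; case: ($pair_P i i1) => p t v _ /=.
exact: ($pair_coord_ge1).
Qed.

Lemma chi_lt1 x i : (1 <= i)%N -> (chi R d q m i x < m 1)%N.
Proof.
move=> i1; apply: leq_trans (chi_lt x i i1) _.
by apply: (m_le d q m hd hq hm hmd) => //; have := kk_range i i1; lia.
Qed.

Lemma size_word n x : size (word n x) = n.
Proof. by rewrite size_map size_iota. Qed.

Lemma word_S n x : word n.+1 x = rcons (word n x) (chi R d q m n.+1 x).
Proof. by rewrite /Defs.word -[n.+1]addn1 iotaD map_cat cats1 /= add1n addn1. Qed.

Lemma take_word k n x : (k <= n)%N -> take k (word n x) = word k x.
Proof. by move=> kn; rewrite -map_take take_iota (minn_idPl kn). Qed.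

Lemma nth_word n x i : (i < n)%N -> nth 0%N (word n x) i = chi R d q m i.+1 x.
Proof. by move=> i_n; rewrite (nth_map 0%N) ?size_iota// nth_iota. Qed.

Lemma Pref_word n x : Omega x -> Pref (word n x).
Proof. by move=> Ox; exists x; rewrite ?size_word. Qed.

Lemma Pref_take k u : Pref u -> Pref (take k u).
Proof.
move=> [x Ox xu]; rewrite -xu; case: (leqP k (size u)) => ku.
  by rewrite take_word//; exact: Pref_word.
by rewrite take_oversize ?size_word 1?ltnW//; exact: Pref_word.
Qed.

Lemma Pref_prefix u v : prefix u v -> Pref v -> Pref u.
Proof. by move=> /prefixP[s ->] /(Pref_take (size u)); rewrite take_size_cat. Qed.

Lemma Pref_rcons_lt u c : Pref (rcons u c) -> (c < m (kk (size u).+1))%N.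
Proof.
move=> [x Ox]; rewrite size_rcons word_S => /rcons_inj[_ <-].
exact: chi_lt.
Qed.

Lemma Pref_rcons_lt1 u c : Pref (rcons u c) -> (c < m 1)%N.
Proof.
move=> /Pref_rcons_lt h; apply: leq_trans h _.
apply: (m_le d q m hd hq hm hmd) => //; have := kk_range (size u).+1; lia.
Qed.

Lemma Pref_ext u : Pref u -> exists c : 'I_(m 1), Pref (rcons u c).
Proof.
move=> [x Ox xu].
exists (Ordinal (chi_lt1 x (size u).+1 isT)); exists x => //.
by rewrite size_rcons word_S xu.
Qed.

End Words.

Section Tree.
Variables (R : realType) (d q : nat) (m : nat -> nat).
Hypotheses (hd : (2 <= d)%N) (hq : (2 <= q)%N)
  (hm : forall k, (1 <= k < d)%N -> (m k.+1 <= m k)%N) (hmd : (2 <= m d)%N).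
Variable Omega : set (Sigma d m).
#[local] Set Default Proof Using "hd hq hm hmd".
Local Notation "$ l" := (l R d q m hd hq hm hmd) (at level 0).

Local Notation Pref := (Pref R d q m Omega).
Local Notation N := (N_ R d q m).
Local Notation w := (weight R d q m).
Local Notation pair := (pair_ R d q m).
Local Notation kk i := (pair_coord R d q m (pair i).1 (pair i).2).
Local Notation nested := (nested_sum R d q m Omega).

(* The weight of the outermost letter of a nested sum over r letters *)
Definition level_weight (r : nat) : R := w (N - r.-1).
Local Notation E := level_weight.

Local Lemma N_ge_d : (d <= N)%N. Proof. exact: $N_ge. Qed.
#[local] Hint Resolve N_ge_d : core.
Local Lemma w_gt0 i : (1 <= i)%N -> 0 < w i. Proof. exact: $weight_gt0. Qed.

Lemma level_weight_gt0 r : (r <= N)%N -> 0 < E r.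
Proof. by move=> rN; apply: w_gt0; have := N_ge_d; lia. Qed.

Lemma level_weight0 : E 0 = w N. Proof. by rewrite /E subn0. Qed.

Lemma level_weight_div r : (r <= N)%N -> E r / E r = 1.
Proof. by move=> rN; rewrite divff// gt_eqF// level_weight_gt0. Qed.

(** One recursion for all levels: the innermost sum carries no power, which fits because
    [E 0 = E 1 = w N], and the other exponents [omega] are ratios of consecutive [E]. *)
Lemma nested_sumS (t : seq nat -> R) r u : (r < N)%N ->
  (forall v, Pref v -> prefix u v -> size v = (size u + r.+1)%N -> 0 <= t v) ->
  nested t r.+1 u =
  \sum_(c < m 1 | `[< Pref (rcons u c) >]) nested t r (rcons u c) `^ (E r / E r.+1).
Proof.
move=> rN t0 /=; apply: eq_bigr => c /asboolP Pc; case: eqP => [r0|rn0].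
  subst r; rewrite (level_weight_div 1)// powRr1//.
  by apply: t0 => //; rewrite ?prefix_rcons// size_rcons addn1.
congr (_ `^ _); rewrite ($omega_E)//; [|lia..].
by rewrite /E; congr (w _ / w _); lia.
Qed.

Local Lemma prefix_ext u v (c : nat) : prefix (rcons u c) v -> prefix u v.
Proof. by apply: prefix_trans; exact: prefix_rcons. Qed.

(** Monotonicity and homogeneity at once: a factor c on the leaves becomes [c ^ (w N / E r)] r
    levels above, since the exponents [E r / E r.+1] multiply out. *)
Lemma nested_le_scale (s t : seq nat -> R) (c : R) r u : (r <= N)%N -> 0 < c ->
  (forall v, Pref v -> prefix u v -> size v = (size u + r)%N ->
    0 <= s v <= c * t v) -> Pref u ->
  0 <= nested s r u <= c `^ (w N / E r) * nested t r u.
Proof.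
move=> + c0; elim: r u => [|r IH] u rN st Pu.
  rewrite -level_weight0 level_weight_div// powRr1 ?(ltW c0)//=.
  by apply: st; rewrite ?prefix_refl ?addn0.
have t0 v : Pref v -> prefix u v -> size v = (size u + r.+1)%N -> 0 <= t v.
  move=> Pv uv sv; have /andP[h1 h2] := st v Pv uv sv.
  by have := le_trans h1 h2; rewrite pmulr_rge0.
have s0 v : Pref v -> prefix u v -> size v = (size u + r.+1)%N -> 0 <= s v.
  by move=> Pv uv sv; have /andP[] := st v Pv uv sv.
rewrite (nested_sumS s)// (nested_sumS t)//.
have Er : 0 < E r by rewrite level_weight_gt0// ltnW.
have Er1 : 0 < E r.+1 by rewrite level_weight_gt0.
rewrite sumr_ge0/=; last by move=> *; exact: powR_ge0.
rewrite mulr_sumr; apply: ler_sum => a /asboolP Pa.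
have /andP[h1 h2] : 0 <= nested s r (rcons u a) <= c `^ (w N / E r) * nested t r (rcons u a).
  apply: IH => //; first exact: ltnW.
  move=> v Pv uv sv; apply: st => //; first exact: prefix_ext uv.
  by rewrite sv size_rcons addSnnS.
apply: (@le_trans _ _ ((c `^ (w N / E r) * nested t r (rcons u a)) `^ (E r / E r.+1))).
  by apply: powR_le2 => //; rewrite divr_ge0// ltW.
rewrite powRM ?powR_ge0//; last first.
  by have := le_trans h1 h2; rewrite pmulr_rge0 ?powR_gt0.
rewrite -powRrM (_ : w N / E r * (E r / E r.+1) = w N / E r.+1)//.
by rewrite mulrA divfK// gt_eqF.
Qed.

Lemma nested_ge1 (t : seq nat -> R) r u : (r <= N)%N ->
  (forall v, Pref v -> prefix u v -> size v = (size u + r)%N -> 1 <= t v) ->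
  Pref u -> 1 <= nested t r u.
Proof.
elim: r u => [|r IH] u rN t1 Pu; first by apply: t1; rewrite ?prefix_refl ?addn0.
rewrite nested_sumS//; last by move=> v Pv uv sv; rewrite (le_trans ler01)// t1.
have [c Pc] := $Pref_ext Omega u Pu.
rewrite (bigD1 c) /=; last exact/asboolP.
rewrite -[leLHS]addr0; apply: lerD; last by apply: sumr_ge0 => *; exact: powR_ge0.
apply: powR_ge1.
  by rewrite divr_ge0// ltW// level_weight_gt0// ltnW.
apply: IH => //; first exact: ltnW.
move=> v Pv uv sv; apply: t1 => //; first exact: prefix_ext uv.
by rewrite sv size_rcons addSnnS.
Qed.

Lemma kk_period i l : (N - d < i)%N -> kk (i + l * d) = kk i.
Proof.
move=> hi; elim: l => [|l IH]; first by rewrite addn0.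
rewrite mulSn addnCA addnC ($pair_coord_add_d)//; lia.
Qed.

(** A sum over a letter of coordinate k has at most [m_k] terms, and its level weight times [ln m_k]
    is at most [(1 - 1/q) ln m_d] because the depth read is at least 1. The condition on l and r
    ensures, by periodicity, that the letters below u have the coordinates of the last r among the
    first N. *)
Lemma nested_le_exp (t : seq nat -> R) (M : R) r u l : (r <= N)%N -> 1 <= M ->
  (size u + r = N + l * d)%N -> (l = 0 \/ r <= d)%N ->
  (forall v, Pref v -> prefix u v -> size v = (size u + r)%N -> 1 <= t v <= M) ->
  Pref u ->
  E r * ln (nested t r u) <=
    r%:R * ((q%:R - 1) / q%:R * ln (m d)%:R) + w N * ln M.
Proof.
move=> + M1; elim: r u => [|r IH] u rN su lr tM Pu.
  rewrite mul0r add0r level_weight0 ler_pM2l; last by rewrite -level_weight0 level_weight_gt0.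
  have /andP[h1 h2] : 1 <= t u <= M by apply: tM; rewrite ?prefix_refl ?addn0.
  by rewrite ler_ln ?posrE ?(lt_le_trans ltr01).
set K := (q%:R - 1) / q%:R * ln (m d)%:R.
set B := r%:R * K + w N * ln M.
have Er : 0 < E r by rewrite level_weight_gt0// ltnW.
have Er1 : 0 < E r.+1 by rewrite level_weight_gt0.
have t0 v : Pref v -> prefix u v -> size v = (size u + r.+1)%N -> 0 <= t v.
  by move=> Pv uv sv; have /andP[h _] := tM v Pv uv sv; rewrite (le_trans ler01).
have N1 : 1 <= nested t r.+1 u.
  by apply: nested_ge1 => // v Pv uv sv; have /andP[] := tM v Pv uv sv.
have i1 : (1 <= N - r)%N by lia.
have k0 := $kk_range (N - r) i1.
have ek : kk (size u).+1 = kk (N - r).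
  have -> : (size u).+1 = (N - r + l * d)%N by lia.
  by case: lr => [->|rd]; [rewrite addn0|apply: kk_period; lia].
have m1 : 0 < ln (m (kk (N - r)))%:R :> R by apply: ($lnm_gt0) => //; lia.
have hk : E r.+1 * ln (m (kk (N - r)))%:R <= K.
  rewrite /E /= /weight.
  case: ($pair_P (N - r) i1) => p p' v _ /=.
  rewrite ($pair_weight_ln)// /K ler_pM2r; last by apply: ($lnm_gt0) => //; lia.
  rewrite ler_pM2l; last by rewrite subr_gt0 ($q_gt1).
  rewrite lef_pV2 ?posrE ?exprn_gt0 ?($q_gt0)//.
  rewrite -[leLHS]expr1 ler_eXn2l ?($q_gt1)//.
  by have := $pair_coord_p p p' v; lia.
have main : nested t r.+1 u <= (m (kk (N - r)))%:R * expR (B / E r.+1).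
  rewrite nested_sumS//.
  apply: (@le_trans _ _ (\sum_(c < m 1 | `[< Pref (rcons u c) >]) expR (B / E r.+1))).
    apply: ler_sum => c /asboolP Pc.
    have h : E r * ln (nested t r (rcons u c)) <= B.
      apply: IH => //; first exact: ltnW.
      - by rewrite size_rcons; lia.
      - by case: lr; [left|right; lia].
      - move=> v Pv uv sv; apply: tM => //; first exact: prefix_ext uv.
        by rewrite sv size_rcons addSnnS.
    have h1 : 1 <= nested t r (rcons u c).
      apply: nested_ge1 => //; first exact: ltnW.
      move=> v Pv uv sv; have := tM v Pv; rewrite (prefix_ext _ _ _ uv) sv size_rcons addSnnS.
      by move=> /(_ isT erefl)/andP[].
    rewrite /powR gt_eqF ?(lt_le_trans ltr01)// ler_expR.
    by rewrite mulrAC ler_pM2r ?invr_gt0.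
  set A := [pred c : 'I_(m 1) | `[< Pref (rcons u c) >]].
  rewrite (_ : \sum_(c < m 1 | _) _ = expR (B / E r.+1) *+ #|A|); last first.
    by rewrite -sumr_const; apply: eq_bigl => c; rewrite inE.
  rewrite -[expR _ *+ _]mulr_natl ler_pM2r ?expR_gt0// ler_nat cardE; set s := enum _.
  have : uniq (map val s) by rewrite map_inj_uniq ?enum_uniq//; exact: val_inj.
  move=> /(uniq_leq_size) h; rewrite -(size_map val s) -[leqRHS](size_iota 0).
  apply: h => i /mapP[c]; rewrite mem_enum => /asboolP Pc ->.
  by rewrite mem_iota /= -ek; exact: ($Pref_rcons_lt Omega).
have mm : 0 < (m (kk (N - r)))%:R :> R.
  by rewrite ltr0n; have := m_ge2 d q m hd hq hm hmd (kk (N - r)); lia.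
move: main; rewrite -ler_ln ?posrE ?(lt_le_trans ltr01 N1) ?mulr_gt0 ?expR_gt0//.
rewrite lnM ?posrE ?expR_gt0//.
rewrite expRK -(ler_pM2l Er1) mulrDr => h; apply: le_trans h _.
rewrite [E r.+1 * (_ / _)]mulrC divfK ?gt_eqF// -natr1 mulrDl mul1r.
by rewrite (addrAC _ K) -/B [leLHS]addrC lerD2l.
Qed.

Local Notation Mx := ((m d)%:R `^ (omega R d q m N.+1 * d%:R)).

Lemma ln_tree_bound : w N * ln Mx = d%:R / q%:R * ln (m d)%:R.
Proof.
rewrite ln_powR ($omega_N1) invfM !mulrA.
have w0 : w N != 0 by rewrite gt_eqF// -level_weight0 level_weight_gt0.
by have q0 : q%:R != 0 :> R := $q_neq0; field; rewrite w0 q0.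
Qed.

Lemma tree_bound_ge1 : 1 <= Mx.
Proof.
apply: powR_ge1; last by rewrite ler1n; have := hmd; lia.
by rewrite mulr_ge0// ($omega_N1) invr_ge0 mulr_ge0// -level_weight0 ltW// level_weight_gt0.
Qed.

Lemma level_weight_d : E d = w (N - d + 1).
Proof. by rewrite /E; congr w; have := N_ge_d; lia. Qed.

Lemma tree_exponent_level : tree_exponent R d q m = q%:R * w N / E d.
Proof. by rewrite ($tree_exponent_E) level_weight_d. Qed.

Lemma tree_exponent_gt0 : 0 < tree_exponent R d q m.
Proof.
have w0 : 0 < w N by rewrite -level_weight0 level_weight_gt0.
have e0 : 0 < E d := level_weight_gt0 d N_ge_d.
by rewrite tree_exponent_level divr_gt0// mulr_gt0// ($q_gt0).
Qed.

Local Notation te := (tree_exponent R d q m).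

(* The recursion reads [t = tree_step t] on the tree. *)
Definition tree_step (t : seq nat -> R) (u : seq nat) : R := nested t d u `^ te^-1.

Variable X : seq nat.
Local Notation G := (Gamma R d q m Omega X).

Lemma Gamma_desc u v : G u -> Pref v -> prefix u v -> size v = (size u + d)%N -> G v.
Proof.
move=> [[l sl] Pu Xu] Pv uv sv; split => //; last exact: prefix_trans uv.
by exists l.+1; rewrite sv sl mulSn; lia.
Qed.

(** The nested sum is homogeneous of degree [w N / E d], and the inverted exponent is
    [E d / (q w N)]; their product is 1/q, the rate of the contraction. *)
Lemma tree_step_le_scale (s t : seq nat -> R) (c : R) u : 0 < c -> G u ->
  (forall v, G v -> 0 <= s v <= c * t v) ->
  tree_step s u <= c `^ q%:R^-1 * tree_step t u.
Proof.
move=> c0 Gu st; have [_ Pu _] := Gu.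
have /andP[h1 h2] : 0 <= nested s d u <= c `^ (w N / E d) * nested t d u.
  apply: nested_le_scale => // v Pv uv sv; apply: st; exact: Gamma_desc uv sv.
have te0 : 0 <= te^-1 by rewrite invr_ge0 ltW// tree_exponent_gt0.
apply: le_trans (powR_le2 _ _ _ _ te0 h1 h2) _.
rewrite powRM ?powR_ge0//; last first.
  by have := le_trans h1 h2; rewrite pmulr_rge0 ?powR_gt0.
rewrite -powRrM (_ : w N / E d / te = q%:R^-1)// tree_exponent_level.
have w0 : w N != 0 by rewrite gt_eqF// -level_weight0 level_weight_gt0.
have e0 : E d != 0 by rewrite gt_eqF// level_weight_gt0// N_ge_d.
have q0 : q%:R != 0 :> R := $q_neq0.
by field; rewrite w0 e0 q0.
Qed.

(** The upper bound M reproduces itself: d letters cost at most [d (1 - 1/q) ln m_d] and the leaves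
    [w N ln M = (d / q) ln m_d], in total [d ln m_d = q w N ln M]. This is where the exponent
    [d omega_(N+1)] comes from. *)
Lemma tree_step_bounds (t : seq nat -> R) u : G u -> (forall v, G v -> 1 <= t v <= Mx) ->
  1 <= tree_step t u <= Mx.
Proof.
move=> Gu tb; have [[l sl] Pu Xu] := Gu.
have tb' v : Pref v -> prefix u v -> size v = (size u + d)%N -> 1 <= t v <= Mx.
  by move=> Pv uv sv; apply: tb; exact: Gamma_desc uv sv.
have n1 : 1 <= nested t d u.
  by apply: nested_ge1 => // v Pv uv sv; have /andP[] := tb' v Pv uv sv.
have te0 := tree_exponent_gt0.
apply/andP; split; first by apply: powR_ge1 => //; rewrite invr_ge0 ltW.
have le := nested_le_exp t Mx d u l.+1 N_ge_d tree_bound_ge1 ltac:(rewrite sl mulSn; lia)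
  (or_intror (leqnn d)) tb' Pu.
have M0 : 0 < Mx := lt_le_trans ltr01 tree_bound_ge1.
have n0 : 0 < nested t d u := lt_le_trans ltr01 n1.
have s0 : 0 < tree_step t u by rewrite /tree_step powR_gt0.
rewrite -ler_ln ?posrE// {1}/tree_step [ln (_ `^ te^-1)]ln_powR mulrC ler_pdivrMr//.
have Ed : 0 < E d := level_weight_gt0 d N_ge_d.
rewrite -(ler_pM2l Ed); apply: le_trans le _.
rewrite (_ : E d * (ln Mx * te) = q%:R * (w N * ln Mx)); last first.
  rewrite tree_exponent_level; have e0 : E d != 0 by rewrite gt_eqF.
  by field.
rewrite ln_tree_bound le_eqVlt; apply/orP; left; apply/eqP.
by have q0 : q%:R != 0 :> R := $q_neq0; field.
Qed.

Lemma tree_solutionE t : tree_solution R d q m Omega X t <->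
  (forall u, G u -> 1 <= t u <= Mx) /\ (forall u, G u -> t u = tree_step t u).
Proof.
have te0 := tree_exponent_gt0.
split=> -[tb te_eq]; split => // u Gu; have /andP[t1 _] := tb u Gu.
  by rewrite /tree_step -te_eq// -powRrM divff ?gt_eqF// powRr1// (le_trans ler01).
have n1 : 1 <= nested t d u.
  have [_ Pu _] := Gu; apply: nested_ge1 => // v Pv uv sv.
  by have /andP[] := tb v (Gamma_desc u v Gu Pv uv sv).
by rewrite te_eq// /tree_step -powRrM mulVf ?gt_eqF// powRr1// (le_trans ler01).
Qed.

(* Knaster-Tarski: the supremum of the subsolutions is a solution. *)
Lemma tree_solution_exists : exists t, tree_solution R d q m Omega X t.
Proof.
pose sub (s : seq nat -> R) := forall u, G u -> 1 <= s u <= Mx /\ s u <= tree_step s u.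
have sub1 : sub (fun=> 1).
  move=> u Gu; rewrite lexx tree_bound_ge1; split => //.
  by have /andP[] := tree_step_bounds (fun=> 1) u Gu
    (fun v _ => introT andP (conj (lexx 1) tree_bound_ge1)).
pose vals u := [set s u | s in sub].
pose t u := sup (vals u).
have ub u : G u -> ubound (vals u) Mx by move=> Gu _ [s /(_ u Gu)[/andP[_ h] _] <-].
have hs u : G u -> has_sup (vals u).
  by move=> Gu; split; [exists 1, (fun=> 1)|exists Mx; exact: ub].
have slet s u : sub s -> G u -> s u <= t u.
  by move=> ss Gu; apply: ub_le_sup; [case: (hs u Gu)|exists s].
have tb u : G u -> 1 <= t u <= Mx.
  move=> Gu; apply/andP; split; first exact: (slet (fun=> 1)).
  by apply: ge_sup; [exists 1, (fun=> 1)|exact: ub].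
have mono (s s' : seq nat -> R) u : G u -> (forall v, G v -> 0 <= s v <= s' v) -> tree_step s u <= tree_step s' u.
  move=> Gu ss; rewrite -[leRHS]mul1r (_ : 1 = 1 `^ q%:R^-1); last by rewrite powR1.
  by apply: tree_step_le_scale => // v Gv; rewrite mul1r; exact: ss.
have tsub u : G u -> t u <= tree_step t u.
  move=> Gu; apply: ge_sup; first by exists 1, (fun=> 1).
  move=> _ [s ss <-]; have [_ h] := ss u Gu; apply: le_trans h _.
  apply: mono => // v Gv; rewrite slet// andbT.
  by have [/andP[h _] _] := ss v Gv; rewrite (le_trans ler01).
exists t; apply/tree_solutionE; split => // u Gu.
(* The image [tree_step t] is again a subsolution, hence at most the supremum t. *)
apply/eqP; rewrite eq_le tsub//=; apply: (slet (tree_step t)) => // v Gv.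
split; first exact: tree_step_bounds.
apply: mono => // v' Gv'; rewrite tsub// andbT.
by have /andP[h _] := tb v' Gv'; rewrite (le_trans ler01).
Qed.

(* Log-contraction: [t <= c t'] on the tree improves to [t <= c^(1/q) t']. *)
Lemma tree_solution_le t t' u :
  tree_solution R d q m Omega X t -> tree_solution R d q m Omega X t' ->
  G u -> t u <= t' u.
Proof.
move=> /tree_solutionE[tb te_eq] /tree_solutionE[tb' te_eq'] Gu.
have M0 : 0 < Mx := lt_le_trans ltr01 tree_bound_ge1.
have tt n v : G v -> t v <= Mx `^ (q%:R^-1 ^+ n) * t' v.
  elim: n v => [|n IH] v Gv.
    have /andP[h1 h2] := tb v Gv; have /andP[h1' h2'] := tb' v Gv.
    by rewrite expr0 powRr1 ?(ltW M0)// (le_trans h2)// ler_peMr ?(ltW M0).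
  rewrite te_eq// te_eq'// exprSr (powRrM Mx).
  apply: tree_step_le_scale => //; first exact: powR_gt0.
  move=> v' Gv'; rewrite IH// andbT.
  by have /andP[h _] := tb v' Gv'; rewrite (le_trans ler01).
have /andP[t1 _] := tb u Gu; have /andP[t1' _] := tb' u Gu.
have t0 : 0 < t u := lt_le_trans ltr01 t1.
have t0' : 0 < t' u := lt_le_trans ltr01 t1'.
rewrite -ler_ln ?posrE// -subr_le0.
have q1 : `|q%:R^-1| < 1 :> R.
  by rewrite ger0_norm ?invr_ge0// invf_lt1 ?($q_gt0)// ($q_gt1).
have lim : (fun n => q%:R^-1 ^+ n * ln Mx) @ \oo --> (0 : R).
  by rewrite -[X in _ --> X](mul0r (ln Mx)); apply: cvgM; [exact: cvg_expr|exact: cvg_cst].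
rewrite -(cvg_lim _ lim)//; apply: limr_ge; first by apply/cvg_ex; exists 0.
near=> n; have P0 : 0 < Mx `^ (q%:R^-1 ^+ n) by exact: powR_gt0.
by rewrite lerBlDr -(ln_powR Mx) -lnM ?posrE// ler_ln ?posrE ?(mulr_gt0 P0)// tt.
Unshelve. all: by end_near. Qed.

Lemma tree_solution_unique t t' u :
  tree_solution R d q m Omega X t -> tree_solution R d q m Omega X t' ->
  G u -> t' u = t u.
Proof. by move=> h h' Gu; apply/eqP; rewrite eq_le !tree_solution_le. Qed.

End Tree.

(** * Measures on the sequence space *)

Lemma cvg_prod_topology (I : Type) (T : I -> topologicalType)
    (F : set_system (prod_topology T)) (f : prod_topology T) : Filter F ->
  (forall i, (fun g : prod_topology T => g i) @ F --> f i) -> F --> f.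
Proof.
move=> FF h; apply/cvg_sup => i A [B [[V oV <-] Vf] sub].
apply: filterS sub _; apply: h; exact: open_nbhs_nbhs.
Qed.

Section SigmaTopology.
Variables (d : nat) (m : nat -> nat).
Local Notation Sg := (Sigma d m).

Definition agree (n : nat) (x : Sg) : set Sg :=
  [set u | forall i, (i < n)%N -> u i = x i].

Lemma agree_refl n x : agree n x x. Proof. by []. Qed.

Lemma agree_le n n' x : (n <= n')%N -> agree n' x `<=` agree n x.
Proof. by move=> nn u h i i_n; apply: h; exact: leq_trans nn. Qed.

(** The sets containing some [agree n x] form a filter that converges to x in each coordinate, every
    factor being discrete, hence in the product topology. *)
Lemma open_agree_sub (U : set Sg) x : open U -> U x ->
  exists n, agree n x `<=` U.
Proof.
move=> oU Ux.
pose F : set_system Sg := [set A | exists n, agree n x `<=` A].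
have FF : Filter F.
  split; first by exists 0%N.
  - move=> A B [n nA] [n' nB]; exists (maxn n n') => u h; split.
      by apply: nA; apply: agree_le h; exact: leq_maxl.
    by apply: nB; apply: agree_le h; exact: leq_maxr.
  - by move=> A B AB [n nA]; exists n; exact: subset_trans AB.
have : F --> (x : Sg).
  apply: cvg_prod_topology => i; apply: cvg_prod_topology => k A.
  rewrite nbhs_principalE => /principal_filterP Ax.
  by exists i.+1 => u /(_ i (ltnSn i)) /= ->.
by apply; exact: open_nbhs_nbhs.
Qed.

Lemma open_agree n x : open (agree n x).
Proof.
rewrite openE => u xu; rewrite /interior.
apply: (@filterS _ _ _ [set v : Sg | forall i : 'I_n, forall k : 'I_d, v i k = x i k]).
  move=> v vx i i_n; apply: functional_extensionality_dep => k.
  exact: (vx (Ordinal i_n) k).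
have FF : Filter (nbhs (u : Sg)) by exact: nbhs_filter.
apply: (@filter_forall Sg 'I_n (fun i => [set v | forall k : 'I_d, v i k = x i k]) _ FF) => i.
apply: (@filter_forall Sg 'I_d (fun k => [set v | v i k = x i k]) _ FF) => k.
have : nbhs (u : Sg) ((fun v : Sg => v i k) @^-1` [set x i k]).
  have : {for u, continuous (fun v : Sg => v i k)}.
    apply: (@continuous_comp _ _ _ (fun v : Sg => v i) (fun f => f k)).
      exact: (@proj_continuous nat _ i).
    exact: (@proj_continuous 'I_d _ k).
  apply; rewrite nbhs_principalE; apply/principal_filterP => /=.
  by rewrite (xu i)//.
exact: filterS.
Qed.

Lemma open_fin_det (A : set Sg) n :
  (forall x u, agree n x u -> A x -> A u) -> open A.
Proof.
move=> hA; rewrite openE => x Ax; rewrite /interior.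
apply: (@filterS _ _ _ (agree n x)); first by move=> u xu; exact: hA xu Ax.
by apply: open_nbhs_nbhs; split; [exact: open_agree|exact: agree_refl].
Qed.

Lemma open_measurable (A : set Sg) : open A -> measurable (A : set (SigmaB d m)).
Proof. by move=> oA; apply: sub_sigma_algebra. Qed.

Lemma measurable_fin_det (A : set Sg) n :
  (forall x u, agree n x u -> A x -> A u) -> measurable (A : set (SigmaB d m)).
Proof. by move=> hA; apply: open_measurable; exact: open_fin_det hA. Qed.

End SigmaTopology.

Lemma bigcup_seq_measurable (dp : measure_display) (T : measurableType dp)
    (A : set (seq nat)) (F : seq nat -> set T) :
  (forall w, measurable (F w)) -> measurable (\bigcup_(w in A) F w).
Proof.
move=> mF.
pose G (o : option (seq nat)) := if o is Some w then if `[< A w >] then F w else set0 else set0.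
have mG o : measurable (G o).
  by case: o => [w|] /=; [case: asboolP => // _|]; exact: measurable0.
have -> : \bigcup_(w in A) F w = \bigcup_n G (unpickle n).
  apply/seteqP; split=> x.
    by move=> [w Aw Fx]; exists (pickle w) => //; rewrite pickleK /=; case: asboolP.
  by move=> [n _]; case: (unpickle n) => [w|] //=; case: asboolP => // Aw Fx; exists w.
by apply: bigcupT_measurable => n; exact: mG.
Qed.

(** * Measures with prescribed cylinder weights *)

Section Kolmogorov.
Variables (R : realType) (b : nat) (W : seq nat -> R).
Hypotheses (W1 : W [::] = 1) (W_ge0 : forall w, 0 <= W w)
  (W_sum : forall w, W w = \sum_(0 <= c < b) W (rcons w c)).

Local Notation letters w := (all (fun c => (c < b)%N) w).

(** Total weight of the words of the same length that precede w lexicographically. The cells of one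
    length tile [0, 1) and those of greater length refine them, so the measure sought is the image
    of Lebesgue measure under the digit expansion. *)
Local Definition lo (w : seq nat) : R :=
  \sum_(0 <= j < size w) \sum_(0 <= c < nth 0%N w j) W (rcons (take j w) c).

Local Definition cell (w : seq nat) : set R := `[lo w, lo w + W w[%classic.

Local Lemma lo_rcons w c :
  lo (rcons w c) = lo w + \sum_(0 <= c' < c) W (rcons w c').
Proof.
rewrite /lo size_rcons big_nat_recr//=; congr (_ + _).
  apply: eq_big_nat => j /andP[_ jw]; rewrite nth_rcons jw.
  by apply: eq_bigr => c' _; rewrite -(cats1 w c) takel_cat// ltnW.
by rewrite nth_rcons ltnn eqxx -(cats1 w c) takel_cat// take_size.
Qed.

Local Definition digit (u : R) (w : seq nat) : nat :=
  find (fun c => u < lo (rcons w c) + W (rcons w c)) (iota 0 b).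

Local Fixpoint walk (u : R) (n : nat) : seq nat :=
  if n is n'.+1 then rcons (walk u n') (digit u (walk u n')) else [::].

Local Lemma size_walk u n : size (walk u n) = n.
Proof. by elim: n => //= n IH; rewrite size_rcons IH. Qed.

Local Lemma hi_rcons w c :
  lo (rcons w c) + W (rcons w c) = lo w + \sum_(0 <= c' < c.+1) W (rcons w c').
Proof. by rewrite lo_rcons big_nat_recr//= addrA. Qed.

Local Lemma partial_le w c c' : (c <= c')%N ->
  \sum_(0 <= a < c) W (rcons w a) <= \sum_(0 <= a < c') W (rcons w a).
Proof.
move=> cc; rewrite (@big_cat_nat _ _ _ c 0 c')//= lerDl.
by apply: sumr_ge0 => *.
Qed.

Local Lemma cell_digit w u : cell w u ->
  (digit u w < b)%N /\ cell (rcons w (digit u w)) u.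
Proof.
rewrite /cell /= in_itv /= => /andP[lu uh].
have hs : has (fun c => u < lo (rcons w c) + W (rcons w c)) (iota 0 b).
  (* The cell of the last letter ends where the cell of w ends, as [W w] is the sum over all
     letters; b = 0 would make the cell of w empty. *)
  apply/hasP; exists b.-1.
    rewrite mem_iota/= add0n; case: b W_sum => [|b'] //= W_sum'.
    by move: (W_sum' w); rewrite big_geq// => e; move: uh; rewrite e addr0 ltNge lu.
  rewrite hi_rcons prednK -?W_sum//.
  case: b W_sum => [|b'] //= W_sum'.
  by move: (W_sum' w); rewrite big_geq// => e; move: uh; rewrite e addr0 ltNge lu.
have db : (digit u w < b)%N by move: hs; rewrite has_find size_iota.
split => //; rewrite in_itv /=.
have := nth_find 0%N hs; rewrite -/(digit u w) nth_iota// add0n => ->; rewrite andbT.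
rewrite lo_rcons.
case e : (digit u w) => [|c]; first by rewrite big_geq// addr0.
have := @before_find _ 0%N (fun c => u < lo (rcons w c) + W (rcons w c)) (iota 0 b) c.
rewrite -/(digit u w) e ltnSn => /(_ isT); rewrite nth_iota ?add0n; last by rewrite (ltn_trans _ db)// e.
by rewrite hi_rcons => /negbT; rewrite -leNgt.
Qed.

Local Lemma cell_rcons w c u : (c < b)%N -> cell (rcons w c) u ->
  cell w u /\ digit u w = c.
Proof.
move=> cb; rewrite {1}/cell /= in_itv/= => /andP[h1 h2].
have iw : cell w u.
  rewrite /cell /= in_itv /=; apply/andP; split.
    apply: le_trans h1; rewrite lo_rcons lerDl; apply: sumr_ge0 => *; exact: W_ge0.
  by apply: lt_le_trans h2 _; rewrite hi_rcons lerD2l [leRHS]W_sum partial_le.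
split => //; have [db] := cell_digit w u iw.
rewrite /cell /= in_itv/= => /andP[h3 h4].
case: (ltngtP (digit u w) c) => // dc.
- have : u < u; last by rewrite ltxx.
  apply: lt_le_trans h4 _; apply: le_trans h1.
  by rewrite hi_rcons lo_rcons lerD2l partial_le.
- have : u < u; last by rewrite ltxx.
  apply: lt_le_trans h2 _; apply: le_trans h3.
  by rewrite hi_rcons lo_rcons lerD2l partial_le.
Qed.

Local Definition D01 : set R := `[0, 1[%classic.

Local Lemma cell_nil : cell [::] = D01.
Proof. by rewrite /cell /lo /= big_geq// W1 add0r. Qed.

Local Lemma walk_letters u n : D01 u -> letters (walk u n) /\ cell (walk u n) u.
Proof.
rewrite -cell_nil => u01; elim: n => [|n [IH1 IH2]] //=.
have [h1 h2] := cell_digit _ _ IH2; split => //.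
by rewrite all_rcons h1.
Qed.

Local Lemma cell_walk w u : letters w -> cell w u -> D01 u /\ walk u (size w) = w.
Proof.
elim/last_ind: w => [|w c IH]; first by rewrite cell_nil.
rewrite all_rcons size_rcons => /andP[cb lw] /(cell_rcons _ _ _ cb)[iw dw].
have [u01 e] := IH lw iw; split => //=; by rewrite e dw.
Qed.

Local Lemma walk_cell w : letters w -> [set u | D01 u /\ walk u (size w) = w] = cell w.
Proof.
move=> lw; apply/seteqP; split=> u.
  by move=> [u01 <-]; have [_] := walk_letters u (size w) u01.
exact: cell_walk.
Qed.

Local Lemma measurable_D01 : measurable D01. Proof. exact: measurable_itv. Qed.

Local Lemma lebesgue_cell w : lebesgue_measure (cell w) = (W w)%:E.
Proof.
rewrite /cell lebesgue_measure_itv /= lte_fin ltrDl.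
case: ifPn => [_|]; first by rewrite -EFinD addrAC subrr add0r.
by rewrite -leNgt => h; congr (_%:E); apply/eqP; rewrite eq_le W_ge0 h.
Qed.

Local Definition digits (u : R) : nat -> nat := fun j => nth 0%N (walk u j.+1) j.

Local Lemma walk_digits u n : walk u n = mkseq (digits u) n.
Proof.
elim: n => //= n IH; rewrite mkseqS -IH; congr rcons.
by rewrite /digits /= nth_rcons size_walk ltnn eqxx.
Qed.

Local Lemma weight_digits_gt0 u n : D01 u -> 0 < W (mkseq (digits u) n).
Proof.
move=> u01; rewrite -walk_digits; have [_] := walk_letters u n u01.
by rewrite /cell /= in_itv /= => /andP[h1 h2]; have := le_lt_trans h1 h2; rewrite ltrDl.
Qed.

Variables (d : nat) (m : nat -> nat) (Phi : (nat -> nat) -> Sigma d m).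
Hypothesis Phi_det : forall n, exists M, forall g g',
  (forall j, (j < M)%N -> g j = g' j) -> agree d m n (Phi g) (Phi g').

Local Definition code (u : R) : SigmaB d m :=
  if u \in D01 then Phi (digits u) else point.

(** Membership of the image in an open set is decided by finitely many digits, so the preimage is a
    countable union of cells, up to the points outside [0, 1), which are all sent to [point]. *)
Local Lemma measurable_code : measurable_fun [set: R] code.
Proof.
apply: (@measurability _ _ R (SigmaB d m) setT code (@open (Sigma d m))) => //.
move=> _ [U oU <-]; rewrite setTI.
pose good w := letters w /\ forall g, mkseq g (size w) = w -> U (Phi g).
have -> : code @^-1` U = \bigcup_(w in good) cell w `|`
    (if `[< U point >] then ~` D01 else set0).
  apply/seteqP; split=> u; rewrite /preimage /= /code.
    case: ifPn => [/set_mem u01 Uu|/negP u01 Uu]; last first.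
      by right; case: asboolP => // _ Du; apply: u01; exact/mem_set.
    left; have [n nU] := open_agree_sub d m U _ oU Uu.
    have [M hM] := Phi_det n.
    exists (walk u M); last by have [] := walk_letters u M u01.
    split; first by have [] := walk_letters u M u01.
    move=> g; rewrite size_walk walk_digits => e; apply: nU; apply: hM => j jM.
    by rewrite -(nth_mkseq 0%N g jM) e nth_mkseq.
  move=> [[w [lw hw] iw]|].
    have [u01 e] := cell_walk w u lw iw; rewrite mem_set//.
    by apply: hw; rewrite -walk_digits.
  by case: asboolP => // Up Du; rewrite memNset.
apply: measurableU; last by case: asboolP => // _; apply: measurableC; exact: measurable_D01.
by apply: bigcup_seq_measurable => w; exact: measurable_itv.
Qed.

HB.instance Definition _ := isMeasurableFun.Build _ _ R (SigmaB d m) code measurable_code.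

Local Definition base : set R -> \bar R := mrestr lebesgue_measure measurable_D01.

Local Lemma base0 : base set0 = 0%E.
Proof. by rewrite /base /mrestr set0I measure0. Qed.

Local Lemma base_ge0 A : (0 <= base A)%E. Proof. exact: measure_ge0. Qed.

Local Lemma base_sigma_additive : semi_sigma_additive base.
Proof. exact: (@measure_semi_sigma_additive _ _ _ (mrestr lebesgue_measure measurable_D01)). Qed.

HB.instance Definition _ := isMeasure.Build _ _ _ base base0 base_ge0 base_sigma_additive.

Local Lemma base_setT : base setT = 1%E.
Proof.
rewrite /base /mrestr setTI /D01 lebesgue_measure_itv /= lte_fin ltr01.
by rewrite -EFinD subr0.
Qed.

HB.instance Definition _ := Measure_isProbability.Build _ _ _ base base_setT.

(** The condition on A is tested only on streams all of whose prefixes have positive weight, since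
    the digits of a point of [0, 1) never lead into an empty cell. So [Phi] may be arbitrary on all
    other streams. *)
Lemma kolmogorov : exists P : probability (SigmaB d m) R,
  forall (A : set (SigmaB d m)) w, letters w ->
   (forall g, (forall n, 0 < W (mkseq g n)) -> A (Phi g) <-> mkseq g (size w) = w) ->
   P A = (W w)%:E.
Proof.
exists (distribution base code) => A w lw hA.
rewrite /distribution /pushforward /base /mrestr -lebesgue_cell -walk_cell//.
congr (lebesgue_measure _); apply/seteqP; split=> u.
  move=> [+ u01]; rewrite /preimage /= /code mem_set// => Au; split => //.
  by rewrite walk_digits; apply/hA => // n; exact: weight_digits_gt0.
move=> [u01 pw]; split=> //; rewrite /preimage /= /code mem_set//.
by apply/hA; [move=> n; exact: weight_digits_gt0|rewrite -walk_digits].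
Qed.

End Kolmogorov.

(** * Cylinders of the coordinate functions *)

Section ChiCylinders.
Variables (R : realType) (d q : nat) (m : nat -> nat).
Hypotheses (hd : (2 <= d)%N) (hq : (2 <= q)%N)
  (hm : forall k, (1 <= k < d)%N -> (m k.+1 <= m k)%N) (hmd : (2 <= m d)%N).
#[local] Set Default Proof Using "hd hq hm hmd".
Local Notation "$ l" := (l R d q m hd hq hm hmd) (at level 0).

Local Notation word := (word R d q m).
Local Notation pair := (pair_ R d q m).
Local Notation kk i := (pair_coord R d q m (pair i).1 (pair i).2).
Local Notation Sg := (Sigma d m).

(* chi_i is the coordinate of index chi_coord i at position chi_pos i *)
Definition chi_coord (i : nat) : nat := kk i.
Definition chi_pos (i : nat) : nat := ((pair i).1 - p_ R d q m (kk i))%N.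

Lemma chi_posE i x : (1 <= i)%N ->
  chi R d q m i x = Defs.coord x (chi_pos i) (chi_coord i).
Proof. by move=> i1; rewrite ($chi_E (pair i).1 (pair i).2)//; case: (pair i). Qed.

Lemma chi_pos_ge1 i : (1 <= i)%N -> (1 <= chi_pos i)%N.
Proof.
move=> i1; rewrite /chi_pos; case: ($pair_P i i1) => p t v _ /=.
by rewrite subn_gt0; exact: $pair_coord_p.
Qed.

Lemma chi_coord_range i : (1 <= i)%N -> (1 <= chi_coord i <= d)%N.
Proof. by move=> i1; rewrite /chi_coord; exact: $kk_range. Qed.

Lemma chi_coord_inj i j : (1 <= i)%N -> (1 <= j)%N ->
  chi_coord i = chi_coord j -> chi_pos i = chi_pos j -> i = j.
Proof.
move=> i1 j1; rewrite /chi_coord /chi_pos.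
case: ($pair_P i i1) => p t v ei; case: ($pair_P j j1) => p' t' v' ej /= e1 e2.
by have [pp tt] := $pair_coord_inj p t p' t' v v' e1 e2; rewrite ei ej pp tt.
Qed.

Lemma chi_coord_surj l k : (1 <= l)%N -> (1 <= k <= d)%N ->
  exists i, [/\ (1 <= i)%N, chi_coord i = k & chi_pos i = l].
Proof.
move=> l1 /andP[k1 kd]; have [i [p [t [i1 e v ek el]]]] := $coord_pair l k l1 k1 kd.
by exists i; rewrite /chi_coord /chi_pos e /= ek el.
Qed.

Lemma eq_wordP n x u : word n u = word n x <->
  forall i, (i < n)%N -> chi R d q m i.+1 u = chi R d q m i.+1 x.
Proof.
split=> [e i i_n|e]; first by rewrite -!($nth_word n) ?e.
by apply: (@eq_from_nth _ 0%N); rewrite !($size_word)// => i i_n; rewrite !($nth_word)// e.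
Qed.

Lemma word_eq_le n n' x u : (n <= n')%N -> word n' u = word n' x -> word n u = word n x.
Proof. by move=> nn e; rewrite -!($take_word n n')// e. Qed.

(** With [word_agree]: the enumeration by positions and the enumeration by [chi] are cofinal, so
    they define the same topology and the same Borel sets. *)
Lemma agree_word n : exists M, forall x u, agree d m M x u -> word n u = word n x.
Proof.
exists (\max_(i < n) chi_pos i.+1) => x u xu; apply/eq_wordP => i i_n.
rewrite !chi_posE// /Defs.coord; case: insubP => // k _ _.
rewrite xu// prednK ?chi_pos_ge1//.
exact: (@leq_bigmax _ (fun i : 'I_n => chi_pos i.+1) (Ordinal i_n)).
Qed.

Lemma word_agree n : exists M, forall x u, word M u = word M x -> agree d m n x u.
Proof.
elim: n => [|n [M hM]]; first by exists 0%N.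
suff [M' hM'] : exists M', forall x u, word M' u = word M' x -> u n = x n.
  exists (maxn M M') => x u e i; rewrite ltnS leq_eqVlt => /orP[/eqP ->|i_n].
    by apply: hM'; apply: word_eq_le e; exact: leq_maxr.
  by apply: hM => //; apply: word_eq_le e; exact: leq_maxl.
have ex (k : 'I_d) : exists i, [/\ (1 <= i)%N, chi_coord i = k.+1 & chi_pos i = n.+1].
  by apply: chi_coord_surj => //=; exact: ltn_ord.
have [f hf] := choice ex.
exists (\max_(k < d) f k) => x u /eq_wordP e.
apply: functional_extensionality_dep => k; apply: val_inj => /=.
have [f1 fc fp] := hf k.
have := e (f k).-1; rewrite prednK// => /(_ (@leq_bigmax _ f k)).
rewrite !chi_posE// fc fp /Defs.coord /=.
by case: insubP => [k' _ /= ek|]; [rewrite (_ : k' = k)//; exact: val_inj|rewrite ltn_ord].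
Qed.

Definition chi_cyl (w : seq nat) : set Sg := [set u | word (size w) u = w].

Lemma measurable_word n (A : set (seq nat)) :
  measurable ([set u | A (word n u)] : set (SigmaB d m)).
Proof.
have [M hM] := agree_word n.
by apply: (@measurable_fin_det _ _ _ M) => x u /hM /= ->.
Qed.

Lemma measurable_chi_cyl w : measurable (chi_cyl w : set (SigmaB d m)).
Proof. exact: (measurable_word (size w) [set w]). Qed.

Lemma open_chi_cyl (U : set Sg) : open U ->
  U = \bigcup_(w in [set w | chi_cyl w `<=` U]) chi_cyl w.
Proof.
move=> oU; apply/seteqP; split=> x; last by move=> [w hw]; exact: hw.
move=> Ux; have [n nU] := open_agree_sub d m U x oU Ux.
have [M hM] := word_agree n.
exists (word M x); last by rewrite /chi_cyl /= ($size_word).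
by move=> u; rewrite /chi_cyl /= ($size_word) => /hM; exact: nU.
Qed.

(** The number [m 1] is never a letter. Having the empty set among the cylinders makes them stable
    under intersection, as the uniqueness of measures requires. *)
Lemma chi_cyl_out : chi_cyl [:: m 1] = set0.
Proof.
apply/seteqP; split=> // u; rewrite /chi_cyl /= /Defs.word /= => -[e].
by have := $chi_lt1 u 1 isT; rewrite e ltnn.
Qed.

Lemma chi_cyl_unique (mu nu : probability (SigmaB d m) R) :
  (forall w, mu (chi_cyl w) = nu (chi_cyl w)) ->
  forall A : set (SigmaB d m), measurable A -> mu A = nu A.
Proof.
move=> e A mA; apply: (@measure_unique _ R (SigmaB d m) (range chi_cyl) (fun=> chi_cyl [::]) _ _ _ _ mu nu) => // {A mA}.
- rewrite eqEsubset; split.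
    apply: smallest_sub; first exact: smallest_sigma_algebra.
    move=> U oU; rewrite (open_chi_cyl U oU).
    apply: (@bigcup_seq_measurable _ (g_sigma_algebraType (range chi_cyl))) => w.
    by apply: sub_sigma_algebra; exists w.
  apply: smallest_sub; first exact: sigma_algebra_measurable.
  by move=> _ [w _ <-]; exact: measurable_chi_cyl.
- move=> _ _ [w _ <-] [w' _ <-].
  wlog ww : w w' / (size w <= size w')%N.
    by move=> H; case: (leqP (size w) (size w')) => [|/ltnW] ?; [|rewrite setIC]; exact: H.
  case: (eqVneq (take (size w) w') w) => [<-|ne]; last first.
    exists [:: m 1] => //; rewrite chi_cyl_out; apply/seteqP; split=> // u [] /= h1 h2.
    by move/eqP: ne; apply; rewrite -{1}h2 ($take_word)// h1.
  exists w' => //; apply/seteqP; split=> [u h|u []//]; split=> //.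
  rewrite /chi_cyl /= size_take_min; move: h; rewrite /chi_cyl /= => h.
  by rewrite -{2}h ($take_word) ?geq_minr// (minn_idPl ww).
- by apply/seteqP; split => // x _; exists 0%N.
- by move=> A [w _ <-]; exact: e.
- by move=> _; apply: le_lt_trans (probability_le1 _ _) (ltry _); exact: measurable_chi_cyl.
Qed.

Variable Omega : set Sg.
Hypothesis cOmega : closed Omega.
Local Notation Pref := (Pref R d q m Omega).

Lemma cylE w : cyl R d q m Omega w = Omega `&` chi_cyl w.
Proof. by []. Qed.

Lemma closed_word x : (forall n, Pref (word n x)) -> Omega x.
Proof using cOmega hd hq hm hmd.
move=> Px; apply: cOmega => U /= Ux.
have : (U^°) x by exact: Ux.
move=> Ux'; have [n nU] := open_agree_sub d m _ x (open_interior U) Ux'.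
have [M hM] := word_agree n; have [u Ou] := Px M; rewrite ($size_word) => e.
by exists u; split => //; apply: interior_subset; apply: nU; apply: hM.
Qed.

Lemma measurable_Omega : measurable (Omega : set (SigmaB d m)).
Proof using cOmega.
by rewrite -(setCK Omega); apply: measurableC; apply: open_measurable; exact: closed_openC.
Qed.

Section OfWeights.
Variable b : seq nat -> R.
Hypotheses (b1 : b [::] = 1) (b_ge0 : forall w, 0 <= b w)
  (b_sum : forall w, b w = \sum_(0 <= c < m 1) b (rcons w c))
  (b_Pref : forall w, ~ Pref w -> b w = 0).

(** A stream of letters is sent to the point whose [chi_(j+1)] is the letter of index j; each entry
    being read by exactly one [chi_i], this defines a point. Streams of positive weight have all
    their prefixes in [Pref], which keeps the letters inside the alphabets. *)
Lemma measure_of_weights : exists mu : probability (SigmaB d m) R,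
  (forall w, mu (chi_cyl w) = (b w)%:E) /\ mu Omega = 1%E.
Proof using All.
have ex (i : nat) (k : 'I_d) : exists j, chi_coord j.+1 = k.+1 /\ chi_pos j.+1 = i.+1.
  have [j [j1 jc jp]] := chi_coord_surj i.+1 k.+1 isT (ltn_ord k).
  by exists j.-1; rewrite prednK.
have [f hf] : exists f : nat -> 'I_d -> nat, forall i k,
    chi_coord (f i k).+1 = k.+1 /\ chi_pos (f i k).+1 = i.+1.
  have h i := choice (ex i).
  by exists (fun i => projT1 (h i)) => i k; exact: (projT2 (h i)) k.
pose Phi (g : nat -> nat) : Sg := fun i k => inord (g (f i k)).
have Phi_det n : exists M, forall g g', (forall j, (j < M)%N -> g j = g' j) ->
    agree d m n (Phi g) (Phi g').
  exists (\max_(i < n) \max_(k < d) (f i k).+1) => g g' e i i_n.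
  apply: functional_extensionality_dep => k; rewrite /Phi e//.
  apply: leq_trans (@leq_bigmax _ (fun i : 'I_n => \max_(k < d) (f i k).+1)%N (Ordinal i_n)).
  exact: (@leq_bigmax _ (fun k => (f i k).+1) k).
have chi_Phi g j : (forall n, 0 < b (mkseq g n)) -> chi R d q m j.+1 (Phi g) = g j.
  move=> bg; rewrite chi_posE//.
  have /andP[c1 cd] := chi_coord_range j.+1 isT; have p1 := chi_pos_ge1 j.+1 isT.
  have cd' : ((chi_coord j.+1).-1 < d)%N by lia.
  rewrite /Defs.coord insubT /= /Phi.
  have -> : f (chi_pos j.+1).-1 (Sub (chi_coord j.+1).-1 cd') = j.
    apply: succn_inj; apply: chi_coord_inj => //.
      by have [-> _] := hf (chi_pos j.+1).-1 (Sub (chi_coord j.+1).-1 cd'); rewrite prednK.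
    by have [_ ->] := hf (chi_pos j.+1).-1 (Sub (chi_coord j.+1).-1 cd'); rewrite prednK.
  have Pg : Pref (rcons (mkseq g j) (g j)).
    rewrite -mkseqS; apply: contrapT => /b_Pref e; by have := bg j.+1; rewrite e ltxx.
  have := $Pref_rcons_lt Omega _ _ Pg; rewrite size_mkseq -/(chi_coord _) => lt.
  by rewrite inordK// prednK// prednK//; exact: leq_ltn_trans lt.
have [mu hmu] := kolmogorov R (m 1) b b1 b_ge0 b_sum d m Phi Phi_det.
have muC w : mu (chi_cyl w) = (b w)%:E.
  case: (boolP (all (fun c => (c < m 1)%N) w)) => lw; last first.
    have nP : ~ Pref w.
      move=> [x Ox ex']; move/negP: lw; apply; apply/(all_nthP 0%N) => i iw.
      by rewrite -ex' ($nth_word)//; exact: $chi_lt1.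
    rewrite b_Pref//; have -> : chi_cyl w = set0; last by rewrite measure0.
    apply/seteqP; split=> // u e; move/negP: lw; apply; apply/(all_nthP 0%N) => i iw.
    by rewrite -e ($nth_word)//; exact: $chi_lt1.
  apply: hmu => // g bg; rewrite /chi_cyl /=.
  suff -> : word (size w) (Phi g) = mkseq g (size w) by [].
  apply: (@eq_from_nth _ 0%N); rewrite ?($size_word) ?size_mkseq// => i iw.
  by rewrite ($nth_word)// nth_mkseq// chi_Phi.
exists mu; split=> //.
(* The complement of the closed set [Omega] is covered by the countably many cylinders of words
   outside [Pref], all of weight 0. *)
have null : mu.-negligible (~` (Omega : set (SigmaB d m))).
  pose G (o : option (seq nat)) : set (SigmaB d m) := if o is Some w then
    if `[< Pref w >] then set0 else chi_cyl w else set0.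
  have sub : (~` (Omega : set (SigmaB d m))) `<=` \bigcup_n G (unpickle n).
    move=> x Ox; have : ~ forall n, Pref (word n x) by move=> /closed_word.
    move=> /existsNP[n nP]; exists (pickle (word n x)) => //.
    by rewrite pickleK /=; case: asboolP => // _; rewrite /chi_cyl /= ($size_word).
  apply: (negligibleS sub); apply: negligible_bigcup => n; case: (unpickle n) => [w|] /=; last exact: negligible_set0.
  case: asboolP => [_|nP]; first exact: negligible_set0.
  have e0 : mu (chi_cyl w) = 0%E by rewrite muC b_Pref.
  by apply/negligibleP; [exact: measurable_chi_cyl|exact: e0].
have mO := measurable_Omega.
have : mu (~` Omega) = 0%E by apply/negligibleP => //; exact: measurableC.
rewrite probability_setC// => /eqP; rewrite sube_eq ?add0e// ?fin_num_measure//.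
by move=> /eqP <-.
Qed.

End OfWeights.
End ChiCylinders.

(** * Entropy and nested sums *)

Fixpoint words (b n : nat) : seq (seq nat) :=
  if n is n'.+1 then [seq rcons w c | w <- words b n', c <- iota 0 b] else [:: [::]].

Lemma big_words_S (R : zmodType) b n (F : seq nat -> R) :
  \sum_(w <- words b n.+1) F w = \sum_(w <- words b n) \sum_(0 <= c < b) F (rcons w c).
Proof. by rewrite /= big_allpairs_dep /index_iota subn0. Qed.

Lemma mem_words b n w : (w \in words b n) = (size w == n) && all (fun c => (c < b)%N) w.
Proof.
elim: n w => [|n IH] w; first by case: w.
apply/allpairsP/andP => [[[u c] /= [uw cb ->]]|].
  move: uw; rewrite IH mem_iota in cb * => /andP[/eqP su au].
  by rewrite size_rcons su eqxx all_rcons au andbT.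
case/lastP: w => [[]//|u c]; rewrite size_rcons eqSS all_rcons => -[su /andP[cb au]].
by exists (u, c); rewrite /= IH su au mem_iota.
Qed.

Lemma words_uniq b n : uniq (words b n).
Proof.
elim: n => //= n IH; apply: allpairs_uniq => //; first exact: iota_uniq.
by move=> [u c] [u' c'] /= _ _ /rcons_inj[-> ->].
Qed.

Lemma size_words b n w : w \in words b n -> size w = n.
Proof. by rewrite mem_words => /andP[/eqP]. Qed.

Section Consistent.
Variables (R : realType) (b : nat) (a : seq nat -> R).
Hypothesis a_sum : forall w, a w = \sum_(0 <= c < b) a (rcons w c).

Lemma sum_words_take n I (F : seq nat -> R) : (n <= I)%N ->
  \sum_(w <- words b n) a w * F w = \sum_(w <- words b I) a w * F (take n w).
Proof using a_sum.
move=> nI; rewrite -(subnKC nI); elim: (I - n)%N => [|k IH].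
  rewrite addn0 big_seq [RHS]big_seq; apply: eq_bigr => w /size_words sw.
  by rewrite -sw take_size.
rewrite addnS big_words_S IH big_seq [RHS]big_seq; apply: eq_bigr => w /size_words sw.
rewrite a_sum mulr_suml; apply: eq_bigr => c _.
by rewrite -cats1 takel_cat// sw leq_addr.
Qed.

Lemma sum_words_const n : \sum_(w <- words b n) a w = a [::].
Proof using a_sum.
have := sum_words_take 0 n (fun=> 1) isT.
rewrite /= big_seq1 mulr1 => ->.
by apply: eq_bigr => w _; rewrite mulr1.
Qed.

End Consistent.

Definition wentropy (R : realType) (b : nat) (a : seq nat -> R) (n : nat) : R :=
  - \sum_(w <- words b n) a w * ln (a w).

Section Gibbs.
Variables (R : realType) (T : eqType).

Lemma ln_le_sub1 (x : R) : 0 < x -> ln x <= x - 1.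
Proof.
move=> x0; have := expR_ge1Dx (ln x); rewrite lnK ?posrE// => h.
by rewrite lerBrDl.
Qed.

(** [ln u <= u - 1] at [u = y / x]; over two families of equal total mass the left-hand sides sum to
    0. *)
Lemma gibbs_term (x y : R) : 0 <= x -> 0 < y -> x - y <= x * (ln x - ln y).
Proof.
move=> x0 y0; move: x0; rewrite le_eqVlt => /orP[/eqP <-|x0].
  by rewrite mul0r sub0r oppr_le0 ltW.
have := ln_le_sub1 (y / x) (divr_gt0 y0 x0).
rewrite ln_div ?posrE// => h.
have := ler_wpM2l (ltW x0) h; rewrite !mulrBr mulr1 mulrCA divff ?gt_eqF// mulr1.
by lra.
Qed.

Lemma gibbs_eq (x y : R) : 0 <= x -> 0 < y -> x - y = x * (ln x - ln y) -> x = y.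
Proof.
move=> x0 y0; move: x0; rewrite le_eqVlt => /orP[/eqP <-|x0].
  by rewrite mul0r sub0r => /eqP; rewrite oppr_eq0 gt_eqF.
move=> e; have yx : 0 < y / x by exact: divr_gt0.
have hln : ln (y / x) = y / x - 1.
  rewrite ln_div ?posrE//; apply: (mulfI (lt0r_neq0 x0)).
  by rewrite mulrBr mulrBr [x * (y / x)]mulrC divfK ?gt_eqF// mulr1; lra.
have : y / x = 1.
  apply/eqP/negPn/negP => n1.
  have n1' : y / x - 1 != 0 by rewrite subr_eq0.
  have := expR_gt1Dx n1'.
  by rewrite -hln lnK ?posrE// hln addrC subrK ltxx.
by move=> /divr1_eq.
Qed.

(* [y] may vanish where [x] does. *)
Lemma gibbs (s : seq T) (x y : T -> R) :
  (forall i, 0 <= x i) -> (forall i, 0 <= y i) -> (forall i, y i = 0 -> x i = 0) ->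
  \sum_(i <- s) x i = \sum_(i <- s) y i ->
  0 <= \sum_(i <- s) x i * (ln (x i) - ln (y i)) /\
  (\sum_(i <- s) x i * (ln (x i) - ln (y i)) = 0 -> forall i, i \in s -> x i = y i).
Proof.
move=> x0 y0 xy e.
have term i : x i - y i <= x i * (ln (x i) - ln (y i)).
  have := y0 i; rewrite le_eqVlt => /orP[/eqP yi|]; last exact: gibbs_term.
  by rewrite xy// -yi subrr mul0r.
have s0 : \sum_(i <- s) (x i - y i) = 0 by rewrite sumrB e subrr.
split; first by rewrite -[X in X <= _]s0; apply: ler_sum => i _; exact: term.
move=> S0 i si.
have : \sum_(i <- s) (x i * (ln (x i) - ln (y i)) - (x i - y i)) = 0.
  by rewrite sumrB S0 s0 subrr.
move/eqP; rewrite psumr_eq0; last by move=> j _; rewrite subr_ge0.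
move=> /allP/(_ i si) /=; rewrite subr_eq0 => /eqP ei.
have := y0 i; rewrite le_eqVlt => /orP[/eqP yi|yi]; first by rewrite xy.
by apply: gibbs_eq; rewrite ?ei.
Qed.

End Gibbs.

(** * The variational identity on a weighted tree *)

Section WeightedTree.
Variables (R : realType) (b : nat) (Pf : seq nat -> Prop) (D : nat -> R)
  (Z : seq nat -> R) (K : R).
Hypotheses (Pf_nil : Pf [::]) (Pf_rcons : forall w c, Pf (rcons w c) -> Pf w)
  (Pf_lt : forall w c, Pf (rcons w c) -> (c < b)%N)
  (D_gt0 : forall i, (1 <= i)%N -> 0 < D i)
  (D_le : forall i, (1 <= i)%N -> D i.+1 <= D i)
  (Z_ge1 : forall w, Pf w -> 1 <= Z w) (Z_le : forall w, Pf w -> Z w <= K)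
  (Z_sum : forall w, Pf w -> Z w = \sum_(0 <= c < b | `[< Pf (rcons w c) >])
     Z (rcons w c) `^ (D (size w).+2 / D (size w).+1)).

Definition tree_weight (w : seq nat) : R :=
  if `[< Pf w >] then \prod_(0 <= j < size w)
     (Z (take j.+1 w) `^ (D j.+2 / D j.+1) / Z (take j w))
  else 0.
Local Notation beta := tree_weight.

Lemma Pf_take w n : Pf w -> Pf (take n w).
Proof using Pf_rcons.
elim/last_ind: w => [//|w c IH] Pw; case: (leqP n (size w)) => nw.
  by rewrite -cats1 takel_cat//; exact: IH (Pf_rcons _ _ Pw).
by rewrite take_oversize ?size_rcons.
Qed.

Lemma Z_gt0 w : Pf w -> 0 < Z w.
Proof using Z_ge1. by move=> /Z_ge1; exact: lt_le_trans. Qed.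

Lemma tree_weight_nil : beta [::] = 1.
Proof using Pf_nil. by rewrite /beta asboolT// big_geq. Qed.

Lemma tree_weight_out w : ~ Pf w -> beta w = 0.
Proof using. by move=> nP; rewrite /beta asboolF. Qed.

Lemma tree_weight_rcons w c : Pf (rcons w c) ->
  beta (rcons w c) = beta w * (Z (rcons w c) `^ (D (size w).+2 / D (size w).+1) / Z w).
Proof using Pf_rcons.
move=> Pwc; rewrite /beta !asboolT//; last exact: Pf_rcons Pwc.
rewrite size_rcons big_nat_recr//=; congr (_ * (Z _ `^ _ / Z _)).
- apply: eq_big_nat => j /andP[_ jw].
  by rewrite -cats1 !takel_cat// ltnW.
- by rewrite take_oversize// size_rcons.
- by rewrite -cats1 takel_cat// take_size.
Qed.

Lemma tree_weight_gt0 w : Pf w -> 0 < beta w.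
Proof using Pf_rcons Pf_nil Z_ge1.
elim/last_ind: w => [|w c IH] Pw; first by rewrite tree_weight_nil.
have Pw' := Pf_rcons _ _ Pw.
by rewrite tree_weight_rcons// mulr_gt0 ?IH// divr_gt0 ?powR_gt0 ?Z_gt0.
Qed.

Lemma tree_weight_ge0 w : 0 <= beta w.
Proof using Pf_rcons Pf_nil Z_ge1.
by case: (pselect (Pf w)) => [/tree_weight_gt0/ltW//|/tree_weight_out ->].
Qed.

Lemma tree_weight_sum w : beta w = \sum_(0 <= c < b) beta (rcons w c).
Proof using Pf_rcons Pf_nil Z_ge1 Z_sum.
case: (pselect (Pf w)) => Pw; last first.
  rewrite tree_weight_out// big1// => c _; rewrite tree_weight_out//.
  by move=> /Pf_rcons.
rewrite (bigID (fun c => `[< Pf (rcons w c) >]))/= [X in _ + X]big1 ?addr0; last first.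
  by move=> c /asboolP/tree_weight_out.
under eq_bigr => c /asboolP Pc do rewrite tree_weight_rcons// mulrA.
rewrite -mulr_suml -mulr_sumr -Z_sum// -mulrA divff ?mulr1//.
by rewrite gt_eqF// Z_gt0.
Qed.

Lemma K_ge1 : 1 <= K.
Proof using Pf_nil Z_ge1 Z_le. exact: le_trans (Z_ge1 _ Pf_nil) (Z_le _ Pf_nil). Qed.

Lemma ln_tree_weight_rcons w c : Pf (rcons w c) ->
  D (size w).+1 * ln (beta (rcons w c)) = D (size w).+1 * ln (beta w) +
    D (size w).+2 * ln (Z (rcons w c)) - D (size w).+1 * ln (Z w).
Proof using Pf_rcons Pf_nil Z_ge1 D_gt0.
move=> Pwc; have Pw := Pf_rcons _ _ Pwc.
have Z0 := Z_gt0 _ Pw; have Z0' := Z_gt0 _ Pwc; have b0 := tree_weight_gt0 _ Pw.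
rewrite tree_weight_rcons// lnM ?posrE ?divr_gt0 ?powR_gt0//.
rewrite ln_div ?posrE ?powR_gt0// ln_powR.
have D0 : D (size w).+1 != 0 by rewrite gt_eqF// D_gt0.
by field.
Qed.

(** A transition probability is a summand of [Z w] divided by [Z w], hence at most 1; its numerator
    is at least 1, hence it is at least 1/K. *)
Lemma ln_tree_weight w : Pf w -> 0 <= - ln (beta w) <= (size w)%:R * ln K.
Proof using All.
elim/last_ind: w => [|w c IH] Pwc; first by rewrite tree_weight_nil ln1 oppr0 mul0r lexx.
have Pw := Pf_rcons _ _ Pwc.
have /andP[h1 h2] := IH Pw.
have Z1 := Z_ge1 _ Pw; have Z1' := Z_ge1 _ Pwc.
have Z0 := Z_gt0 _ Pw; have Z0' := Z_gt0 _ Pwc; have b0 := tree_weight_gt0 _ Pw.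
have D0 : 0 < D (size w).+1 by exact: D_gt0.
have e := tree_weight_rcons _ _ Pwc; set x := Z (rcons w c) `^ _ in e.
have x1 : 1 <= x.
  rewrite /x -(powRr0 (Z (rcons w c))); apply: ler_powR => //.
  by rewrite divr_ge0// ltW// D_gt0.
have x0 : 0 < x by rewrite powR_gt0.
have xZ : x <= Z w.
  rewrite Z_sum// big_mkcond (bigD1_seq c) ?iota_uniq ?mem_index_iota ?(Pf_lt _ _ Pwc)//=.
  rewrite asboolT// -/x lerDl; apply: sumr_ge0 => i _; case: asboolP => // _; exact: powR_ge0.
rewrite e lnM ?posrE ?divr_gt0// ln_div ?posrE// size_rcons -natr1 mulrDl mul1r.
have lx : 0 <= ln x by rewrite ln_ge0.
have lxZ : ln x <= ln (Z w) by rewrite ler_ln ?posrE.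
have lZ : ln (Z w) <= ln K by rewrite ler_ln ?posrE ?(lt_le_trans ltr01 K_ge1)// Z_le.
by lra.
Qed.

(* Summation by parts turns the recursion for [Z] into a telescoping identity. *)
Lemma ln_tree_weight_telescope w I : Pf w -> (I <= size w)%N ->
  \sum_(1 <= n < I.+1) (D n - D n.+1) * - ln (beta (take n w)) =
  D 1 * ln (Z [::]) - D I.+1 * (ln (Z (take I w)) - ln (beta (take I w))).
Proof using All.
move=> Pw; elim: I => [|I IH] Iw.
  by rewrite big_geq// take0 tree_weight_nil ln1 subr0 subrr.
rewrite big_nat_recr//= IH ?(ltnW Iw)//.
have := ln_tree_weight_rcons (take I w) (nth 0%N w I).
rewrite -take_nth// size_takel 1?ltnW// => /(_ (Pf_take _ _ Pw)) h.
rewrite !mulrBr mulrBl; lra.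
Qed.

Section Compare.
Variable a : seq nat -> R.
Hypotheses (a1 : a [::] = 1) (a_ge0 : forall w, 0 <= a w)
  (a_sum : forall w, a w = \sum_(0 <= c < b) a (rcons w c))
  (a_out : forall w, ~ Pf w -> a w = 0).

Definition relative_entropy n : R :=
  \sum_(w <- words b n) a w * (ln (a w) - ln (beta w)).

Lemma relative_entropy_ge0 n : 0 <= relative_entropy n.
Proof using All.
apply: (proj1 (gibbs _ _ _ _ _ _ _ _ _)) => //; first exact: tree_weight_ge0.
- by move=> w; case: (pselect (Pf w)) => [/tree_weight_gt0/gt_eqF/eqP//|/a_out].
- by rewrite !sum_words_const ?tree_weight_nil//; exact: tree_weight_sum.
Qed.

Lemma relative_entropy_eq0 n w : relative_entropy n = 0 -> w \in words b n -> a w = beta w.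
Proof using All.
move=> h; apply: (proj2 (gibbs _ _ _ _ _ _ _ _ _)) h _ => //; first exact: tree_weight_ge0.
- by move=> v; case: (pselect (Pf v)) => [/tree_weight_gt0/gt_eqF/eqP//|/a_out].
- by rewrite !sum_words_const ?tree_weight_nil//; exact: tree_weight_sum.
Qed.

Lemma entropy_sum_identity I :
  \sum_(1 <= n < I.+1) (D n - D n.+1) * wentropy R b a n =
  D 1 * ln (Z [::]) - D I.+1 * \sum_(w <- words b I) a w * (ln (Z w) - ln (beta w))
  - \sum_(1 <= n < I.+1) (D n - D n.+1) * relative_entropy n.
Proof using All.
have e n : wentropy R b a n = \sum_(w <- words b n) a w * - ln (beta w) - relative_entropy n.
  by rewrite /wentropy /relative_entropy -sumrN -sumrB; apply: eq_bigr => w _; ring.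
under eq_bigr do rewrite e mulrBr.
rewrite sumrB; congr (_ - _).
rewrite (eq_big_nat _ _ (F2 := fun n => \sum_(w <- words b I)
    a w * ((D n - D n.+1) * - ln (beta (take n w))))); last first.
  move=> n /andP[n1 nI]; rewrite (sum_words_take R b a a_sum n I (fun w => - ln (beta w)))//.
  by rewrite mulr_sumr; apply: eq_bigr => w _; ring.
rewrite exchange_big /=.
rewrite -[D 1 * _]mul1r -a1 -(sum_words_const R b a a_sum I) mulr_suml mulr_sumr -sumrB.
rewrite big_seq [RHS]big_seq; apply: eq_bigr => w /size_words sw.
rewrite -mulr_sumr; case: (pselect (Pf w)) => Pw; last by rewrite a_out// !mul0r mulr0 subrr.
rewrite ln_tree_weight_telescope ?sw// take_oversize ?sw//; ring.
Qed.

(** The boundary term grows at most linearly, so that any decay of [D] faster than 1/I removes it;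
    its sign is what the upper bound for competitors needs. *)
Lemma tail_term_bounds I :
  0 <= \sum_(w <- words b I) a w * (ln (Z w) - ln (beta w)) <= I.+1%:R * ln K.
Proof using All.
apply/andP; split.
  apply: sumr_ge0 => w _; case: (pselect (Pf w)) => Pw; last by rewrite a_out// mul0r.
  rewrite mulr_ge0// addr_ge0 ?ln_ge0 ?Z_ge1//.
  by have /andP[] := ln_tree_weight _ Pw.
rewrite (_ : I.+1%:R * ln K = \sum_(w <- words b I) a w * (I.+1%:R * ln K)); last first.
  by rewrite -mulr_suml sum_words_const// a1 mul1r.
rewrite big_seq [leRHS]big_seq; apply: ler_sum => w /size_words sw.
case: (pselect (Pf w)) => Pw; last by rewrite a_out// !mul0r.
apply: ler_wpM2l => //; have /andP[_ h] := ln_tree_weight _ Pw.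
rewrite -natr1 mulrDl mul1r addrC -sw lerD//.
by rewrite ler_ln ?posrE ?Z_gt0 ?(lt_le_trans ltr01 K_ge1)// Z_le.
Qed.

Lemma wentropy_ge0 n : 0 <= wentropy R b a n.
Proof using All.
rewrite oppr_ge0; rewrite big_seq; apply: sumr_le0 => w wn.
have aw1 : a w <= 1.
  rewrite -a1 -(sum_words_const R b a a_sum n) (bigD1_seq w)//= ?words_uniq//.
  by rewrite lerDl; apply: sumr_ge0.
rewrite mulr_ge0_le0// ; exact: ln_le0.
Qed.

(** A single relative entropy is kept: a competitor attaining the bound must have it equal to 0
    wherever [D n.+1 < D n]. *)
Lemma entropy_sum_le I n : (1 <= n <= I)%N ->
  \sum_(1 <= n < I.+1) (D n - D n.+1) * wentropy R b a n <=
  D 1 * ln (Z [::]) - (D n - D n.+1) * relative_entropy n.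
Proof using All.
move=> /andP[n1 nI]; rewrite entropy_sum_identity.
have /andP[h _] := tail_term_bounds I.
have D0 : 0 < D I.+1 by exact: D_gt0.
have h' := mulr_ge0 (ltW D0) h.
have : (D n - D n.+1) * relative_entropy n <=
    \sum_(1 <= k < I.+1) (D k - D k.+1) * relative_entropy k.
  rewrite (bigD1_seq n) ?iota_uniq ?mem_index_iota ?n1//= lerDl big_seq_cond.
  apply: sumr_ge0 => k /andP[]; rewrite mem_index_iota => /andP[k1 _] _.
  by rewrite mulr_ge0 ?relative_entropy_ge0// subr_ge0 D_le.
by lra.
Qed.

End Compare.
End WeightedTree.

(** * The nested sums as one recursion over all prefixes *)

Section TreeMeasure.
Variables (R : realType) (d q : nat) (m : nat -> nat).
Hypotheses (hd : (2 <= d)%N) (hq : (2 <= q)%N)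
  (hm : forall k, (1 <= k < d)%N -> (m k.+1 <= m k)%N) (hmd : (2 <= m d)%N).
Variable Omega : set (Sigma d m).
Hypothesis Omega0 : Omega !=set0.
Variable t : seq nat -> R.

Local Notation Pref := (Pref R d q m Omega).
Local Notation N := (N_ R d q m).
Local Notation w := (weight R d q m).
Local Notation E := (level_weight R d q m).
Local Notation nested := (nested_sum R d q m Omega).
Local Notation te := (tree_exponent R d q m).
Local Notation Mx := ((m d)%:R `^ (omega R d q m N.+1 * d%:R)).

Hypothesis t_sol : forall X, size X = N -> Pref X -> tree_solution R d q m Omega X t.
#[local] Set Default Proof Using "hd hq hm hmd".
Local Notation "$ l" := (l R d q m hd hq hm hmd) (at level 0).

(** Distance from n to the next leaf level [N + l d] strictly after n, so d and not 0 at a leaf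
    level: there [tree_sum] is the sum below the leaf, a power of t, and not t itself. *)
Definition letters_left (n : nat) : nat := if (n < N)%N then (N - n)%N else (d - (n - N) %% d)%N.
Definition tree_sum (u : seq nat) : R := nested t (letters_left (size u)) u.
Local Notation Z := tree_sum.

Local Lemma N_ge_d' : (d <= N)%N. Proof. exact: $N_ge. Qed.
#[local] Hint Resolve N_ge_d' : core.

Lemma letters_left_range n : (1 <= letters_left n <= N)%N.
Proof.
rewrite /letters_left; case: (ltnP n N) => h; first lia.
have := ltn_pmod (n - N) (ltnW hd); have := N_ge_d'; lia.
Qed.

Lemma letters_leftP n : exists l, (n + letters_left n = N + l * d)%N /\
  (l = 0%N \/ (letters_left n <= d)%N).
Proof.
rewrite /letters_left; case: (ltnP n N) => h; first by exists 0%N; split; [lia|left].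
exists ((n - N) %/ d).+1; split; last by right; exact: leq_subr.
have := ltn_pmod (n - N) (ltnW hd); have := divn_eq (n - N) d; rewrite mulSn; lia.
Qed.

Lemma letters_leftS n : letters_left n.+1 =
  if letters_left n == 1%N then d else (letters_left n).-1.
Proof.
rewrite /letters_left; case: (ltnP n.+1 N) => h1.
  by rewrite (ltn_trans _ h1)// ifF; lia.
case: (ltnP n N) => h2.
  have -> : n.+1 = N by lia.
  by rewrite subnn mod0n subn0 ifT//; lia.
have dm := ltn_pmod (n - N) (ltnW hd).
rewrite subSn// modnS; case: ifP => dv.
  rewrite ifT ?subn0//; move: dv; rewrite /dvdn -addn1 -modnDml addn1.
  case: (ltngtP ((n - N) %% d).+1 d) => [lt||eq]; [by rewrite modn_small//; lia|lia|lia].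
rewrite ifF; first lia.
apply/negbTE/eqP => e; move/negP: dv; apply.
by rewrite /dvdn -addn1 -modnDml addn1 (_ : ((n - N) %% d).+1 = d) ?modnn//; lia.
Qed.

Lemma weight_mono i j : (1 <= i)%N -> (i <= j)%N -> w j <= w i.
Proof.
move=> i1; elim: j => [|j IH]; first by rewrite leqn0 => /eqP ->.
rewrite leq_eqVlt => /orP[/eqP -> //|ij].
by apply: le_trans (IH ij); apply: ($weight_le); exact: leq_trans i1 ij.
Qed.

Lemma weight_period i l : (N - d < i)%N -> w (i + l * d) = w i / q%:R ^+ l.
Proof.
move=> hi; elim: l => [|l IH]; first by rewrite addn0 expr0 divr1.
rewrite mulSn addnCA addnC ($weight_add_d); last lia.
by rewrite IH exprS invfM mulrA mulrAC.
Qed.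

Lemma tree_solution_leaf v l : Pref v -> size v = (N + l * d)%N ->
  1 <= t v <= Mx /\ t v `^ te = nested t d v.
Proof using t_sol hd hq hm hmd.
move=> Pv sv.
have sX : size (take N v) = N by rewrite size_takel// sv leq_addr.
have PX : Pref (take N v) by exact: ($Pref_take Omega).
have [h1 h2] := t_sol _ sX PX.
have G : Gamma R d q m Omega (take N v) v.
  by split => //; [exists l|exact: prefix_take].
by split; [exact: h1|exact: h2].
Qed.

Lemma nested_leaf (u v : seq nat) r l : Pref v -> size v = (size u + r)%N ->
  (size u + r = N + l * d)%N -> 1 <= t v <= Mx.
Proof using t_sol hd hq hm hmd.
by move=> Pv sv su; have [] := tree_solution_leaf v l Pv; rewrite ?sv.
Qed.

Lemma tree_sum_ge1 u : Pref u -> 1 <= Z u.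
Proof using t_sol hd hq hm hmd.
move=> Pu; have [l [el _]] := letters_leftP (size u).
have /andP[_ rN] := letters_left_range (size u).
apply: ($nested_ge1) => // v Pv uv sv.
by have /andP[] := nested_leaf u v _ _ Pv sv el.
Qed.

Definition tree_sum_bound : R :=
  expR ((N%:R * ((q%:R - 1) / q%:R * ln (m d)%:R) + w N * ln Mx) / w N).

Lemma tree_sum_le u : Pref u -> Z u <= tree_sum_bound.
Proof using t_sol hd hq hm hmd.
move=> Pu; have [l [el rl]] := letters_leftP (size u).
have /andP[r1 rN] := letters_left_range (size u).
have h := $nested_le_exp Omega t Mx _ _ _ rN ($tree_bound_ge1) el rl
  (fun v Pv _ sv => nested_leaf u v _ _ Pv sv el) Pu.
have Z1 := tree_sum_ge1 u Pu.
have w0 : 0 < w N by rewrite -($level_weight0) ($level_weight_gt0).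
rewrite -[leLHS]lnK ?posrE ?(lt_le_trans ltr01)// ler_expR ler_pdivlMr//.
rewrite mulrC; apply: (@le_trans _ _ (E (letters_left (size u)) * ln (Z u))).
  apply: ler_wpM2r; first by rewrite ln_ge0.
  by apply: weight_mono; rewrite ?leq_subr//; have := N_ge_d'; lia.
apply: le_trans h _; rewrite lerD2r; apply: ler_wpM2r; last by rewrite ler_nat.
rewrite mulr_ge0 ?divr_ge0 ?ln_ge0 ?subr_ge0//.
  by rewrite ler1n; have := hq; lia.
by rewrite ler1n; have := hmd; lia.
Qed.

(** At a leaf level the exponent of the tree equation is inverse to the weight ratio,
    [tree_exponent * w (n+1) / w n = 1] for n = N + l d. So t is exactly the power of [Z] with which
    a one-letter recursion continues. *)
Lemma tree_sum_leaf v l : Pref v -> size v = (N + l * d)%N ->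
  Z v = t v `^ te /\ Z v `^ (w (size v).+1 / w (size v)) = t v.
Proof using t_sol hd hq hm hmd.
move=> Pv sv; have Nd := N_ge_d'; have [/andP[t1 _] te_eq] := tree_solution_leaf v l Pv sv.
have Zt : Z v = t v `^ te.
  by rewrite te_eq /Z /letters_left sv ifF ?addKn ?modnMl ?subn0//; lia.
split => //; rewrite Zt -powRrM (_ : te * _ = 1) ?powRr1 ?(le_trans ler01)//.
rewrite sv (_ : (N + l * d).+1 = (N - d + 1) + l.+1 * d)%N; last first.
  by have := N_ge_d'; rewrite mulSn; lia.
rewrite !weight_period//; [|lia..]; rewrite ($tree_exponent_E).
have a0 : w (N - d + 1) != 0 by rewrite gt_eqF// ($weight_gt0)//; lia.
have b0 : w N != 0 by rewrite gt_eqF// ($weight_gt0)//; lia.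
have q0 : q%:R != 0 :> R := $q_neq0.
have ql : q%:R ^+ l != 0 :> R by rewrite expf_neq0.
rewrite exprS; move: (q%:R ^+ l) ql => x x0; field.
by rewrite a0 b0 q0 x0.
Qed.

Lemma weight_ratio n : letters_left n != 1%N ->
  w n.+2 / w n.+1 = E (letters_left n).-1 / E (letters_left n).
Proof.
move=> rn1; have Nd := N_ge_d'; have /andP[r1 rN] := letters_left_range n.
have [l [el rl]] := letters_leftP n.
have -> : n.+1 = (N - (letters_left n).-1 + l * d)%N by lia.
rewrite /E (_ : (N - (letters_left n).-1 + l * d).+1 = N - (letters_left n).-2 + l * d)%N; last lia.
case: rl => [->|rd]; first by rewrite !addn0.
rewrite !weight_period; [|lia..].
have ql : (q%:R ^+ l)^-1 != 0 :> R by rewrite invr_neq0// expf_neq0// ($q_neq0).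
by rewrite -mulf_div divff// mulr1.
Qed.

(** Leaves cease to be special: at the last letter of a block the summand t is [Z] to the weight
    ratio, and at the other letters the ratios [omega] repeat with period d. *)
Lemma tree_sum_rec u : Pref u -> Z u = \sum_(0 <= c < m 1 | `[< Pref (rcons u c) >])
   Z (rcons u c) `^ (w (size u).+2 / w (size u).+1).
Proof using t_sol hd hq hm hmd.
move=> Pu; have /andP[r1 rN] := letters_left_range (size u).
have [l [el rl]] := letters_leftP (size u).
rewrite {1}/Z -(prednK r1) ($nested_sumS)//; last 2 first.
- lia.
- move=> v Pv uv; rewrite prednK// => sv.
  by have /andP[h _] := nested_leaf u v _ _ Pv sv el; rewrite (le_trans ler01).
rewrite big_mkord; apply: eq_bigr => c /asboolP Pc.
case: (eqVneq (letters_left (size u)) 1%N) => r.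
  have sc : size (rcons u c) = (N + l * d)%N by rewrite size_rcons; lia.
  have [_] := tree_sum_leaf _ l Pc sc; rewrite size_rcons => ->.
  have [/andP[t1 _] _] := tree_solution_leaf _ l Pc sc.
  rewrite r /= (_ : E 0 / E 1 = 1) ?powRr1 ?(le_trans ler01)//.
  by apply: ($level_weight_div 1); have := N_ge_d'; lia.
rewrite weight_ratio// prednK//; congr (_ `^ _).
by rewrite /Z size_rcons letters_leftS (negbTE r).
Qed.

Lemma tree_sum_nil : Z [::] = t_empty R d q m Omega t.
Proof. by rewrite /Z /letters_left /= ifT ?subn0//; have := N_ge_d'; lia. Qed.

Lemma Pref_nil : Pref [::].
Proof using Omega0. by have [x Ox] := Omega0; exists x. Qed.

Lemma Pref_rconsW u c : Pref (rcons u c) -> Pref u.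
Proof. by apply: ($Pref_prefix Omega); exact: prefix_rcons. Qed.

Local Notation beta := (tree_weight R Pref w Z).

(** [Z] of an inner prefix occurs once with the weight ratio as exponent and once as a denominator,
    which leaves the ratio minus 1; this is the shape of the factors [A_] and [Ak]. *)
Lemma tree_weight_block u a L : (a + L.+1 <= size u)%N -> Pref u ->
  \prod_(a <= j < a + L.+1) (Z (take j.+1 u) `^ (w j.+2 / w j.+1) / Z (take j u)) =
  Z (take (a + L.+1) u) `^ (w (a + L.+1).+1 / w (a + L.+1)) / Z (take a u) *
  \prod_(1 <= j < L.+1) Z (take (a + j) u) `^ (w (a + j).+1 / w (a + j) - 1).
Proof using t_sol hd hq hm hmd.
move=> + Pu; elim: L => [|L IH] au.
  by rewrite addn1 big_nat1 big_geq// mulr1.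
rewrite addnS big_nat_recr/=; last by rewrite leq_addr.
rewrite IH; last by rewrite addnS in au; exact: ltnW.
rewrite [in RHS]big_nat_recr//=.
have Z0 j : 0 < Z (take j u).
  by apply: lt_le_trans ltr01 (tree_sum_ge1 _ _); exact: ($Pref_take Omega).
set x := Z (take (a + L.+1) u).
have x0 : 0 < x by exact: Z0.
set r := w _ / w (a + L.+1).
have -> : x `^ r = x * x `^ (r - 1).
  by rewrite -{2}(powRr1 (ltW x0)) -powRD ?(gt_eqF x0) ?implybT// addrC subrK.
set P := \prod_(1 <= j < _) _; set y := Z (take a u).
have y0 : y != 0 by rewrite gt_eqF// Z0.
have xn0 : x != 0 by rewrite gt_eqF.
move: (Z (take (a + L.+1).+1 u) `^ _) (x `^ _) P => A B P.
by field; rewrite xn0 y0.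
Qed.

(** One block of N letters is followed by l blocks of d letters; at the block ends [tree_sum_leaf]
    replaces the powers of [Z] by t or by t to the power [tree_exponent]. *)
Lemma mu_cylE l u : size u = (N + l * d)%N -> Pref u ->
  beta u = mu_cyl R d q m Omega t l u.
Proof using t_sol hd hq hm hmd.
move=> su Pu; rewrite /tree_weight asboolT// /mu_cyl.
have Nd := N_ge_d'.
have N1 : (1 <= N)%N by lia.
have PT j : Pref (take j u) by exact: ($Pref_take Omega).
have sT j : (j <= l)%N -> size (take (N + j * d) u) = (N + j * d)%N.
  by move=> jl; rewrite size_takel// su leq_add2l leq_mul2r jl orbT.
rewrite su (@big_cat_nat _ _ _ N)//= ?leq_addr//.
congr (_ * _).
  have := tree_weight_block u 0 N.-1; rewrite add0n prednK// su leq_addr => /(_ isT Pu) ->.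
  have sN : size (take N u) = (N + 0 * d)%N by rewrite addn0 size_takel// su leq_addr.
  have [_ e] := tree_sum_leaf (take N u) 0 (PT N) sN; rewrite sN addn0 in e; rewrite e.
  rewrite take0 tree_sum_nil; congr (_ * _); rewrite [RHS]big_add1 /=.
  apply: eq_big_nat => j /andP[j1 jN]; rewrite add0n ($omega_E)//; [|lia..].
  rewrite /A_ /= /Z size_takel ?su; last lia.
  by rewrite /letters_left jN (_ : N - j.+1 + 1 = N - j)%N//; lia.
suff H k : (k <= l)%N -> \prod_(N <= j < N + k * d)
    (Z (take j.+1 u) `^ (w j.+2 / w j.+1) / Z (take j u)) =
  \prod_(1 <= k < k.+1)
    (t (take (N + k * d) u) * t (take (N + k.-1 * d) u) `^ (- te) *
     \prod_(2 <= p < d.+1) Ak R d q m Omega t k p u `^ (omega R d q m (N - d + p) - 1)).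
  exact: H.
elim: k => [|k IH] kl; first by rewrite addn0 !big_geq.
have kd1 : (N + k * d + d <= N + l * d)%N by rewrite -addnA -mulSnr leq_add2l leq_mul2r kl orbT.
rewrite big_nat_recr//= -IH; last exact: ltnW.
rewrite (@big_cat_nat _ _ _ (N + k * d))//= ?leq_addr//; last by rewrite leq_add2l leq_mul2r leqnSn orbT.
congr (_ * _); rewrite mulSnr addnA.
have := tree_weight_block u (N + k * d) d.-1; rewrite prednK ?su ?(ltnW hd)// => /(_ kd1 Pu) ->.
have sk := sT k (ltnW kl); have sk1 := sT k.+1 kl.
have [_ e] := tree_sum_leaf (take (N + k.+1 * d) u) k.+1 (PT _) sk1.
rewrite sk1 mulSnr addnA in e; rewrite e.
have [-> _] := tree_sum_leaf (take (N + k * d) u) k (PT _) sk.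
rewrite -powRN; congr (_ * _); rewrite [RHS]big_add1 /=.
apply: eq_big_nat => j /andP[j1 jd].
rewrite /Ak /= ($omega_E); [|lia..].
rewrite /Z size_takel ?su; last lia.
have ll : letters_left (N + k * d + j) = (d - j)%N.
  rewrite /letters_left ifF; last lia.
  by rewrite (_ : N + k * d + j - N = k * d + j)%N ?modnMDl ?modn_small//; lia.
rewrite ll (_ : d - j.+1 + 1 = d - j)%N; last lia.
suff -> : w (N + k * d + j).+1 / w (N + k * d + j) =
  w (N - d + j.+1) / w (N - d + j.+1).-1 by [].
rewrite (_ : (N + k * d + j).+1 = (N - d + j.+1) + k.+1 * d)%N; last by rewrite mulSn; lia.
rewrite (_ : (N + k * d + j) = (N - d + j) + k.+1 * d)%N; last by rewrite mulSn; lia.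
rewrite !weight_period; [|lia..].
have ql : (q%:R ^+ k.+1)^-1 != 0 :> R by rewrite invr_neq0// expf_neq0// ($q_neq0).
by rewrite (_ : (N - d + j.+1).-1 = N - d + j)%N ?addnS// -mulf_div divff// mulr1.
Qed.

End TreeMeasure.

(** * The functional S as a sum over the coordinate functions *)

Section Partitions.
Variables (R : realType) (d q : nat) (m : nat -> nat).
Hypotheses (hd : (2 <= d)%N) (hq : (2 <= q)%N)
  (hm : forall k, (1 <= k < d)%N -> (m k.+1 <= m k)%N) (hmd : (2 <= m d)%N).
Variable Omega : set (Sigma d m).
Hypothesis Omega0 : Omega !=set0.

Local Notation Pref := (Pref R d q m Omega).
Local Notation pair := (pair_ R d q m).
Local Notation pk := (p_ R d q m).
Local Notation so := (s_of R d q m).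
Local Notation sg := (sigma R d q m).
Local Notation p_st := (p_st R d q m).
Local Notation rank := (pair_rank R d q m).
Local Notation valid := (valid R d q m).
#[local] Set Default Proof Using "hd hq hm hmd".
Local Notation "$ l" := (l R d q m hd hq hm hmd) (at level 0).

Lemma pair_rank_le p p' : (1 <= p)%N -> (p <= p')%N -> (rank p <= rank p')%N.
Proof.
move=> p1; elim: p' => [|p' IH]; first by rewrite leqn0 => /eqP ->.
rewrite leq_eqVlt => /orP[/eqP -> //|pp].
apply: leq_trans (IH pp) _; rewrite ($pair_rankS) ?leq_addr//.
exact: leq_trans p1 pp.
Qed.

Lemma pair_rank_lex p t p' t' : valid p t -> valid p' t' ->
  (rank p' + (d - t') <= rank p + (d - t))%N = (p' < p)%N || ((p' == p) && (t <= t')%N).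
Proof.
move=> /and3P[p1 st td] /and3P[p1' st' td'].
have [sd s1] := $s_of_le p; have [sd' s1'] := $s_of_le p'.
case: (ltngtP p' p) => /= pp.
- have := pair_rank_le p'.+1 p isT pp; rewrite ($pair_rankS)//; lia.
- have := pair_rank_le p.+1 p' isT pp; rewrite ($pair_rankS)//; lia.
- by subst p'; lia.
Qed.

Lemma p_st_E s t u : (s <= u < d)%N -> (t < d)%N ->
  p_st s t (sg s u) = (pk (sg s u) + (u <= t))%N.
Proof.
move=> usd td; rewrite /p_st; case: ifP => [/mapP[v]|/negP h].
  rewrite mem_iota => vst e; have : v = u by apply: ($sigma_inj s) => //; lia.
  move=> ev; have -> : (u <= t)%N by lia.
  by rewrite addn1.
case: leqP => ut; last by rewrite addn0.
by exfalso; apply: h; apply/mapP; exists u => //; rewrite mem_iota; lia.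
Qed.

(* This uses that ties of [sigma] are ordered by increasing index. *)
Lemma p_st_le s t k k' : (1 <= s)%N -> (s <= k)%N -> (k <= k')%N -> (k' < d)%N ->
  (t < d)%N -> (p_st s t k' <= p_st s t k)%N.
Proof.
move=> s1 sk; rewrite leq_eqVlt => /orP[/eqP -> //|kk kd td].
have [u us eu] := $sigma_surj s k ltac:(lia).
have [u' us' eu'] := $sigma_surj s k' ltac:(lia).
rewrite -{1}eu -{1}eu' !p_st_E// eu eu'.
have := $p_le k k' ltac:(lia) ltac:(lia) ltac:(lia).
rewrite leq_eqVlt => /orP[/eqP e|]; last by case: (u <= t)%N; case: (u' <= t)%N; lia.
have := $a_le k k' ltac:(lia) ltac:(lia) ltac:(lia) (esym e) => le.
have := $sigma_index s k k' u u' us us' eu eu' kk le.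
case: (leqP u t); case: (leqP u' t); lia.
Qed.

(** For k = [sigma_s(u)], row p reads coordinate k at depth [p - p_k] through the pair (p, u - 1).
    When the list has reached t this has happened iff u > t, and [p_st] exceeds [p_k] by 1 exactly
    when u <= t. *)
Lemma pair_before p t l k : valid p t -> (1 <= l)%N -> (1 <= k <= d)%N ->
  (exists2 j, (1 <= j <= rank p + (d - t))%N &
     chi_coord R d q m j = k /\ chi_pos R d q m j = l) <->
  if k == d then (l <= p)%N else (so p <= k)%N && (l <= p - p_st (so p) t k)%N.
Proof.
move=> v l1 k1d; have [sd s1] := $s_of_le p.
have /and3P[p1 st td] := v.
have [j [j1 jk jl]] := $chi_coord_surj l k l1 k1d.
have -> : (exists2 j, (1 <= j <= rank p + (d - t))%N &
     chi_coord R d q m j = k /\ chi_pos R d q m j = l) <-> (j <= rank p + (d - t))%N.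
  split=> [[j' /andP[j1' h] [e1 e2]]|h]; last by exists j; rewrite ?j1.
  by have <- : j' = j by apply: ($chi_coord_inj) => //; rewrite ?jk ?jl.
move: jk jl; rewrite /chi_coord /chi_pos; case: ($pair_P j j1) => p' t' v' -> /= ek el.
have /and3P[p1' st' td'] := v'; have [sd' s1'] := $s_of_le p'.
rewrite pair_rank_lex// -el.
have pk' := $pair_coord_p p' t' v'.
have := ek; rewrite {1}/pair_coord; case: eqP => et ek'.
  rewrite ek -ek' eqxx ($p_d) subn0 et.
  by rewrite leq_eqVlt orbC (_ : (t <= d.-1)%N) ?andbT//; lia.
have skr := $sigma_in (so p') t'.+1 ltac:(lia).
rewrite ifF; last by apply/eqP; lia.
have pkk : (pk k < p')%N by rewrite -ek.
case: (leqP (so p) k) => sk /=; last first.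
  have : ~~ (pk k < p)%N by rewrite -($s_ofP)//; lia.
  by move=> h; split=> //; lia.
have [u usd eu] := $sigma_surj (so p) k ltac:(lia).
rewrite -{1}eu p_st_E// eu ek.
case: (ltngtP p' p) => /= pp.
- by split=> // _; case: (u <= t)%N; lia.
- by split=> //; case: (u <= t)%N; lia.
- subst p'; have -> : u = t'.+1 by apply: ($sigma_inj (so p)) => //; [lia|rewrite eu ek'].
  case: (leqP t t') => tt /=; last by split=> //; lia.
  by split=> // _; lia.
Qed.

(** The partition by the entries with indices in S: joins become unions of index sets, and
    partitions agree as soon as their index sets do. *)
Definition coord_part (S : nat -> nat -> Prop) : set (set (Sigma d m)) :=
  [set C | exists2 x, Omega x & C = [set u | Omega u /\
     forall i l, S i l -> Defs.coord u i l = Defs.coord x i l]].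

Lemma alphaE k p : alpha d m Omega k p =
  coord_part (fun i l => (1 <= i <= p)%N /\ (d - k + 1 <= l <= d)%N).
Proof.
apply/seteqP; split=> C [x Ox ->]; exists x => //; apply/seteqP; split=> u [Ou h]; split=> //.
- by move=> i l [h1 h2]; exact: h.
- by move=> i l h1 h2; exact: h.
- by move=> i l h1 h2; exact: h.
- by move=> i l [h1 h2]; exact: h.
Qed.

Lemma join_coord_part S S' :
  join d m (coord_part S) (coord_part S') = coord_part (fun i l => S i l \/ S' i l).
Proof.
apply/seteqP; split=> C.
  move=> [[z Cz] [A [B [[x Ox eA] [y Oy eB] eC]]]]; subst A B C.
  have [[Oz zx] [_ zy]] := Cz.
  exists z => //; apply/seteqP; split=> u.
    move=> [[Ou ux] [_ uy]]; split=> // i l [s|s]; first by rewrite ux// zx.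
    by rewrite uy// zy.
  move=> [Ou uz]; split; split=> // i l s; first by rewrite uz ?zx//; left.
  by rewrite uz ?zy//; right.
move=> [x Ox ->]; split; first by exists x.
exists [set u | Omega u /\ forall i l, S i l -> Defs.coord u i l = Defs.coord x i l],
  [set u | Omega u /\ forall i l, S' i l -> Defs.coord u i l = Defs.coord x i l].
split; [by exists x|by exists x|].
apply/seteqP; split=> u.
  by move=> [Ou h]; split; split=> // i l s; apply: h; [left|right].
by move=> [[Ou h] [_ h']]; split=> // i l [s|s]; [exact: h|exact: h'].
Qed.

Lemma coord_part_eq S S' : (forall i l, S i l <-> S' i l) -> coord_part S = coord_part S'.
Proof.
by move=> e; congr coord_part; apply/funext => i; apply/funext => l; exact/propext.
Qed.

Lemma Omega_coord_part : [set Omega] = coord_part (fun _ _ => False).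
Proof using Omega0 hd hq hm hmd.
apply/seteqP; split=> C.
  move=> ->; have [x Ox] := Omega0; exists x => //.
  by apply/seteqP; split=> u // [].
by move=> [x Ox ->]; apply/seteqP; split=> u // [].
Qed.

Lemma bigjoin_coord_part (r : seq nat) (F : nat -> nat -> nat -> Prop) :
  \big[join d m/[set Omega]]_(j <- r) coord_part (F j) =
  coord_part (fun i l => exists2 j, j \in r & F j i l).
Proof using Omega0 hd hq hm hmd.
elim: r => [|j r IH].
  by rewrite big_nil Omega_coord_part; apply: coord_part_eq => i l; split=> // -[].
rewrite big_cons IH join_coord_part; apply: coord_part_eq => i l; split.
  move=> [h|[j' jr h]]; first by exists j; rewrite ?mem_head.
  by exists j'; rewrite // inE jr orbT.
move=> [j']; rewrite inE => /orP[/eqP -> h|jr h]; first by left.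
by right; exists j'.
Qed.

Definition word_part (n : nat) : set (set (Sigma d m)) :=
  cyl R d q m Omega @` [set u | size u = n /\ Pref u].

Lemma coord_part_word n S : (forall i l, S i l -> (1 <= i)%N /\ (1 <= l <= d)%N) ->
  (forall i l, (1 <= i)%N -> (1 <= l <= d)%N -> S i l <->
     exists2 j, (1 <= j <= n)%N & chi_coord R d q m j = l /\ chi_pos R d q m j = i) ->
  coord_part S = word_part n.
Proof.
move=> S1 hS.
have e x u : (forall i l, S i l -> Defs.coord u i l = Defs.coord x i l) <->
    word R d q m n u = word R d q m n x.
  rewrite ($eq_wordP); split=> [h i i_n|h i l s].
    rewrite !($chi_posE)//; apply: h.
    apply/hS; [exact: $chi_pos_ge1|exact: $chi_coord_range|].
    by exists i.+1.
  have [i1 l1] := S1 _ _ s.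
  have /hS := s => /(_ i1 l1)[j /andP[j1 jn] [<- <-]].
  by have := h j.-1; rewrite prednK// !($chi_posE)//; apply.
apply/seteqP; split=> C.
  move=> [x Ox ->]; exists (word R d q m n x).
    by rewrite /= ($size_word); split=> //; exact: $Pref_word.
  apply/seteqP; split=> u; rewrite /cyl /= ($size_word).
    by move=> [Ou h]; split=> //; apply/e.
  by move=> [Ou h]; split=> //; apply/e.
move=> [u [su [x Ox xu]] <-]; exists x => //; rewrite su in xu.
apply/seteqP; split=> v; rewrite /cyl /= su -xu.
  by move=> [Ov h]; split=> //; apply/e.
by move=> [Ov h]; split=> //; apply/e.
Qed.

(** [alpha^j] prescribes all coordinates from d - j + 1 on to a common depth. Those above d - j + 1
    are prescribed at least as deep by earlier factors, since [p_st] is nonincreasing in the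
    coordinate; so each coordinate is read exactly to its own depth. *)
Lemma partition_E p t : valid p t ->
  join d m (alpha d m Omega 1 p)
    (\big[join d m/[set Omega]]_(2 <= j < (d - so p + 1).+1)
        alpha d m Omega j (p - p_st (so p) t (d - j + 1))) =
  word_part (rank p + (d - t)).
Proof using Omega0 hd hq hm hmd.
move=> v; have [sd s1] := $s_of_le p; have /and3P[p1 st td] := v.
under eq_bigr do rewrite alphaE.
rewrite bigjoin_coord_part alphaE join_coord_part; apply: coord_part_word.
  move=> i l [[h1 h2]|[j]]; first by lia.
  by rewrite mem_index_iota => h1 [h2 h3]; lia.
move=> i l i1 l1; rewrite pair_before//.
case: eqP => [ld|ld].
  subst l; split=> [[[h1 h2]|[j]]|h]; [lia| |by left; lia].
  by rewrite mem_index_iota => h1 [h2 h3]; lia.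
split=> [[[h1 h2]|[j]]|/andP[sl h]]; first lia.
  rewrite mem_index_iota => h1 [h2 h3]; apply/andP; split; first lia.
  have := p_st_le (so p) t (d - j + 1) l s1 ltac:(lia) ltac:(lia) ltac:(lia) td; lia.
right; exists (d - l + 1)%N; first by rewrite mem_index_iota; lia.
by rewrite (_ : d - (d - l + 1) + 1 = l)%N; lia.
Qed.

Section Entropy.
Variable nu : probability (SigmaB d m) R.
Hypothesis nu1 : nu Omega = 1%E.
Hypothesis cOmega : closed Omega.

Definition word_prob (u : seq nat) : R := fine (nu (chi_cyl R d q m u)).

Lemma word_probE u : nu (chi_cyl R d q m u) = (word_prob u)%:E.
Proof. by rewrite /word_prob fineK// fin_num_measure//; exact: $measurable_chi_cyl. Qed.

Lemma null_setC : nu (~` (Omega : set (SigmaB d m))) = 0%E.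
Proof using nu1 cOmega hd hq hm hmd.
by rewrite probability_setC ?nu1 ?subee//; exact: measurable_Omega.
Qed.

Lemma word_prob_cyl u : nu (cyl R d q m Omega u) = (word_prob u)%:E.
Proof using All.
rewrite -word_probE ($cylE).
have mO : measurable (Omega : set (SigmaB d m)) := measurable_Omega d m Omega cOmega.
have mu := $measurable_chi_cyl u.
have e : (chi_cyl R d q m u : set (SigmaB d m)) =
  (Omega `&` chi_cyl R d q m u) `|` (chi_cyl R d q m u `&` ~` Omega).
  by rewrite (setIC Omega) -setIUr setUv setIT.
rewrite [in RHS]e measureU//; last 3 first.
- exact: measurableI.
- by apply: measurableI => //; exact: measurableC.
- by apply/seteqP; split=> // x [[Ox _] [_]].
have e0 : nu (chi_cyl R d q m u `&` ~` Omega) = 0%E.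
  apply/eqP; rewrite eq_le measure_ge0 andbT -null_setC.
  by apply: le_measure; rewrite ?inE//; [apply: measurableI => //; exact: measurableC|exact: measurableC].
by rewrite -[LHS]adde0; congr (_ + _)%E; exact: esym e0.
Qed.

Lemma word_prob_ge0 u : 0 <= word_prob u.
Proof. by rewrite fine_ge0// measure_ge0. Qed.

Lemma word_prob_out u : ~ Pref u -> word_prob u = 0.
Proof using All.
move=> nP; apply: EFin_inj; rewrite -word_prob_cyl (_ : cyl _ _ _ _ _ _ = set0) ?measure0//.
by apply/seteqP; split=> // x [Ox xu]; apply: nP; exists x.
Qed.

Lemma word_prob_nil : word_prob [::] = 1.
Proof.
apply: EFin_inj; rewrite -word_probE (_ : chi_cyl _ _ _ _ _ = setT) ?probability_setT//.
by apply/seteqP; split.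
Qed.

Lemma word_prob_sum u : word_prob u = \sum_(0 <= c < m 1) word_prob (rcons u c).
Proof.
apply: EFin_inj; rewrite -word_probE -sumEFin big_mkord.
have -> : (chi_cyl R d q m u : set (SigmaB d m)) =
    \big[setU/set0]_(c < m 1) chi_cyl R d q m (rcons u c).
  rewrite -(bigcup_mkord (m 1) (fun c => chi_cyl R d q m (rcons u c) : set (SigmaB d m))).
  apply/seteqP; split=> x.
    rewrite /chi_cyl /= => xu; exists (chi R d q m (size u).+1 x); first exact: $chi_lt1.
    by rewrite /= size_rcons ($word_S) xu.
  by move=> [c /= cm]; rewrite /chi_cyl /= size_rcons ($word_S) => /rcons_inj[].
rewrite measure_bigsetU_ord.
- by apply: eq_bigr => c _; exact: word_probE.
- by move=> c; exact: $measurable_chi_cyl.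
- move=> c c' _ _ [x []]; rewrite /chi_cyl /= !size_rcons => -> /rcons_inj[e].
  exact: val_inj.
Qed.

Lemma entropy_word n : entropy R d m nu (word_part n) =
  wentropy R (m 1) word_prob n / ln (m d)%:R.
Proof using All.
rewrite /entropy /word_part fsbig_image; last first.
  move=> u v; rewrite !inE /= => -[su [x Ox xu]] [sv _] e.
  have : cyl R d q m Omega v x by rewrite -e.
  by rewrite /cyl /= sv -su => -[_ <-].
rewrite /wentropy mulNr; congr (- _).
rewrite (fsbigE [seq u <- words (m 1) n | `[< Pref u >]]); last 3 first.
- by rewrite filter_uniq// words_uniq.
- move=> u /=; rewrite mem_filter => /andP[/asboolP Pu un].
  by split => //; exact: size_words un.
- move=> u [su Pu]; rewrite mem_filter asboolT//= mem_words su eqxx /=.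
  move=> /negP[]; have [x Ox xu] := Pu; apply/(all_nthP 0%N) => i iu.
  by rewrite -xu ($nth_word)//; exact: $chi_lt1.
rewrite mulr_suml big_filter_cond [RHS]big_seq [LHS]big_seq_cond.
rewrite [RHS](bigID (fun u => `[< Pref u >]))/= [X in _ = _ + X]big1 ?addr0; last first.
  by move=> u /andP[_ /asboolP nP]; rewrite word_prob_out// mul0r mul0r.
apply: eq_big => [u|u _]; last by rewrite word_prob_cyl /log_ mulrA.
case: (boolP (u \in words _ _)) => un //=; case: asboolP => //= Pu.
by apply: mem_set; split => //; exact: (size_words (m 1)).
Qed.

Local Notation w := (weight R d q m).

Definition partial_S (I : nat) : R :=
  \sum_(1 <= n < I.+1) (w n - w n.+1) * wentropy R (m 1) word_prob n.

Lemma H_tilde_E p : (1 <= p)%N -> H_tilde R d q m Omega nu (so p) p =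
  (partial_S (rank p.+1) - partial_S (rank p)) / ln (m d)%:R.
Proof using All.
move=> p1; rewrite /H_tilde.
have [sd s1] := $s_of_le p.
have -> : partial_S (rank p.+1) - partial_S (rank p) =
    \sum_((rank p).+1 <= i < (rank p.+1).+1) (w i - w i.+1) * wentropy R (m 1) word_prob i.
  rewrite /partial_S (@big_cat_nat _ _ _ (rank p).+1)//=; last first.
    by rewrite ltnS pair_rank_le.
  by rewrite addrAC subrr add0r.
rewrite -($sum_pairs)// mulr_suml; apply: eq_big_nat => t ht.
rewrite partition_E; last by rewrite /valid; lia.
by rewrite entropy_word mulrA.
Qed.

Lemma s_of_small p : (1 <= p)%N -> (p <= pk d.-1)%N -> so p = d.
Proof.
move=> p1 h; have := $s_ofP p d.-1 p1 ltac:(lia) ltac:(lia).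
by have := $s_of_le p; lia.
Qed.

Lemma s_of_mid p s : (2 <= s)%N -> (s < d)%N -> (pk s < p)%N -> (p <= pk s.-1)%N -> so p = s.
Proof.
move=> s2 sd h1 h2; have p1 : (1 <= p)%N by lia.
have := $s_ofP p s p1 ltac:(lia) sd.
have := $s_ofP p s.-1 p1 ltac:(lia) ltac:(lia).
by have := $s_of_le p; lia.
Qed.

(** The ranges of p in [S] are the level sets of s(p), so that all the sums are one sum over rows,
    which telescopes in [partial_S]. *)
Lemma finite_part_S :
  \sum_(1 <= p < (pk d.-1).+1) H_tilde R d q m Omega nu d p +
  \sum_(2 <= s < d) \sum_((pk s).+1 <= p < (pk s.-1).+1) H_tilde R d q m Omega nu s p =
  partial_S (rank (pk 1).+1) / ln (m d)%:R.
Proof using All.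
pose G p := H_tilde R d q m Omega nu (so p) p.
have sumG a b : (1 <= a)%N -> (a <= b)%N ->
    \sum_(a <= p < b) G p = (partial_S (rank b) - partial_S (rank a)) / ln (m d)%:R.
  move=> a1 ab; rewrite (eq_big_nat _ _ (F2 := fun p =>
      partial_S (rank p.+1) / ln (m d)%:R - partial_S (rank p) / ln (m d)%:R)).
    by rewrite (telescope_sumr (fun p => partial_S (rank p) / ln (m d)%:R))// mulrBl.
  by move=> p hp; rewrite /G H_tilde_E ?mulrBl//; lia.
rewrite (eq_big_nat _ _ (F2 := G)); last first.
  by move=> p hp; rewrite /G s_of_small//; lia.
have H e : (1 <= e)%N -> (e < d)%N ->
    \sum_(2 <= s < e.+1) \sum_((pk s).+1 <= p < (pk s.-1).+1) H_tilde R d q m Omega nu s p =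
    \sum_((pk e).+1 <= p < (pk 1).+1) G p.
  elim: e => // e IH _ ed; case: (posnP e) => [->|e0]; first by rewrite !big_geq.
  rewrite big_nat_recr//= IH//; last exact: ltnW.
  have h1 := $p_le e e.+1 e0 (leqnSn e) (ltnW ed).
  have h2 := $p_le 1 e isT e0 ltac:(lia).
  rewrite [RHS](@big_cat_nat _ _ _ (pk e).+1)//= addrC; congr (_ + _).
  by apply: eq_big_nat => p hp; rewrite /G (s_of_mid p e.+1)//=; lia.
have := H d.-1; rewrite prednK; last lia.
move=> ->; [|lia..].
have h := $p_le 1 d.-1 isT ltac:(lia) ltac:(lia).
rewrite -big_cat_nat//= sumG// ($pair_rank1).
by rewrite /partial_S [X in _ - X]big_geq// subr0.
Qed.

Local Notation ps := partial_S.

Hypothesis wentropy_ge0 : forall n, 0 <= wentropy R (m 1) word_prob n.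

Lemma partial_S_le I J : (I <= J)%N -> ps I <= ps J.
Proof using All.
move=> IJ; rewrite /ps [leRHS](@big_cat_nat _ _ _ I.+1)//= lerDl big_nat_cond.
apply: sumr_ge0 => n; rewrite andbT => hn; rewrite mulr_ge0// subr_ge0.
by apply: ($weight_le); lia.
Qed.

(** Entropies are nonnegative, so the series converges in the extended reals; [H_tilde] gathers
    whole rows, hence the partial sums at row ends suffice. *)
Lemma S_cvg : (fun P => (ps (rank P) / ln (m d)%:R)%:E) @ \oo --> S_ R d q m Omega nu.
Proof using All.
have lm : 0 < ln (m d)%:R :> R by apply: ($lnm_gt0) => //; lia.
rewrite /S_ finite_part_S.
have Hge0 p : (1 <= p)%N -> 0 <= H_tilde R d q m Omega nu (so p) p.
  move=> p1; rewrite H_tilde_E// divr_ge0 ?(ltW lm)// subr_ge0 partial_S_le//.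
  by apply: pair_rank_le.
set A := (ps _ / _)%:E.
have C : (fun n => (A + \sum_((pk 1).+1 <= p < n) (H_tilde R d q m Omega nu 1 p)%:E)%E) @ \oo -->
   (A + \sum_((pk 1).+1 <= p <oo) (H_tilde R d q m Omega nu 1 p)%:E)%E.
  apply: cvgeD; [exact: fin_num_adde_defr|exact: cvg_cst|].
  apply: is_cvg_nneseries_cond => n hn _.
  by rewrite lee_fin -(_ : so n = 1%N) ?Hge0//; [lia|apply: ($s_of_gt); lia].
apply: cvg_trans C; apply: near_eq_cvg; near=> n.
have hn : ((pk 1).+1 <= n)%N by near: n; exists (pk 1).+1.
rewrite /A sumEFin -EFinD; congr (_%:E).
rewrite (eq_big_nat _ _ (F2 := fun p =>
    ps (rank p.+1) / ln (m d)%:R - ps (rank p) / ln (m d)%:R)).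
  rewrite (telescope_sumr (fun p => ps (rank p) / ln (m d)%:R))//; ring.
move=> p hp; rewrite -(_ : so p = 1%N); last by apply: ($s_of_gt); lia.
by rewrite H_tilde_E ?mulrBl//; lia.
Unshelve. all: by end_near. Qed.

End Entropy.
End Partitions.

(** * Moments and counting *)

(** [exp x <= 1 / (1 - x)], and [(1 - x) (1 + x + 2 x^2) - 1 = x^2 (1 - 2 x)]. *)
Lemma expR_le_quadratic (R : realType) (x : R) : x <= 2^-1 -> expR x <= 1 + x + 2 * x ^+ 2.
Proof.
move=> x2; have h : 0 < 1 - x by lra.
have : expR x <= (1 - x)^-1.
  rewrite -[leLHS]invrK lef_pV2 ?posrE ?invr_gt0 ?expR_gt0// -expRN.
  exact: expR_ge1Dx.
move=> /le_trans; apply; rewrite -[leLHS]mul1r ler_pdivrMr//.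
have : 0 <= x ^+ 2 * (1 - 2 * x) by rewrite mulr_ge0 ?sqr_ge0//; lra.
by lra.
Qed.

(* Either [th] is small and the exponential is below a quadratic, or the trivial bound suffices. *)
Lemma moment_le (R : realType) (b : nat) (be : seq nat -> R) (C th : R) (J : nat) :
  (forall w, 0 <= be w) -> \sum_(w <- words b J) be w = 1 -> 0 <= C ->
  (forall w, w \in words b J -> be w != 0 -> 0 <= - ln (be w) <= J%:R * C) ->
  \sum_(w <- words b J) be w * expR (th * ln (be w)) <=
    expR (- th * wentropy R b be J + 4 * th ^+ 2 * C ^+ 2 * J%:R ^+ 2).
Proof.
move=> b0 b1 C0 hb; set c := J%:R * C.
have c0 : 0 <= c by rewrite mulr_ge0.
have avg (F : seq nat -> R) (M : R) : (forall w, w \in words b J -> be w != 0 -> F w <= M) ->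
    \sum_(w <- words b J) be w * F w <= M.
  move=> hF; rewrite -[leRHS]mul1r -b1 mulr_suml big_seq [leRHS]big_seq.
  apply: ler_sum => w wJ; have [->|bw] := eqVneq (be w) 0; first by rewrite !mul0r.
  by apply: ler_wpM2l => //; exact: hF.
have H_le : wentropy R b be J <= c.
  rewrite /wentropy -sumrN.
  under eq_bigr do rewrite -mulrN.
  by apply: avg => w wJ bw; have /andP[] := hb w wJ bw.
have H_ge0 : 0 <= wentropy R b be J.
  rewrite /wentropy -sumrN big_seq; apply: sumr_ge0 => w wJ; rewrite -mulrN.
  have [->|bw] := eqVneq (be w) 0; first by rewrite mul0r.
  by rewrite mulr_ge0//; have /andP[] := hb w wJ bw.
have e4 : 4 * th ^+ 2 * C ^+ 2 * J%:R ^+ 2 = (2 * (th * c)) ^+ 2 by rewrite /c; ring.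
rewrite e4; have [small|large] := leP (`|th| * c) 2^-1.
  apply: (@le_trans _ _ (1 + (- th * wentropy R b be J + (2 * (th * c)) ^+ 2))); last exact: expR_ge1Dx.
  apply: (@le_trans _ _ (\sum_(w <- words b J) be w * (1 + th * ln (be w) + 2 * (th * c) ^+ 2))).
    rewrite big_seq [leRHS]big_seq; apply: ler_sum => w wJ.
    have [->|bw] := eqVneq (be w) 0; first by rewrite !mul0r.
    have /andP[l1 l2] := hb w wJ bw.
    apply: ler_wpM2l => //; apply: le_trans (expR_le_quadratic _ _ _) _.
      apply: le_trans (ler_norm _) _; rewrite normrM; apply: le_trans small.
      by apply: ler_wpM2l => //; rewrite -normrN ger0_norm.
    rewrite lerD2l ler_pM2l ?ltr0n// [leLHS]exprMn [leRHS]exprMn; apply: ler_wpM2l; first exact: sqr_ge0.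
    by rewrite -sqrrN; apply: lerXn2r => //; rewrite nnegrE.
  under eq_bigr do rewrite 2!mulrDr mulr1 mulrCA.
  rewrite !big_split/= b1 -mulr_sumr -mulr_suml b1 /wentropy.
  have := sqr_ge0 (th * c); move: (\sum_(w <- _) _) => s h.
  have -> : (2 * (th * c)) ^+ 2 = 4 * (th * c) ^+ 2 by ring.
  by lra.
apply: avg => w wJ bw; rewrite ler_expR.
have /andP[l1 l2] := hb w wJ bw.
have n0 := normr_ge0 th.
have h1 : th * ln (be w) <= `|th| * c.
  apply: le_trans (ler_norm _) _; rewrite normrM.
  by apply: ler_wpM2l => //; rewrite -normrN ger0_norm.
have h2 : th * wentropy R b be J <= `|th| * c.
  apply: le_trans (ler_norm _) _; rewrite normrM.
  by apply: ler_wpM2l => //; rewrite ger0_norm.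
have -> : (2 * (th * c)) ^+ 2 = 4 * (`|th| * c) ^+ 2.
  by rewrite !exprMn real_normK ?num_real//; ring.
have : `|th| * c <= 2 * (`|th| * c) ^+ 2.
  by rewrite expr2 mulrA ler_peMl ?mulr_ge0//; lra.
by lra.
Qed.

(** For a predicate true on an initial segment, the count is the last index where it holds; this
    lets [depth] be defined by a finite sum. *)
Lemma count_initial (p : nat -> bool) M : (forall j, (1 <= j)%N -> p j.+1 -> p j) ->
  forall j, (1 <= j <= M)%N -> (j <= \sum_(1 <= i < M.+1) p i)%N = p j.
Proof.
move=> hp; elim: M => [|M IH] j /andP[j1 jM]; first by lia.
have le n : (\sum_(1 <= i < n.+1) p i <= n)%N.
  apply: (@leq_trans (\sum_(1 <= i < n.+1) 1)); first by apply: leq_sum => i _; case: (p i).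
  by rewrite sum_nat_const_nat; lia.
have down a k : (1 <= a)%N -> p (a + k)%N -> p a.
  by move=> a1; elim: k => [|k IHk]; rewrite ?addn0// addnS => /hp h; apply: IHk; apply: h; lia.
case pM : (p M.+1); last first.
  rewrite big_nat_recr//= pM addn0.
  move: jM; rewrite leq_eqVlt => /orP[/eqP ->|jM]; last by apply: IH; lia.
  by rewrite pM; apply/negbTE; rewrite -ltnNge ltnS; exact: le.
have -> : (\sum_(1 <= i < M.+2) p i)%N = M.+1.
  rewrite (eq_big_nat _ _ (F2 := fun=> 1%N)); first by rewrite sum_nat_const_nat; lia.
  by move=> i hi; rewrite (down i (M.+1 - i)%N) ?subnKC//; lia.
by rewrite jM (down j (M.+1 - j)%N) ?subnKC//; lia.
Qed.

Lemma count_nondiv q f : (1 <= q)%N ->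
  (\sum_(1 <= i < f.+1) ~~ (q %| i) = f - f %/ q)%N.
Proof.
move=> q1; elim: f => [|f IH]; first by rewrite big_geq// div0n.
rewrite big_nat_recr//= IH divnS//; case: (q %| f.+1)%N => /=; last first.
  by have := leq_div f q; lia.
by have := leq_div f q; lia.
Qed.

(** * Counting the chains seen at a given scale *)

Section Counting.
Variables (R : realType) (q : nat) (lam : nat -> R) (A : R).
Hypotheses (q2 : (2 <= q)%N) (lam_gt0 : forall j, (1 <= j)%N -> 0 < lam j)
  (lam_le : forall j, (1 <= j)%N -> lam j.+1 <= lam j)
  (lam_dec : forall j, (1 <= j)%N -> lam j * j%:R ^+ 6 <= A).

(* Only indices up to [cutoff n] can satisfy [1 <= n * lam j]. *)
Definition cutoff (n : nat) : nat := (n * (Num.truncn A).+1)%N.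

(** Length of the prefix of the word of [chi] along the chain of i that is visible at scale n, once
    [lam] is the right multiple of the weights. *)
Definition depth (i n : nat) : nat :=
  (\sum_(1 <= j < (cutoff n).+1) (i%:R <= n%:R * lam j)%R)%N.

Lemma A_gt0 : 0 < A.
Proof using lam_dec lam_gt0.
by apply: lt_le_trans (lam_dec 1 isT); rewrite expr1n mulr1 lam_gt0.
Qed.

Lemma lam_cutoff n j : (cutoff n < j)%N -> n%:R * lam j < 1.
Proof using All.
move=> hj; have j1 : (1 <= j)%N by lia.
have j0 : 0 < j%:R :> R by rewrite ltr0n.
rewrite -(ltr_pM2r (exprn_gt0 6 j0)) mul1r -mulrA.
apply: (@le_lt_trans _ _ (n%:R * A)); first by apply: ler_wpM2l => //; exact: lam_dec.
apply: (@lt_le_trans _ _ j%:R).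
  apply: (@le_lt_trans _ _ (cutoff n)%:R); last by rewrite ltr_nat.
  by rewrite /cutoff natrM; apply: ler_wpM2l => //; exact/ltW/truncnS_gt.
by rewrite ler_eXnr// ler1n.
Qed.

Lemma depthP i n j : (1 <= i)%N -> (1 <= j)%N -> (j <= depth i n)%N = (i%:R <= n%:R * lam j).
Proof using All.
move=> i1 j1; have [jc|jc] := leqP j (cutoff n).
  rewrite /depth (count_initial (fun j => i%:R <= n%:R * lam j)) ?j1//.
  by move=> k k1 /le_trans; apply; apply: ler_wpM2l => //; exact: lam_le.
have -> : (i%:R <= n%:R * lam j) = false.
  apply/negbTE; rewrite -ltNge; apply: lt_le_trans (lam_cutoff n j jc) _; by rewrite ler1n.
apply/negbTE; rewrite -ltnNge; apply: leq_ltn_trans jc.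
apply: (@leq_trans (\sum_(1 <= j < (cutoff n).+1) 1)%N).
  by apply: leq_sum => k _; case: (_ <= _).
by rewrite sum_nat_const_nat; lia.
Qed.

Lemma depth_le_cutoff i n : (1 <= i)%N -> (depth i n <= cutoff n)%N.
Proof using All.
move=> i1; rewrite leqNgt; apply/negP => h.
have := depthP i n (depth i n) i1 ltac:(lia); rewrite leqnn => /esym.
by rewrite leNgt (lt_le_trans (lam_cutoff n _ h))// ler1n.
Qed.

Definition mult (n M j : nat) : R :=
  \sum_(1 <= i < M.+1 | ~~ (q %| i)%N) (i%:R <= n%:R * lam j)%R%:R.

Lemma multE n M j : (1 <= j)%N -> (n%:R * lam j <= M%:R) ->
  mult n M j = (Num.truncn (n%:R * lam j))%:R - (Num.truncn (n%:R * lam j) %/ q)%:R.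
Proof using All.
move=> j1 hM; set y := n%:R * lam j; set f := Num.truncn y.
have y0 : 0 <= y by rewrite mulr_ge0// ltW// lam_gt0.
have fM : (f <= M)%N.
  by rewrite -(ler_nat R); apply: le_trans hM; rewrite truncn_le.
rewrite -natrB ?leq_div// -count_nondiv//; last lia.
rewrite /mult big_mkcond /= natr_sum [LHS](@big_cat_nat _ _ _ f.+1)//=.
rewrite [X in _ + X]big_nat [X in _ + X]big1 ?addr0; last first.
  move=> i /andP[fi _]; case: ifP => // _.
  have : y < i%:R by apply: lt_le_trans (truncnS_gt y) _; rewrite ler_nat.
  by rewrite ltNge => /negbTE ->.
apply: eq_big_nat => i hi.
have -> : i%:R <= y by apply: (@le_trans _ _ f%:R); rewrite ?truncn_le// ler_nat; lia.
by case: (q %| i)%N.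
Qed.

Lemma mult_le n M j : (1 <= j)%N -> (n%:R * lam j <= M%:R) ->
  0 <= mult n M j <= n%:R * lam j.
Proof using All.
move=> j1 hM; rewrite multE// subr_ge0 ler_nat leq_div/=.
have y0 : 0 <= n%:R * lam j by rewrite mulr_ge0// ltW// lam_gt0.
by apply: le_trans (_ : _ <= (Num.truncn (n%:R * lam j))%:R) _; rewrite ?truncn_le// gerBl.
Qed.

(** For y > 1 rounding costs at most 1, for y <= 1 the error is at most y; both are at most
    [sqrt y]. The square root instead of 1 makes the errors summable over j. *)
Lemma mult_dist n M j : (1 <= j)%N -> (n%:R * lam j <= M%:R) ->
  `|mult n M j - (1 - q%:R^-1) * (n%:R * lam j)| <= Num.sqrt (n%:R * lam j).
Proof using All.
move=> j1 hM; set y := n%:R * lam j.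
have y0 : 0 <= y by rewrite mulr_ge0// ltW// lam_gt0.
have q0 : 0 < q%:R :> R by rewrite ltr0n; lia.
have qi : 0 < q%:R^-1 :> R by rewrite invr_gt0.
have qi1 : q%:R^-1 <= 1 :> R by rewrite invf_le1// ler1n; lia.
have [y1|y1] := leP y 1.
  have /andP[m0 m1] := mult_le n M j j1 hM.
  have ys : y <= Num.sqrt y.
    rewrite -{1}(sqr_sqrtr y0) expr2 ler_piMr ?sqrtr_ge0//.
    by rewrite -[leRHS]sqrtr1 ler_wsqrtr.
  apply: le_trans ys; rewrite -/y in m1 *.
  have z0 : 0 <= (1 - q%:R^-1) * y by rewrite mulr_ge0// subr_ge0.
  have z1 : (1 - q%:R^-1) * y <= y by rewrite ler_piMl// gerBl ltW.
  by rewrite ler_norml; apply/andP; split; lra.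
apply: (@le_trans _ _ 1); last by rewrite -[leLHS]sqrtr1 ler_wsqrtr// ltW.
rewrite multE// -/y; set f := Num.truncn y.
have f1 : f%:R <= y by rewrite truncn_le.
have f2 : y < f%:R + 1 by have := truncnS_gt y; rewrite -/f -natr1.
have e : f%:R = (f %/ q)%:R * q%:R + (f %% q)%:R :> R by rewrite {1}(divn_eq f q) natrD natrM.
have r0 : (f %% q)%:R <= q%:R - 1 :> R.
  by rewrite lerBrDr natr1 ler_nat ltn_pmod//; lia.
have r1 : 0 <= (f %% q)%:R :> R by [].
have g : (f %/ q)%:R = (f%:R - (f %% q)%:R) / q%:R :> R.
  by rewrite e addrK mulfK// gt_eqF.
have g1 : (f %/ q)%:R <= y * q%:R^-1.
  by rewrite g ler_pM2r//; lra.
have g2 : y * q%:R^-1 - 1 <= (f %/ q)%:R.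
  have h : y * q%:R^-1 <= (f%:R - (f %% q)%:R + q%:R) * q%:R^-1.
    by rewrite ler_pM2r//; lra.
  by rewrite mulrDl divff ?gt_eqF// -g in h; lra.
by rewrite ler_norml; apply/andP; split; lra.
Qed.

Lemma exchange_depth n M (s : nat -> R) : (1 <= n)%N ->
  \sum_(1 <= i < M.+1 | ~~ (q %| i)%N) \sum_(1 <= j < (depth i n).+1) s j =
  \sum_(1 <= j < (cutoff n).+1) s j * mult n M j.
Proof using All.
move=> n1.
have e i : (1 <= i)%N -> \sum_(1 <= j < (depth i n).+1) s j =
    \sum_(1 <= j < (cutoff n).+1) s j * (i%:R <= n%:R * lam j)%R%:R.
  move=> i1; have dc := depth_le_cutoff i n i1.
  rewrite [RHS](@big_cat_nat _ _ _ (depth i n).+1)//=.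
  rewrite [X in _ = _ + X]big_nat [X in _ = _ + X]big1 ?addr0; last first.
    by move=> j /andP[h1 h2]; rewrite -depthP//; [rewrite leqNgt h1 mulr0|lia].
  by apply: eq_big_nat => j /andP[h1 h2]; rewrite -depthP// -ltnS h2 mulr1.
rewrite big_nat_cond (eq_bigr (fun i => \sum_(1 <= j < (cutoff n).+1) s j * (i%:R <= n%:R * lam j)%R%:R)); last first.
  by move=> i /andP[/andP[i1 _] _]; exact: e.
rewrite -big_nat_cond exchange_big /=; apply: eq_bigr => j _.
by rewrite -mulr_sumr.
Qed.

(** The sixth power in [lam_dec] is chosen for this: [j sqrt (lam j) <= sqrt A / j^2] is
    summable. *)
Lemma sqrt_lam j : (1 <= j)%N -> Num.sqrt (lam j) * j%:R ^+ 3 <= Num.sqrt A.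
Proof using All.
move=> j1; have j0 : 0 <= j%:R ^+ 3 :> R by rewrite exprn_ge0.
rewrite -[_ ^+ 3](@ger0_norm R)// -sqrtr_sqr -sqrtrM ?(ltW (lam_gt0 j j1))//.
by apply: ler_wsqrtr; rewrite -exprM lam_dec.
Qed.

Lemma sum_inv_sq J : \sum_(1 <= j < J.+1) (j%:R ^+ 2)^-1 <= 2 :> R.
Proof using.
case: J => [|J]; first by rewrite big_geq.
suff H : \sum_(1 <= j < J.+2) (j%:R ^+ 2)^-1 <= 2 - (J.+1%:R)^-1 :> R.
  by apply: le_trans H _; rewrite gerBl invr_ge0.
elim: J => [|J IH]; first by rewrite big_nat1 expr1n invr1; lra.
rewrite big_nat_recr//=; apply: le_trans (lerD IH (lexx _)) _.
have x0 : 0 < J.+1%:R :> R by rewrite ltr0n.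
rewrite -[J.+2%:R]natr1; move: x0; move: (J.+1%:R) => x x0.
rewrite -subr_ge0.
have -> : 2 - (x + 1)^-1 - (2 - x^-1 + ((x + 1) ^+ 2)^-1) = (x * (x + 1) ^+ 2)^-1.
  by field; rewrite !gt_eqF//; lra.
by rewrite invr_ge0 mulr_ge0 ?sqr_ge0// ltW.
Qed.

Lemma sum_lam (c : R) J : 0 <= c ->
  \sum_(1 <= j < J.+1) (c * j%:R) * Num.sqrt (lam j) <= 2 * c * Num.sqrt A.
Proof using All.
move=> c0; have sA := sqrtr_ge0 A.
apply: (@le_trans _ _ (\sum_(1 <= j < J.+1) (c * Num.sqrt A) * (j%:R ^+ 2)^-1)).
  apply: ler_sum_nat => j /andP[j1 _]; rewrite -!mulrA; apply: ler_wpM2l => //.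
  have j0 : 0 < j%:R :> R by rewrite ltr0n.
  rewrite ler_pdivlMr ?exprn_gt0//; apply: le_trans (sqrt_lam j j1).
  by rewrite le_eqVlt; apply/orP; left; apply/eqP; ring.
rewrite -mulr_sumr (_ : 2 * c * _ = c * Num.sqrt A * 2); last by ring.
by apply: ler_wpM2l; [exact: mulr_ge0|exact: sum_inv_sq].
Qed.

Lemma depth_sum_dist n M (s : nat -> R) (c : R) : (1 <= n)%N -> n%:R * lam 1 <= M%:R ->
  0 <= c -> (forall j, (1 <= j)%N -> `|s j| <= c * j%:R) ->
  `|\sum_(1 <= i < M.+1 | ~~ (q %| i)%N) \sum_(1 <= j < (depth i n).+1) s j -
    (1 - q%:R^-1) * n%:R * \sum_(1 <= j < (cutoff n).+1) s j * lam j| <=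
  2 * c * Num.sqrt A * Num.sqrt n%:R.
Proof using All.
move=> n1 hM c0 hs; rewrite exchange_depth// mulr_sumr -sumrB.
have lam1 j : (1 <= j)%N -> lam j <= lam 1.
  elim: j => // j IH _; case: (posnP j) => [->//|j0].
  by apply: le_trans (IH j0); exact: lam_le.
apply: le_trans (ler_norm_sum _ _ _) _.
apply: le_trans (_ : _ <= \sum_(1 <= j < (cutoff n).+1) (c * j%:R) * Num.sqrt (lam j) * Num.sqrt n%:R) _.
  apply: ler_sum_nat => j /andP[j1 _].
  have hMj : n%:R * lam j <= M%:R by apply: le_trans hM; apply: ler_wpM2l => //; exact: lam1.
  have -> : s j * mult n M j - (1 - q%:R^-1) * n%:R * (s j * lam j) =
    s j * (mult n M j - (1 - q%:R^-1) * (n%:R * lam j)) by ring.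
  rewrite normrM -mulrA -sqrtrM ?(ltW (lam_gt0 j j1))// [lam j * _]mulrC.
  by apply: ler_pM => //; [exact: hs|exact: mult_dist].
rewrite -mulr_suml; apply: ler_wpM2r; first exact: sqrtr_ge0.
exact: sum_lam.
Qed.

(** With [J^2] as the sum of the first J odd numbers, the sum becomes that of
    [(2 j - 1) mult n M j], where [mult] is at most [n lam j]. So the second-order term of the
    moments is linear in n. *)
Lemma depth_sq_sum_le n M : (1 <= n)%N -> n%:R * lam 1 <= M%:R ->
  \sum_(1 <= i < M.+1 | ~~ (q %| i)%N) (depth i n)%:R ^+ 2 <= 4 * A * n%:R.
Proof using All.
move=> n1 hM.
have lam1 j : (1 <= j)%N -> lam j <= lam 1.
  elim: j => // j IH _; case: (posnP j) => [->//|j0].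
  by apply: le_trans (IH j0); exact: lam_le.
have sq J : J%:R ^+ 2 = \sum_(1 <= j < J.+1) (2 * j%:R - 1) :> R.
  elim: J => [|J IH]; first by rewrite big_geq// expr0n.
  by rewrite big_nat_recr//= -IH -natr1; ring.
under eq_bigr do rewrite sq.
rewrite exchange_depth//.
apply: le_trans (_ : _ <= \sum_(1 <= j < (cutoff n).+1) (2 * A * n%:R) * (j%:R ^+ 2)^-1) _.
  apply: ler_sum_nat => j /andP[j1 _].
  have hMj : n%:R * lam j <= M%:R by apply: le_trans hM; apply: ler_wpM2l => //; exact: lam1.
  have /andP[m0 m1] := mult_le n M j j1 hMj.
  have j0 : 1 <= j%:R :> R by rewrite ler1n.
  have j00 : 0 < j%:R :> R by rewrite ltr0n.
  rewrite ler_pdivlMr ?exprn_gt0//.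
  have l0 := lam_gt0 j j1.
  apply: le_trans (_ : _ <= (2 * j%:R) * (n%:R * lam j) * j%:R ^+ 2) _.
    apply: ler_wpM2r; first exact: sqr_ge0.
    by apply: ler_pM => //; lra.
  have -> : 2 * j%:R * (n%:R * lam j) * j%:R ^+ 2 = 2 * (lam j * j%:R ^+ 3) * n%:R by ring.
  apply: ler_wpM2r => //; rewrite ler_pM2l//.
  apply: le_trans (lam_dec j j1); apply: ler_wpM2l; first exact: ltW.
  by rewrite ler_weXn2l.
rewrite -mulr_sumr (_ : 4 * A * _ = 2 * A * n%:R * 2); last by ring.
apply: ler_wpM2l; last exact: sum_inv_sq.
by rewrite !mulr_ge0// ltW// A_gt0.
Qed.

End Counting.

(** * Factorization along the chains i, qi, q^2 i *)

Section Chains.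
Variables (R : realType) (q : nat).
Hypothesis q2 : (2 <= q)%N.

Definition chain_len (i n : nat) : nat :=
  if (i <= n)%N then (trunc_log q (n %/ i)).+1 else 0%N.

Lemma chain_lenP i n l : (1 <= i)%N -> (l < chain_len i n)%N = (i * q ^ l <= n)%N.
Proof using q2.
move=> i1; rewrite /chain_len; case: ifP => i_n; last first.
  symmetry; apply/negbTE; rewrite -ltnNge; apply: leq_trans (_ : (i <= _)%N).
    by rewrite ltnNge i_n.
  by rewrite leq_pmulr// expn_gt0; lia.
have d0 : (0 < n %/ i)%N by rewrite divn_gt0.
have /andP[h1 h2] := trunc_log_bounds q2 d0.
rewrite mulnC -leq_divRL// ltnS; apply/idP/idP => h.
  by apply: leq_trans h1; rewrite leq_exp2l.
by rewrite -ltnS -(ltn_exp2l _ _ q2); exact: leq_ltn_trans h2.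
Qed.

Lemma chain_index n : (1 <= n)%N -> exists i r, [/\ (1 <= i)%N, ~~ (q %| i)%N & n = (i * q ^ r)%N].
Proof using q2.
elim/ltn_ind: n => n IH n1; case: (boolP (q %| n)%N) => [/dvdnP[k ek]|qn]; last first.
  by exists n, 0%N; rewrite muln1.
have k1 : (1 <= k)%N by case: k ek => //; lia.
have [i [r [i1 qi er]]] := IH k ltac:(nia) k1.
by exists i, r.+1; split => //; rewrite ek er expnSr mulnA.
Qed.

Lemma chain_index_unique i i' l r : ~~ (q %| i)%N -> ~~ (q %| i')%N ->
  (i * q ^ l = i' * q ^ r)%N -> i = i' /\ l = r.
Proof using q2.
wlog lr : i i' l r / (l <= r)%N.
  move=> H qi qi' e; case: (leqP l r) => [|/ltnW] lr; first exact: H.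
  by have [] := H i' i r l lr qi' qi (esym e).
move=> qi qi' e.
have q0 : (0 < q ^ l)%N by rewrite expn_gt0; lia.
move: e; rewrite -(subnK lr) expnD mulnA => /eqP; rewrite eqn_pmul2r// => /eqP e.
case: (posnP (r - l)%N) => [z|z]; first by split; [rewrite e z expn0 muln1|lia].
by move: qi; rewrite e dvdn_mull// dvdn_exp.
Qed.

(** Every positive integer is [i0 q^r] with q not dividing i0 in exactly one way, so a new position
    lengthens a single chain. *)
Lemma chain_lenS i i0 r n : (1 <= i)%N -> ~~ (q %| i)%N -> ~~ (q %| i0)%N ->
  n.+1 = (i0 * q ^ r)%N ->
  chain_len i n.+1 = (chain_len i n + (i == i0))%N /\ (i = i0 -> chain_len i n = r).
Proof using q2.
move=> i1 qi qi0 en.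
have key l : (l < chain_len i n.+1)%N = (l < chain_len i n)%N || ((i == i0) && (l == r)).
  rewrite !chain_lenP// leq_eqVlt ltnS orbC; congr (_ || _).
  apply/eqP/andP => [e|[/eqP -> /eqP -> //]].
  by have [-> ->] := chain_index_unique i i0 l r qi qi0 (etrans e en); rewrite !eqxx.
have le : (chain_len i n <= chain_len i n.+1)%N.
  case: (posnP (chain_len i n)) => [->//|c0].
  have := key (chain_len i n).-1; rewrite prednK// leqnn /=; lia.
case: (eqVneq i i0) => [ei|ne]; last first.
  rewrite addn0; split=> // ; last by move/eqP: ne.
  have := key (chain_len i n); rewrite (negbTE ne) /= orbF ltnn; lia.
subst i0; have er : chain_len i n = r.
  apply/eqP; rewrite eqn_leq; apply/andP; split.
    rewrite leqNgt; apply/negP; rewrite chain_lenP//; lia.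
  case: r en {key} => // r en; rewrite chain_lenP//.
  have : (i * q ^ r < i * q ^ r.+1)%N by rewrite ltn_pmul2l// ltn_exp2l.
  by rewrite -en ltnS.
split=> //; rewrite addn1.
have h1 := key (chain_len i n); have h2 := key (chain_len i n).+1.
rewrite er !eqxx /= in h1 h2 *; rewrite er in le; lia.
Qed.

Definition chain (i : nat) (v : seq nat) : seq nat :=
  [seq nth 0%N v (i * q ^ l).-1 | l <- iota 0 (chain_len i (size v))].

Lemma size_chain i v : size (chain i v) = chain_len i (size v).
Proof using. by rewrite size_map size_iota. Qed.

Lemma chain_rcons i i0 r v a : (1 <= i)%N -> ~~ (q %| i)%N -> ~~ (q %| i0)%N ->
  (size v).+1 = (i0 * q ^ r)%N ->
  chain i (rcons v a) = if i == i0 then rcons (chain i v) a else chain i v.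
Proof using q2.
move=> i1 qi qi0 en; have [e er] := chain_lenS i i0 r (size v) i1 qi qi0 en.
have same : [seq nth 0%N (rcons v a) (i * q ^ l).-1 | l <- iota 0 (chain_len i (size v))] = chain i v.
  apply/eq_in_map => l; rewrite mem_iota add0n /= chain_lenP// => h.
  have := expn_gt0 q l; rewrite nth_rcons ifT//; nia.
rewrite /chain size_rcons e; case: eqP => ei; last by rewrite addn0 same.
rewrite addn1 -[(chain_len i (size v)).+1]addn1 iotaD map_cat same cats1 /= add0n.
congr rcons; rewrite er// ei -en nth_rcons ltnn eqxx//.
Qed.

(* Independence of the chains, as a factorization of sums over words *)
Lemma sum_prod_chains b K n (g : nat -> seq nat -> R) : (n <= K)%N ->
  \sum_(v <- words b n) \prod_(1 <= i < K.+1 | ~~ (q %| i)%N) g i (chain i v) =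
  \prod_(1 <= i < K.+1 | ~~ (q %| i)%N) \sum_(u <- words b (chain_len i n)) g i u.
Proof using q2.
elim: n g => [|n IH] g nK.
  rewrite /= big_seq1 big_nat_cond [RHS]big_nat_cond; apply: eq_bigr => i /andP[/andP[i1 _] _].
  by rewrite /chain /chain_len /= leqn0 (gtn_eqF i1) /= big_seq1.
have [i0 [r [i01 qi0 en]]] := chain_index n.+1 isT.
have i0K : (i0 <= K)%N.
  apply: leq_trans nK; rewrite en leq_pmulr// expn_gt0; lia.
rewrite big_words_S.
(* Only the chain of i0 grows, and the sum over the new letter is absorbed in its factor. The bound
   K stays fixed during the induction, chains with i > n being empty words. *)
pose g' i u := if i == i0 then \sum_(0 <= a < b) g i (rcons u a) else g i u.
transitivity (\sum_(v <- words b n) \prod_(1 <= i < K.+1 | ~~ (q %| i)%N) g' i (chain i v)).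
  rewrite big_seq [RHS]big_seq; apply: eq_bigr => v /size_words sv.
  rewrite -[RHS]big_filter; set s := [seq i <- _ | _].
  have su : uniq s by rewrite filter_uniq// iota_uniq.
  have i0s : i0 \in s by rewrite mem_filter qi0 mem_index_iota; lia.
  rewrite [RHS](bigD1_seq i0)//= {1}/g' eqxx mulr_suml; apply: eq_bigr => a _.
  rewrite -big_filter -/s [LHS](bigD1_seq i0)//= (chain_rcons i0 i0 r)// ?sv// eqxx.
  congr (_ * _); rewrite big_seq_cond [RHS]big_seq_cond; apply: eq_bigr => i.
  rewrite mem_filter mem_index_iota => /andP[/and3P[qi i1 _] ne].
  by rewrite (chain_rcons i i0 r)// ?sv// /g' (negbTE ne).
rewrite IH; last exact: ltnW.
rewrite big_nat_cond [RHS]big_nat_cond; apply: eq_bigr => i /andP[/andP[i1 _] qi].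
have [e _] := chain_lenS i i0 r n i1 qi qi0 en.
rewrite e /g'; case: eqP => _; last by rewrite addn0.
by rewrite addn1 big_words_S.
Qed.

End Chains.

(** * Whole positions as letters of one finite alphabet *)

Section Letters.
Variables (R : realType) (d : nat) (m : nat -> nat).
Local Notation Sg := (Sigma d m).

(** A position carries d entries at once; numbering these tuples makes [words] and [kolmogorov]
    applicable to positions. *)
Definition letter_type : finType := {dffun forall k : 'I_d, 'I_(m k.+1).-1.+1}.
Definition nletters : nat := #|letter_type|.

Definition enc (a : forall k : 'I_d, 'I_(m k.+1).-1.+1) : nat :=
  enum_rank ([ffun k => a k] : letter_type).

Definition dec (c : nat) : forall k : 'I_d, 'I_(m k.+1).-1.+1 :=
  if (insub c : option 'I_nletters) is Some j then (enum_val j : letter_type) else fun=> ord0.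

Lemma enc_lt a : (enc a < nletters)%N. Proof. exact: ltn_ord. Qed.

Lemma encK a : dec (enc a) = a.
Proof.
rewrite /dec /enc; case: insubP => [j _ ej|]; last by rewrite ltn_ord.
have -> : j = enum_rank ([ffun k => a k] : letter_type) by apply: val_inj.
by rewrite enum_rankK; apply: functional_extensionality_dep => k; rewrite ffunE.
Qed.

Lemma decK c : (c < nletters)%N -> enc (dec c) = c.
Proof.
move=> cl; rewrite /dec insubT /enc.
have -> : ([ffun k => (enum_val (Sub c cl : 'I_nletters) : letter_type) k] : letter_type) =
   enum_val (Sub c cl : 'I_nletters) by apply/ffunP => k; rewrite ffunE.
by rewrite enum_valK.
Qed.

Definition pword (n : nat) (x : Sg) : seq nat := [seq enc (x i) | i <- iota 0 n].
Definition dword (v : seq nat) : Sg := fun i => dec (nth 0%N v i).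

Lemma size_pword n x : size (pword n x) = n.
Proof. by rewrite size_map size_iota. Qed.

Lemma nth_pword n x i : (i < n)%N -> nth 0%N (pword n x) i = enc (x i).
Proof. by move=> i_n; rewrite (nth_map 0%N) ?size_iota// nth_iota. Qed.

Lemma pword_S n x : pword n.+1 x = rcons (pword n x) (enc (x n)).
Proof. by rewrite /pword -[n.+1]addn1 iotaD map_cat cats1. Qed.

Lemma pword_words n x : pword n x \in words nletters n.
Proof.
rewrite mem_words size_pword eqxx; apply/allP => c /mapP[i _ ->]; exact: enc_lt.
Qed.

Lemma pwordP n x u : pword n u = pword n x <-> agree d m n x u.
Proof.
split=> [e i i_n|h]; last by apply/eq_in_map => i; rewrite mem_iota => /andP[_ hi]; rewrite h.
by rewrite -(encK (u i)) -(encK (x i)) -!(nth_pword n)// e.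
Qed.

Lemma dwordK v n : v \in words nletters n -> pword n (dword v) = v.
Proof.
rewrite mem_words => /andP[/eqP sv /allP hv].
apply: (@eq_from_nth _ 0%N); rewrite size_pword// => i i_n.
by rewrite nth_pword// decK//; apply: hv; rewrite mem_nth// sv.
Qed.

Lemma dword_pword n x : agree d m n x (dword (pword n x)).
Proof. by move=> i i_n; rewrite /dword nth_pword// encK. Qed.

Definition pcyl (v : seq nat) : set (SigmaB d m) := [set u | pword (size v) u = v].

Lemma measurable_pcyl v : measurable (pcyl v).
Proof.
apply: (@measurable_fin_det d m _ (size v)) => x u xu /= xv.
by apply: etrans xv; apply/pwordP.
Qed.

Section Additivity.
Variable P : probability (SigmaB d m) R.

Definition part_prob (A : set (SigmaB d m)) (v : seq nat) : R := fine (P (A `&` pcyl v)).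

Lemma part_prob_sum A v : measurable A ->
  part_prob A v = \sum_(0 <= c < nletters) part_prob A (rcons v c).
Proof.
move=> mA; apply: EFin_inj; rewrite -sumEFin big_mkord.
have fin (B : set (SigmaB d m)) : measurable B -> (fine (P B))%:E = P B.
  by move=> mB; rewrite fineK// fin_num_measure.
have mAv u : measurable (A `&` pcyl u) by apply: measurableI => //; exact: measurable_pcyl.
rewrite /part_prob fin//.
have -> : A `&` pcyl v =
    \big[setU/set0]_(c < nletters) (A `&` pcyl (rcons v c)).
  rewrite -(bigcup_mkord nletters (fun c => A `&` pcyl (rcons v c))).
  apply/seteqP; split=> x.
    move=> [Ax xv]; exists (enc (x (size v))); first exact: enc_lt.
    by split=> //; rewrite /pcyl /= size_rcons pword_S xv.
  by move=> [c /= cm] [Ax]; rewrite /pcyl /= size_rcons pword_S => /rcons_inj[].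
rewrite measure_bigsetU_ord.
- by apply: eq_bigr => c _; rewrite fin.
- by move=> c; exact: mAv.
- move=> c c' _ _ [x [[_ + ] [_]]]; rewrite /pcyl /= !size_rcons => -> /rcons_inj[e].
  exact: val_inj.
Qed.

(** The event is a union of cylinders of length n, and [dword v] is a point of the cylinder of v on
    which membership is tested. Such finite sums replace integrals throughout. *)
Lemma fin_det_prob (A : set (SigmaB d m)) n : measurable A ->
  (forall x u, agree d m n x u -> A x -> A u) ->
  fine (P A) = \sum_(v <- words nletters n) fine (P (pcyl v)) * (`[< A (dword v) >])%:R.
Proof.
move=> mA hA.
have := sum_words_const _ _ (part_prob A) (fun v => part_prob_sum A v mA) n.
have -> : part_prob A [::] = fine (P A).
  by rewrite /part_prob (_ : pcyl [::] = setT) ?setIT//; apply/seteqP; split.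
move=> <-; rewrite big_seq [RHS]big_seq; apply: eq_bigr => v vn.
have sv := size_words _ _ _ vn.
have hv x : pcyl v x -> (A x <-> A (dword v)).
  rewrite /pcyl /= sv => xv; have e : agree d m n x (dword v).
    by apply/pwordP; rewrite xv dwordK.
  split; first exact: hA.
  by apply: hA; apply/pwordP; rewrite xv dwordK.
rewrite /part_prob; case: asboolP => Av /=.
  rewrite mulr1; congr (fine (P _)); apply/seteqP; split=> [x []//|x xv].
  by split => //; apply/hv.
rewrite mulr0 (_ : _ `&` _ = set0) ?measure0//; apply/seteqP; split=> // x [Ax xv].
by apply: Av; apply/(hv x).
Qed.

End Additivity.
End Letters.

(** * The product measure along the chains *)

Section ChainMeasure.
Variables (R : realType) (d q : nat) (m : nat -> nat).
Hypothesis hq : (2 <= q)%N.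
#[local] Set Default Proof Using "hq".
Variable mu : probability (SigmaB d m) R.
Local Notation Sg := (Sigma d m).
Local Notation nl := (nletters d m).
Local Notation chain := (chain q).
Local Notation chain_len := (chain_len q).

Definition pos_prob (v : seq nat) : R := fine (mu (pcyl d m v)).
Local Notation mw := pos_prob.

Lemma pos_prob_ge0 v : 0 <= mw v.
Proof. by rewrite fine_ge0// measure_ge0. Qed.

Lemma pos_prob_nil : mw [::] = 1.
Proof.
by rewrite /pos_prob (_ : pcyl d m [::] = setT) ?probability_setT//; apply/seteqP; split.
Qed.

Lemma pos_prob_sum v : mw v = \sum_(0 <= c < nl) mw (rcons v c).
Proof.
have e u : part_prob R d m mu setT u = mw u by rewrite /part_prob setTI.
by rewrite -e part_prob_sum//; apply: eq_bigr => c _; rewrite e.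
Qed.

Lemma pos_prob_out v c : (c \in v) -> (nl <= c)%N -> mw v = 0.
Proof.
move=> cv cl; rewrite /pos_prob (_ : pcyl d m v = set0) ?measure0//.
apply/seteqP; split=> // x xv; move: cv; rewrite -[v]xv => /mapP[i _ ec].
by have := enc_lt d m (x i); rewrite -ec; lia.
Qed.

Definition subseq_pt (i : nat) (x : Sg) : Sg := fun l => x (i * q ^ l).-1.

Lemma pword_subseq i n x : (1 <= i)%N ->
  pword d m (chain_len i n) (subseq_pt i x) = chain i (pword d m n x).
Proof.
move=> i1; rewrite /pword /chain size_map size_iota; apply/eq_in_map => l.
rewrite mem_iota add0n /= chain_lenP// => h.
have := expn_gt0 q l; rewrite (nth_map 0%N) ?size_iota ?nth_iota ?add0n//; nia.
Qed.

Definition chains_weight (n : nat) (v : seq nat) : R :=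
  \prod_(1 <= i < n.+1 | ~~ (q %| i)%N) mw (chain i v).

Lemma is_P_mu_pcyl P n v : is_P_mu R d q m mu P -> v \in words nl n ->
  fine (P (pcyl d m v)) = chains_weight n v.
Proof.
move=> hP vn; have sv := size_words _ _ _ vn.
have := hP n (dword d m v).
have -> : [set u : Sg | forall i, (1 <= i <= n)%N -> u i.-1 = dword d m v i.-1] = pcyl d m v.
  apply/seteqP; split=> u; rewrite /pcyl /= sv => h.
    rewrite -[RHS](dwordK d m v n vn); apply/pwordP => i i_n.
    by have := h i.+1; apply.
  move=> i i1; have : agree d m n (dword d m v) u by apply/pwordP; rewrite h dwordK.
  by apply; lia.
move=> ->; rewrite /= /chains_weight big_nat_cond [RHS]big_nat_cond.
apply: eq_bigr => i /andP[/andP[i1 _] qi]; congr (fine (mu _)).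
apply/seteqP; split=> y; rewrite /pcyl /= size_chain sv => h.
  apply: etrans (_ : pword d m (chain_len i n) (subseq_pt i (dword d m v)) = _).
    by apply/pwordP => l; rewrite chain_lenP// => hl; exact: h.
  by rewrite pword_subseq// dwordK.
have : agree d m (chain_len i n) (subseq_pt i (dword d m v)) y.
  by apply/pwordP; rewrite h pword_subseq// dwordK.
by move=> hy l hl; apply: hy; rewrite chain_lenP.
Qed.

Lemma chains_weight_nil : chains_weight 0 [::] = 1.
Proof. by rewrite /chains_weight big_geq. Qed.

(** The letter at position n + 1 affects only the factor of its own chain, where the sum over it is
    the additivity of [mu]. The factor i = n + 1 may be inserted beforehand, its chain being empty
    so far. *)
Lemma chains_weight_sum n v : size v = n ->
  chains_weight n v = \sum_(0 <= c < nl) chains_weight n.+1 (rcons v c).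
Proof.
move=> sv; have [i0 [r [i01 qi0 en]]] := chain_index q hq n.+1 isT.
have i0n : (i0 <= n.+1)%N by rewrite en leq_pmulr// expn_gt0; lia.
have e1 : chains_weight n v = \prod_(1 <= i < n.+2 | ~~ (q %| i)%N) mw (chain i v).
  rewrite /chains_weight [RHS]big_mkcond big_nat_recr//= -big_mkcond /=.
  rewrite (_ : (if _ then _ else _) = 1) ?mulr1//.
  by rewrite /chain /chain_len sv ltnn /= pos_prob_nil; case: ifP.
rewrite e1 -[LHS]big_filter; set s := [seq i <- _ | _].
have su : uniq s by rewrite filter_uniq// iota_uniq.
have i0s : i0 \in s by rewrite mem_filter qi0 mem_index_iota; lia.
rewrite [LHS](bigD1_seq i0)//= pos_prob_sum mulr_suml; apply: eq_bigr => c _.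
rewrite /chains_weight -[RHS]big_filter -/s [RHS](bigD1_seq i0)//=.
rewrite (chain_rcons q hq i0 i0 r)// ?sv// eqxx; congr (_ * _).
rewrite big_seq_cond [RHS]big_seq_cond; apply: eq_bigr => i.
rewrite mem_filter mem_index_iota => /andP[/and3P[qi i1 _] ne].
by rewrite (chain_rcons q hq i i0 r)// ?sv// (negbTE ne).
Qed.

Lemma P_mu_exists : exists P : probability (SigmaB d m) R, is_P_mu R d q m mu P.
Proof.
pose W v := chains_weight (size v) v.
have W0 v : 0 <= W v by apply: prodr_ge0 => i _; exact: pos_prob_ge0.
have Wsum v : W v = \sum_(0 <= c < nl) W (rcons v c).
  rewrite {1}/W (chains_weight_sum (size v))//.
  by apply: eq_bigr => c _; rewrite /W size_rcons.
pose Phi (g : nat -> nat) : Sg := fun i => dec d m (g i).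
have [P hP] := kolmogorov R nl W chains_weight_nil W0 Wsum d m Phi
  (fun n => ex_intro _ n (fun g g' e i i_n => congr1 (dec d m) (esym (e i i_n)))).
exists P => n x.
have -> : [set u : Sg | forall i, (1 <= i <= n)%N -> u i.-1 = x i.-1] =
    pcyl d m (pword d m n x).
  apply/seteqP; split=> u; rewrite /pcyl /= size_pword => h.
    by apply/pwordP => i i_n; have := h i.+1; apply.
  by move=> i i1; move/pwordP: h; apply; lia.
rewrite (hP _ (pword d m n x)).
- congr (_%:E); rewrite /W size_pword /chains_weight big_nat_cond [RHS]big_nat_cond.
  apply: eq_bigr => i /andP[/andP[i1 _] qi]; congr (fine (mu _)).
  rewrite -pword_subseq//; apply/seteqP; split=> y; rewrite /pcyl /= size_pword => h.
    by move/pwordP: h => h l hl; apply: h; rewrite chain_lenP.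
  by apply/pwordP => l; rewrite chain_lenP//; exact: h.
- by have := pword_words d m n x; rewrite mem_words => /andP[].
move=> g hg; rewrite /pcyl /= size_pword.
suff -> : pword d m n (Phi g) = mkseq g n by [].
apply/eq_in_map => i; rewrite mem_iota => /andP[_ i_n].
(* A number outside the alphabet has weight 0 under [mu], hence cannot occur in a stream of positive
   weight. *)
rewrite /Phi decK//; rewrite ltnNge; apply/negP => gi.
have := hg i.+1; rewrite /W size_mkseq /chains_weight.
have [i0 [r [i01 qi0 en]]] := chain_index q hq i.+1 isT.
have i0n : (i0 <= i.+1)%N by rewrite en leq_pmulr// expn_gt0; lia.
rewrite -big_filter; set s := [seq i <- _ | _].
have su : uniq s by rewrite filter_uniq// iota_uniq.
have i0s : i0 \in s by rewrite mem_filter qi0 mem_index_iota; lia.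
rewrite (bigD1_seq i0)//= (pos_prob_out _ (g i))// ?mul0r ?ltxx//.
apply/mapP; exists r; first by rewrite mem_iota add0n size_mkseq chain_lenP//= en.
by rewrite -en /= nth_mkseq.
Qed.

Section Moments.
Hypotheses (hd : (2 <= d)%N)
  (hm : forall k, (1 <= k < d)%N -> (m k.+1 <= m k)%N) (hmd : (2 <= m d)%N).
#[local] Set Default Proof Using "hd hq hm hmd".
Local Notation "$ l" := (l R d q m hd hq hm hmd) (at level 0).
Local Notation word := (word R d q m).
Variable P : probability (SigmaB d m) R.
Hypothesis hP : is_P_mu R d q m mu P.
Variables (n : nat) (J : nat -> nat).
Hypothesis J_det : forall i, (1 <= i)%N -> forall x u,
  agree d m (chain_len i n) x u -> word (J i) u = word (J i) x.

Local Notation chi_prob := (word_prob R d q m mu).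

Lemma word_words k x : word k x \in words (m 1) k.
Proof.
rewrite mem_words ($size_word) eqxx; apply/(all_nthP 0%N) => i; rewrite ($size_word) => ik.
by rewrite ($nth_word)//; exact: $chi_lt1.
Qed.

Lemma sum_word_prob k n' (F : seq nat -> R) :
  (forall x u, agree d m n' x u -> word k u = word k x) ->
  \sum_(u <- words nl n') mw u * F (word k (dword d m u)) =
  \sum_(w <- words (m 1) k) chi_prob w * F w.
Proof.
move=> det.
have e w : w \in words (m 1) k -> chi_prob w * F w =
    \sum_(u <- words nl n') mw u * (word k (dword d m u) == w)%:R * F w.
  move=> wk; have sw := size_words _ _ _ wk.
  rewrite /word_prob (fin_det_prob R d m mu _ n')//; last 2 first.
  - exact: $measurable_chi_cyl.
  - by move=> x u xu; rewrite /chi_cyl /= sw (det _ _ xu).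
  rewrite mulr_suml; apply: eq_bigr => u _; congr (_ * _%:R * _); congr nat_of_bool.
  by apply/asboolP/eqP; rewrite /chi_cyl /= sw.
rewrite [RHS]big_seq (eq_bigr _ e) -big_seq exchange_big /=; apply: eq_bigr => u _.
rewrite (bigD1_seq (word k (dword d m u))) ?words_uniq ?word_words//= eqxx mulr1.
by rewrite big1 ?addr0// => w; rewrite eq_sym => /negbTE ->; rewrite mulr0 mul0r.
Qed.

(** Independence of the chains under P: the mean of a product of functions of one chain each is the
    product of their means under [mu]. [J_det] guarantees that the word read along a chain depends
    only on positions up to n. *)
Lemma moment_product (F : nat -> seq nat -> R) :
  \sum_(v <- words nl n) fine (P (pcyl d m v)) *
    \prod_(1 <= i < n.+1 | ~~ (q %| i)%N) F i (word (J i) (subseq_pt i (dword d m v))) =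
  \prod_(1 <= i < n.+1 | ~~ (q %| i)%N) \sum_(w <- words (m 1) (J i)) chi_prob w * F i w.
Proof using All.
pose g i u := mw u * F i (word (J i) (dword d m u)).
transitivity (\sum_(v <- words nl n) \prod_(1 <= i < n.+1 | ~~ (q %| i)%N) g i (chain i v)).
  rewrite big_seq [RHS]big_seq; apply: eq_bigr => v vn.
  rewrite (is_P_mu_pcyl P n)// /chains_weight -big_split /=.
  rewrite big_nat_cond [RHS]big_nat_cond; apply: eq_bigr => i /andP[/andP[i1 _] _].
  rewrite /g; congr (_ * F i _); apply: J_det => // l.
  rewrite chain_lenP// => hl; rewrite /subseq_pt /dword; congr dec.
  rewrite (nth_map 0%N) ?size_iota ?nth_iota ?add0n// (size_words _ _ _ vn) chain_lenP//.
rewrite sum_prod_chains// big_nat_cond [RHS]big_nat_cond.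
apply: eq_bigr => i /andP[/andP[i1 _] _].
by apply: sum_word_prob; exact: J_det.
Qed.

Definition chains_ball (x : Sg) : set (SigmaB d m) := [set u | forall i, (1 <= i <= n)%N ->
  ~~ (q %| i)%N -> word (J i) (subseq_pt i u) = word (J i) (subseq_pt i x)].

Lemma chains_ball_det x z u : agree d m n z u -> chains_ball x z -> chains_ball x u.
Proof using All.
move=> zu hz i hi qi; rewrite -hz//; apply: J_det; first by lia.
move=> l; rewrite (chain_lenP q hq); last by lia.
by move=> hl; apply: zu; have := expn_gt0 q l; nia.
Qed.

Lemma measurable_chains_ball x : measurable (chains_ball x).
Proof using All.
by apply: (@measurable_fin_det d m _ n) => z u zu; exact: chains_ball_det.
Qed.

Lemma chains_ball_prob x : fine (P (chains_ball x)) =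
  \prod_(1 <= i < n.+1 | ~~ (q %| i)%N) chi_prob (word (J i) (subseq_pt i x)).
Proof using All.
rewrite (fin_det_prob R d m P _ n); last 2 first.
- exact: measurable_chains_ball.
- exact: chains_ball_det.
pose F i (w : seq nat) : R := (w == word (J i) (subseq_pt i x))%:R.
transitivity (\sum_(v <- words nl n) fine (P (pcyl d m v)) *
    \prod_(1 <= i < n.+1 | ~~ (q %| i)%N) F i (word (J i) (subseq_pt i (dword d m v)))).
  apply: eq_bigr => v _; congr (_ * _); case: asboolP => h.
    rewrite big_nat_cond big1// => i /andP[/andP[i1 i_n] qi].
    by rewrite /F h ?eqxx//; lia.
  have [i [hi qi ne]] : exists i, [/\ (1 <= i <= n)%N, ~~ (q %| i)%N &
      word (J i) (subseq_pt i (dword d m v)) <> word (J i) (subseq_pt i x)].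
    apply: contrapT => hn; apply: h => i hi qi; apply: contrapT => ne.
    by apply: hn; exists i.
  rewrite -big_filter; set s := [seq i <- _ | _].
  have su : uniq s by rewrite filter_uniq// iota_uniq.
  have i0s : i \in s by rewrite mem_filter qi mem_index_iota; lia.
  rewrite (bigD1_seq i)//= /F (_ : (_ == _) = false) ?mul0r//.
  exact/eqP.
rewrite moment_product; apply: eq_bigr => i _.
rewrite (bigD1_seq (word (J i) (subseq_pt i x))) ?words_uniq ?word_words//= /F eqxx mulr1.
by rewrite big1 ?addr0// => w /negbTE ->; rewrite mulr0.
Qed.

(** Markov's inequality for a product over chains. The lower bound is asked only at points all of
    whose chain words have positive probability, as the other cylinders are null; this avoids the
    value of [ln] at 0. *)
Lemma markov_fin_det (A : set (SigmaB d m)) (F : nat -> seq nat -> R) (c : R) :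
  (forall x u, agree d m n x u -> A x -> A u) -> 0 < c ->
  (forall i w, 0 <= F i w) ->
  (forall x, A x -> (forall i, (1 <= i <= n)%N -> ~~ (q %| i)%N ->
       chi_prob (word (J i) (subseq_pt i x)) != 0) ->
    c <= \prod_(1 <= i < n.+1 | ~~ (q %| i)%N) F i (word (J i) (subseq_pt i x))) ->
  fine (P A) <= c^-1 *
    \prod_(1 <= i < n.+1 | ~~ (q %| i)%N) \sum_(w <- words (m 1) (J i)) chi_prob w * F i w.
Proof using All.
move=> hA c0 F0 hc; have mA : measurable A by exact: measurable_fin_det hA.
rewrite -moment_product (fin_det_prob R d m P _ n)// mulr_sumr.
rewrite big_seq [leRHS]big_seq; apply: ler_sum => v vn.
have Pv0 : 0 <= fine (P (pcyl d m v)) by rewrite fine_ge0// measure_ge0.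
have prod0 : 0 <= \prod_(1 <= i < n.+1 | ~~ (q %| i)%N) F i (word (J i) (subseq_pt i (dword d m v))).
  by apply: prodr_ge0 => i _.
have ci : 0 <= c^-1 by rewrite invr_ge0 ltW.
case: asboolP => Av /=; last by rewrite mulr0 !mulr_ge0.
rewrite mulr1; move: Pv0; rewrite le_eqVlt => /orP[/eqP <-|Pv0]; first by rewrite mul0r mulr0.
rewrite mulrCA ler_peMr ?(ltW Pv0)// mulrC ler_pdivlMr// mul1r; apply: hc => // i hi qi.
apply/negP => /eqP z; move: Pv0; rewrite (is_P_mu_pcyl P n)// /chains_weight.
rewrite -big_filter; set s := [seq i <- _ | _].
have su : uniq s by rewrite filter_uniq// iota_uniq.
have i0s : i \in s by rewrite mem_filter qi mem_index_iota; lia.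
rewrite (bigD1_seq i)//= (_ : mw (chain i v) = 0) ?mul0r ?ltxx//.
apply/eqP; rewrite eq_le pos_prob_ge0 andbT -z /pos_prob /word_prob.
have mC := $measurable_chi_cyl (word (J i) (subseq_pt i (dword d m v))).
rewrite fine_le ?fin_num_measure//; first exact: measurable_pcyl.
apply: le_measure; rewrite ?inE//; first exact: measurable_pcyl.
move=> y; rewrite /pcyl /= size_chain (size_words _ _ _ vn) => h.
rewrite /chi_cyl /= ($size_word); apply: J_det; first by lia.
apply/pwordP; rewrite pword_subseq; last by lia.
by rewrite dwordK.
Qed.

End Moments.
End ChainMeasure.

(** * Local dimension *)

Lemma bin_le_exp n k : ('C(n, k) <= 2 ^ n)%N.
Proof.
elim: n k => [|n IH] [|k] //; first by rewrite bin0 expn_gt0.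
by rewrite binS expnS mul2n -addnn leq_add.
Qed.

(** [(l + 1)^6] is at most the falling factorial [(l + 6) ... (l + 1) = 6! C(l + 6, 6)], and a
    binomial coefficient is at most [2^(l + 6)]. *)
Lemma pow6_le_exp : exists2 c, (0 < c)%N & forall l, (l.+1 ^ 6 <= c * 2 ^ l)%N.
Proof.
exists (6`! * 2 ^ 6)%N; first by rewrite muln_gt0 fact_gt0 expn_gt0.
move=> l; apply: (@leq_trans ((l + 6) ^_ 6)).
  rewrite !ffactnS ffactn0 /= !addnS addn0 /= muln1 !expnS expn0 muln1.
  by do 5![apply: leq_mul; first lia]; lia.
rewrite -bin_ffact mulnC (_ : 6`! * 2 ^ 6 * 2 ^ l = 6`! * 2 ^ (l + 6))%N.
  by rewrite leq_mul2l bin_le_exp orbT.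
by rewrite expnD [(2 ^ l * _)%N]mulnC mulnA.
Qed.

Section Dimension.
Variables (R : realType) (d q : nat) (m : nat -> nat).
Hypotheses (hd : (2 <= d)%N) (hq : (2 <= q)%N)
  (hm : forall k, (1 <= k < d)%N -> (m k.+1 <= m k)%N) (hmd : (2 <= m d)%N).
#[local] Set Default Proof Using "hd hq hm hmd".
Local Notation "$ l" := (l R d q m hd hq hm hmd) (at level 0).
Local Notation N := (N_ R d q m).
Local Notation w := (weight R d q m).
Local Notation lnm k := (ln (m k)%:R : R).
Local Notation Sg := (Sigma d m).
Local Notation kc := (chi_coord R d q m).
Local Notation lc := (chi_pos R d q m).

(** From N - d + 1 on the weights lose a factor q >= 2 every d indices, which outweighs any power of
    j. *)
Lemma weight_decay : exists A : R, forall j, (1 <= j)%N -> w j * j%:R ^+ 6 <= A.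
Proof.
have Nd := $N_ge.
have w1 : 0 <= w 1 by rewrite ltW// ($weight_gt0).
have q1 := $q_gt1.
have [c c0 hc] := pow6_le_exp.
exists (w 1 * N%:R ^+ 6 * c%:R) => j j1.
have wj : w j <= w 1 by apply: ($weight_mono).
have [jN|jN] := leqP j N.
  apply: (@le_trans _ _ (w 1 * N%:R ^+ 6)).
    apply: ler_pM => //; [exact/ltW/($weight_gt0)|].
    by apply: lerXn2r; rewrite ?nnegrE// ler_nat.
  by apply: ler_peMr; rewrite ?ler1n// mulr_ge0// exprn_ge0.
(* j = i + l d with N - d < i <= N, so that [w j = w i / q^l]. *)
set l := ((j - (N - d + 1)) %/ d)%N.
have dm := divn_eq (j - (N - d + 1)) d; have lt := ltn_pmod (j - (N - d + 1)) (ltnW hd).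
set i := ((j - (N - d + 1)) %% d + (N - d + 1))%N.
have ej : j = (i + l * d)%N by rewrite /i /l; lia.
have iN : (i <= N)%N by rewrite /i; lia.
have hi : (N - d < i)%N by rewrite /i; lia.
rewrite ej ($weight_period)//.
have wi : w i <= w 1 by apply: ($weight_mono) => //; lia.
have jb : (i + l * d)%:R <= N%:R * l.+1%:R :> R.
  by rewrite -natrM ler_nat mulnS leq_add// mulnC leq_mul2r Nd orbT.
apply: (@le_trans _ _ (w 1 / q%:R ^+ l * (N%:R * l.+1%:R) ^+ 6)).
  apply: ler_pM; rewrite ?exprn_ge0//.
  - by rewrite divr_ge0 ?exprn_ge0// ltW// ($weight_gt0)//; lia.
  - by rewrite ler_pM2r// invr_gt0 exprn_gt0// ($q_gt0).
  - by apply: lerXn2r; rewrite ?nnegrE// mulr_ge0.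
rewrite exprMn -mulrA -[leRHS]mulrA; apply: ler_wpM2l => //.
rewrite mulrCA; apply: ler_wpM2l; first exact: exprn_ge0.
rewrite mulrC ler_pdivrMr ?exprn_gt0 ?($q_gt0)//.
apply: (@le_trans _ _ (c * 2 ^ l)%N%:R); first by rewrite -natrX ler_nat hc.
rewrite natrM; apply: ler_wpM2l => //; rewrite natrX.
by apply: lerXn2r; rewrite ?nnegrE// ler_nat.
Qed.

(** The constant for which [lam j = ln m_1 / (q^(l-1) ln m_k)] when [chi_j] reads coordinate k at
    depth l. *)
Definition lam_factor : R := lnm 1 * q%:R / ((q%:R - 1) * lnm d).
Local Notation kap := lam_factor.
Definition lam (j : nat) : R := kap * w j.

Lemma lnm1_gt0 : 0 < lnm 1. Proof. by apply: ($lnm_gt0); lia. Qed.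
Lemma lnmd_gt0 : 0 < lnm d. Proof. by apply: ($lnm_gt0); lia. Qed.

Lemma lam_factor_gt0 : 0 < kap.
Proof.
by rewrite divr_gt0 ?mulr_gt0 ?lnm1_gt0 ?lnmd_gt0 ?($q_gt0)// subr_gt0 ($q_gt1).
Qed.

Lemma lam_gt0 j : (1 <= j)%N -> 0 < lam j.
Proof. by move=> j1; rewrite mulr_gt0 ?lam_factor_gt0// ($weight_gt0). Qed.

Lemma lam_le j : (1 <= j)%N -> lam j.+1 <= lam j.
Proof. by move=> j1; rewrite ler_pM2l ?lam_factor_gt0// ($weight_le). Qed.

Lemma lam_eq j : (1 <= j)%N -> lam j * (q%:R ^+ (lc j).-1 * lnm (kc j)) = lnm 1.
Proof.
move=> j1; rewrite /lam /chi_coord /chi_pos /weight.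
have lp := $chi_pos_ge1 j j1; rewrite /chi_pos in lp.
move: lp; case: ($pair_P j j1) => p t v _ /= lp.
set l := (p - _)%N in lp *.
have e := $pair_weight_ln p t v; rewrite -/l in e.
transitivity (kap * q%:R ^+ l.-1 * (pair_weight R d q m p t * lnm (pair_coord R d q m p t))).
  by rewrite mulrACA mulrA -!mulrA; do !congr (_ * _); rewrite mulrCA.
rewrite e; have -> : q%:R ^+ l = q%:R * q%:R ^+ l.-1 :> R by rewrite -exprS prednK.
rewrite /lam_factor.
have q0 : q%:R != 0 :> R := $q_neq0.
have ql : q%:R ^+ l.-1 != 0 :> R by rewrite expf_neq0.
have l0 : lnm d != 0 by rewrite gt_eqF// lnmd_gt0.
have q1 : q%:R - 1 != 0 :> R by rewrite gt_eqF// subr_gt0 ($q_gt1).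
move: (q%:R ^+ l.-1) ql (lnm d) l0 (lnm 1) => x x0 y y0 z.
by field; rewrite q1 q0 x0 y0.
Qed.

(* A ball of radius m_1 ^ - n sees [chi_j] along the chain of [i] iff [i <= n * lam j]. *)
Lemma lam_key i j n : (1 <= j)%N ->
  (i%:R <= n%:R * lam j) = ((i * q ^ (lc j).-1)%:R * lnm (kc j) <= n%:R * lnm 1).
Proof.
move=> j1; rewrite -(lam_eq j j1) natrM natrX mulrA -[_ * lnm (kc j)]mulrA ler_pM2r//.
rewrite mulr_gt0 ?exprn_gt0 ?($q_gt0)//; have := $chi_coord_range j j1 => h.
by apply: ($lnm_gt0); lia.
Qed.

(** Coordinate k is visible up to [n ln m_1 / ln m_k], which is at most [n ln m_1 / ln m_d]: all
    positions concerned lie below n times this integer. *)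
Definition range_factor : nat := (Num.truncn (lnm 1 / lnm d)).+1.
Definition scale_len (n : nat) : nat := (n * range_factor)%N.

Lemma scale_lenP i k n : (1 <= k <= d)%N -> i%:R * lnm k <= n%:R * lnm 1 ->
  (i <= scale_len n)%N.
Proof.
move=> /andP[k1 kd] h; rewrite -(ler_nat R) natrM.
apply: (@le_trans _ _ (n%:R * (lnm 1 / lnm d))); last first.
  by apply: ler_wpM2l => //; exact/ltW/truncnS_gt.
rewrite mulrA ler_pdivlMr ?lnmd_gt0//; apply: le_trans h.
by apply: ler_wpM2l => //; exact: $lnm_le.
Qed.

Lemma lam1_scale n : n%:R * lam 1 <= (scale_len n)%:R.
Proof.
have e := lam_eq 1 isT; have c1 := $chi_coord_range 1 isT.
rewrite natrM; apply: ler_wpM2l => //.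
apply: (@le_trans _ _ (lnm 1 / lnm d)); last exact/ltW/truncnS_gt.
rewrite ler_pdivlMr ?lnmd_gt0// -e; apply: ler_wpM2l; first exact/ltW/lam_gt0.
apply: (@le_trans _ _ (lnm (kc 1))); first by apply: ($lnm_le); lia.
rewrite ler_peMl//; first by apply/ltW/($lnm_gt0); lia.
by rewrite exprn_ege1// ltW// ($q_gt1).
Qed.

Variable A : R.
Hypothesis lam_dec : forall j, (1 <= j)%N -> lam j * j%:R ^+ 6 <= A.
Local Notation dep := (depth R lam A).
Local Notation depP := (depthP R q lam A hq lam_gt0 lam_le lam_dec).

Lemma depth_det n i : (1 <= i)%N -> forall x u : Sg,
  agree d m (chain_len q i (scale_len n)) x u ->
  word R d q m (dep i n) u = word R d q m (dep i n) x.
Proof using All.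
move=> i1 x u xu; apply/($eq_wordP) => j jd.
rewrite !($chi_posE)// /Defs.coord; case: insubP => // k _ _.
rewrite xu// (chain_lenP q hq)//.
apply: (scale_lenP _ (kc j.+1)); first exact: $chi_coord_range.
by rewrite -lam_key// -depP.
Qed.

(** The ball without the roundings of [L_]; unlike [Bn], it is exactly a product over chains. *)
Definition ideal_ball (n : nat) (x : Sg) : set (SigmaB d m) :=
  [set u | forall k i, (1 <= k <= d)%N -> (1 <= i)%N -> i%:R * lnm k <= n%:R * lnm 1 ->
     Defs.coord u i k = Defs.coord x i k].

Lemma coord_subseq i (x : Sg) l k : (1 <= l)%N ->
  Defs.coord (subseq_pt d q m i x) l k = Defs.coord x (i * q ^ l.-1) k.
Proof. by []. Qed.

(** Coordinate k at position [i0 q^r] is the [chi_j] of coordinate k and depth r + 1 along the chain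
    of i0, and by [lam_key] it is prescribed iff j is at most the depth of i0. *)
Lemma ideal_ballE n x : ideal_ball n x = chains_ball R d q m (scale_len n) (dep ^~ n) x.
Proof using All.
apply/seteqP; split=> u h.
  move=> i hi qi; have i1 : (1 <= i)%N by lia.
  apply/($eq_wordP) => j jd; rewrite !($chi_posE)// !coord_subseq ?($chi_pos_ge1)//.
  apply: h; [exact: $chi_coord_range|by rewrite muln_gt0 i1 expn_gt0; lia|].
  by rewrite -lam_key// -depP.
move=> k i kd i1 hik; have [i0 [r [i01 qi0 ei]]] := chain_index q hq i i1.
have [j [j1 jk jl]] := $chi_coord_surj r.+1 k isT kd.
have iM := scale_lenP i k n kd hik.
have i0M : (1 <= i0 <= scale_len n)%N.
  by rewrite i01 (leq_trans _ iM)// ei leq_pmulr// expn_gt0; lia.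
have /($eq_wordP) e := h i0 i0M qi0.
have jd : (j <= dep i0 n)%N by rewrite depP// lam_key// jk jl /= -ei.
have := e j.-1; rewrite prednK// => /(_ jd).
by rewrite !($chi_posE)// jl jk !coord_subseq//= -ei.
Qed.

Lemma L_compS k n : L_comp R m k.+1 n = L_ R m k.+1 (L_comp R m k n).
Proof. by rewrite /L_comp -[k.+1]addn1 iotaD foldl_cat /= add1n addn1. Qed.

(** After multiplication by [ln m_k] the division by [gamma_k] has no effect, and each ceiling adds
    at most one [ln m_k <= ln m_1]. Hence the shift by less than d between balls and ideal balls. *)
Lemma L_comp_bounds n k : (1 <= k <= d)%N ->
  n%:R * lnm 1 <= (L_comp R m k n)%:R * lnm k <= (n + k.-1)%:R * lnm 1.
Proof.
elim: k => // k IH /andP[_ kd]; case: (posnP k) => [->|k0].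
  by rewrite /L_comp /= /L_ /= addn0 lexx.
have k1d : (1 <= k <= d)%N by lia.
have /andP[h1 h2] := IH k1d.
rewrite L_compS.
set L := L_comp R m k n in h1 h2 *.
have lk : 0 < lnm k by apply: ($lnm_gt0); lia.
have lk1 : 0 < lnm k.+1 by apply: ($lnm_gt0); lia.
have g0 : 0 < gamma R m k.+1 by rewrite divr_gt0.
have x0 : 0 <= L%:R / gamma R m k.+1 by rewrite divr_ge0// ltW.
rewrite /L_ ifF; last by apply/eqP; lia.
have -> : `|Num.ceil (L%:R / gamma R m k.+1)|%N%:R = (Num.ceil (L%:R / gamma R m k.+1))%:~R :> R.
  by rewrite natr_absz ger0_norm// ceil_ge0 (lt_le_trans _ x0)// ltrN10.
have c1 := ceil_ge (L%:R / gamma R m k.+1); have c2 := ltW (ceilB1_lt (L%:R / gamma R m k.+1)).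
rewrite intrB lerBlDr in c2.
have e : L%:R / gamma R m k.+1 * lnm k.+1 = L%:R * lnm k.
  by rewrite /gamma /= invf_div mulrA divfK// gt_eqF.
apply/andP; split.
  by apply: le_trans h1 _; rewrite -e ler_pM2r.
apply: (@le_trans _ _ ((L%:R / gamma R m k.+1 + 1) * lnm k.+1)).
  by rewrite ler_pM2r// ltW.
rewrite mulrDl e mul1r /= -[k in (n + k)%N](prednK k0) addnS -natr1 mulrDl mul1r.
by apply: lerD; [exact: h2|exact: $lnm_le 1 k.+1 isT isT kd].
Qed.

Lemma Bn_ideal n x : ideal_ball (n + d) x `<=` Bn R d m n x /\ Bn R d m n x `<=` ideal_ball n x.
Proof.
split=> u h k i kd.
  move=> /andP[i1 iL]; apply: h => //.
  have /andP[_ h2] := L_comp_bounds n k kd.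
  have lk : 0 < lnm k by apply: ($lnm_gt0); lia.
  apply: (@le_trans _ _ ((L_comp R m k n)%:R * lnm k)); first by rewrite ler_pM2r// ler_nat.
  apply: le_trans h2 _; rewrite ler_pM2r ?lnm1_gt0// ler_nat; lia.
move=> i1 hik; apply: h => //; rewrite i1 /=.
have /andP[h1 _] := L_comp_bounds n k kd.
have lk : 0 < lnm k by apply: ($lnm_gt0); lia.
by have := le_trans hik h1; rewrite ler_pM2r// ler_nat.
Qed.

End Dimension.

Section BallMeasurable.
Variables (R : realType) (d q : nat) (m : nat -> nat).
Hypotheses (hd : (2 <= d)%N) (hq : (2 <= q)%N)
  (hm : forall k, (1 <= k < d)%N -> (m k.+1 <= m k)%N) (hmd : (2 <= m d)%N).
#[local] Set Default Proof Using "hd hq hm hmd".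
Local Notation "$ l" := (l R d q m hd hq hm hmd) (at level 0).

Lemma L_comp_scale n k i : (1 <= k <= d)%N -> (i <= L_comp R m k n)%N ->
  (i <= scale_len R d m (n + d))%N.
Proof.
move=> kd iL; apply: ($scale_lenP) (kd) _.
have lk : 0 < ln (m k)%:R :> R by apply: ($lnm_gt0); lia.
have /andP[_ h2] := $L_comp_bounds n k kd.
apply: (@le_trans _ _ ((L_comp R m k n)%:R * ln (m k)%:R)); first by rewrite ler_pM2r// ler_nat.
by apply: le_trans h2 _; rewrite ler_pM2r ?($lnm1_gt0)// ler_nat; lia.
Qed.

Lemma Bn_det n x z u : agree d m (scale_len R d m (n + d)) z u ->
  Bn R d m n x z -> Bn R d m n x u.
Proof.
move=> zu h k i kd /andP[i1 iL]; rewrite -(h k i kd) ?i1//.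
by rewrite /Defs.coord; case: insubP => // j _ _; rewrite zu// prednK// (L_comp_scale _ k).
Qed.

Lemma measurable_Bn n x : measurable (Bn R d m n x : set (SigmaB d m)).
Proof. by apply: (@measurable_fin_det d m _ (scale_len R d m (n + d))) => z u; exact: Bn_det. Qed.

End BallMeasurable.

(** * The mass of balls around almost every point *)

Section LawOfLargeNumbers.
Variables (R : realType) (d q : nat) (m : nat -> nat).
Hypotheses (hd : (2 <= d)%N) (hq : (2 <= q)%N)
  (hm : forall k, (1 <= k < d)%N -> (m k.+1 <= m k)%N) (hmd : (2 <= m d)%N).
Variables (Omega : set (Sigma d m)) (t : seq nat -> R).
Hypothesis Omega0 : Omega !=set0.
Local Notation Pref := (Pref R d q m Omega).
Hypothesis t_sol : forall X, size X = N_ R d q m -> Pref X -> tree_solution R d q m Omega X t.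
#[local] Set Default Proof Using "hd hq hm hmd Omega0 t_sol".
Local Notation "$ l" := (l R d q m hd hq hm hmd) (at level 0).
Local Notation w := (weight R d q m).
Local Notation lnm k := (ln (m k)%:R : R).
Local Notation Sg := (Sigma d m).
Local Notation Z := (tree_sum R d q m Omega t).
Local Notation K := (tree_sum_bound R d q m).
Local Notation lam := (lam R d q m).
Local Notation beta := (tree_weight R Pref w Z).
Local Notation H := (wentropy R (m 1) beta).
Local Notation C := (ln K).

Lemma Pref_rcons_w u c : Pref (rcons u c) -> Pref u.
Proof using hd hq hm hmd. exact: $Pref_rconsW. Qed.

Local Notation "$$ l" := (l R (m 1) Pref w Z K (Pref_nil R d q m Omega Omega0) Pref_rcons_w
  ($Pref_rcons_lt1 Omega) $weight_gt0 $weight_le ($tree_sum_ge1 Omega t t_sol)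
  ($tree_sum_le Omega t t_sol) ($tree_sum_rec Omega t t_sol)) (at level 0).

Lemma beta_nil : beta [::] = 1.
Proof. exact: tree_weight_nil R Pref w Z (Pref_nil R d q m Omega Omega0). Qed.
Lemma beta_ge0 u : 0 <= beta u.
Proof. exact: tree_weight_ge0 R Pref w Z (Pref_nil R d q m Omega Omega0) Pref_rcons_w ($tree_sum_ge1 Omega t t_sol) u. Qed.
Lemma beta_sum u : beta u = \sum_(0 <= c < m 1) beta (rcons u c).
Proof.
exact: tree_weight_sum R (m 1) Pref w Z (Pref_nil R d q m Omega Omega0) Pref_rcons_w ($tree_sum_ge1 Omega t t_sol)
  ($tree_sum_rec Omega t t_sol) u.
Qed.
Lemma beta_out u : ~ Pref u -> beta u = 0.
Proof. exact: tree_weight_out. Qed.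

Lemma C_ge0 : 0 <= C.
Proof.
exact/ln_ge0/(K_ge1 _ _ _ _ (Pref_nil R d q m Omega Omega0) ($tree_sum_ge1 Omega t t_sol)
  ($tree_sum_le Omega t t_sol)).
Qed.

Lemma ln_beta u n : u \in words (m 1) n -> beta u != 0 -> 0 <= - ln (beta u) <= n%:R * C.
Proof.
move=> un b0; have Pu : Pref u.
  by apply/not_notP => nP; move/eqP: b0; rewrite beta_out.
by have := $$ ln_tree_weight u Pu; rewrite (size_words _ _ _ un).
Qed.

Lemma entropy_le n : 0 <= H n <= n%:R * C.
Proof.
apply/andP; split; first exact: $$ wentropy_ge0 beta beta_nil beta_ge0 beta_sum beta_out n.
have -> : n%:R * C = \sum_(u <- words (m 1) n) beta u * (n%:R * C).
  by rewrite -mulr_suml (sum_words_const _ _ _ beta_sum) beta_nil mul1r.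
rewrite /wentropy -sumrN.
rewrite big_seq [leRHS]big_seq; apply: ler_sum => u un; rewrite -mulrN.
have [->|b0] := eqVneq (beta u) 0; first by rewrite !mul0r.
by apply: ler_wpM2l; [exact: beta_ge0|have /andP[] := ln_beta u n un b0].
Qed.

(** The almost sure limit of [- ln P(ideal_ball n x) / n]; dividing it by [ln m_1] gives the
    dimension. *)
Definition info_rate : R := lnm 1 / lnm d * (w 1 * ln (Z [::])).
Local Notation Dst := info_rate.

Variable A : R.
Hypothesis lam_dec : forall j, (1 <= j)%N -> lam j * j%:R ^+ 6 <= A.
Local Notation dep := (depth R lam A).
#[local] Set Default Proof Using "hd hq hm hmd Omega0 t_sol lam_dec".
Local Notation "$% l" := (l R q lam A hq $lam_gt0 $lam_le lam_dec) (at level 0).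

Lemma lam_weight c : lam c = lam_factor R d q m * w c. Proof. by []. Qed.

(** Summation by parts turns the weighted entropy increments into the sum of [entropy_sum_identity],
    in which the relative entropies vanish because beta is compared with itself. *)
Lemma entropy_steps c :
  `|\sum_(1 <= j < c.+1) (H j - H j.-1) * w j - w 1 * ln (Z [::])| <= w c.+1 * (c.+1%:R * C).
Proof.
have abel : \sum_(1 <= j < c.+1) (H j - H j.-1) * w j =
    \sum_(1 <= j < c.+1) (w j - w j.+1) * H j + H c * w c.+1 - H 0 * w 1.
  elim: c => [|c IH]; first by rewrite !big_geq// add0r subrr.
  by rewrite [LHS]big_nat_recr//= IH [in RHS]big_nat_recr//=; ring.
have H0 : H 0 = 0.
  by rewrite /wentropy /= big_seq1 beta_nil ln1 mulr0 oppr0.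
have := $$ entropy_sum_identity beta beta_nil beta_ge0 beta_sum beta_out c.
have := $$ tail_term_bounds beta beta_nil beta_ge0 beta_sum beta_out c.
set T := \sum_(u <- _) _ => /andP[T0 T1].
rewrite [X in _ - X]big1 ?subr0; last first.
  by move=> j _; rewrite /relative_entropy big1 ?mulr0// => u _; rewrite subrr mulr0.
move=> id; rewrite abel id H0 mul0r subr0.
have -> : w 1 * ln (Z [::]) - w c.+1 * T + H c * w c.+1 - w 1 * ln (Z [::]) =
  w c.+1 * (H c - T) by ring.
have w0 : 0 < w c.+1 by apply: ($weight_gt0).
rewrite normrM (gtr0_norm w0) ler_pM2l//.
have /andP[h0 h1] := entropy_le c; have C0 := C_ge0.
have e : c.+1%:R * C = c%:R * C + C by rewrite -natr1 mulrDl mul1r.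
rewrite e in T1 *.
by rewrite ler_norml; apply/andP; split; lra.
Qed.

Definition info_err : R := 4 * C * Num.sqrt A + A * C.

(** The sum is the mean of [- ln P(ideal_ball n x)]. Split each [H] into increments and exchange the
    sums: the j-th increment is counted for about [(1 - 1/q) n lam j] chains. *)
Lemma entropy_mean n : (1 <= n)%N ->
  `|\sum_(1 <= i < (scale_len R d m n).+1 | ~~ (q %| i)%N) H (dep i n) - n%:R * Dst| <=
  info_err * Num.sqrt n%:R.
Proof.
move=> n1; have C0 := C_ge0; have A0 := A_gt0 R lam A $lam_gt0 lam_dec.
have H0 : H 0 = 0 by rewrite /wentropy /= big_seq1 beta_nil ln1 mulr0 oppr0.
pose s j := H j - H j.-1.
have Hs J : H J = \sum_(1 <= j < J.+1) s j.
  elim: J => [|J IH]; first by rewrite big_geq.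
  by rewrite big_nat_recr//= -IH /s /= subrKC.
have s_le j : (1 <= j)%N -> `|s j| <= (2 * C) * j%:R.
  move=> j1; have /andP[a0 a1] := entropy_le j; have /andP[b0 b1] := entropy_le j.-1.
  have e : j.-1%:R * C <= j%:R * C by apply: ler_wpM2r => //; rewrite ler_nat leq_pred.
  have e2 : 2 * C * j%:R = j%:R * C + j%:R * C by ring.
  have e3 : 0 <= j%:R * C by rewrite mulr_ge0.
  by rewrite e2 ler_norml /s; apply/andP; split; lra.
under eq_bigr do rewrite Hs.
have C2 : 0 <= 2 * C by rewrite mulr_ge0.
have h1 := $% depth_sum_dist n (scale_len R d m n) s _ n1 ($lam1_scale n) C2 s_le.
set c := cutoff R A n in h1 *.
have nc : (n <= c.+1)%N by rewrite /c /cutoff ltnW// ltnS leq_pmulr.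
have q0 := $q_gt0; have q1 := $q_gt1.
have ld := $lnmd_gt0; have l1 := $lnm1_gt0.
(* The density [1 - 1/q] of the chain origins cancels the factor [q / (q - 1)] of [lam_factor]. *)
have fe : (1 - q%:R^-1) * lam_factor R d q m = lnm 1 / lnm d.
  rewrite /lam_factor; move: (lnm d) ld (lnm 1) => y y0 z.
  have q1' : q%:R - 1 != 0 :> R by rewrite subr_eq0 gt_eqF.
  by field; rewrite !gt_eqF// subr_gt0.
pose W := \sum_(1 <= j < c.+1) (H j - H j.-1) * w j.
have eW : (1 - q%:R^-1) * n%:R * \sum_(1 <= j < c.+1) s j * lam j = n%:R * (lnm 1 / lnm d) * W.
  transitivity ((1 - q%:R^-1) * n%:R * (lam_factor R d q m * W)).
    by congr (_ * _); rewrite /W mulr_sumr; apply: eq_bigr => j _; rewrite lam_weight mulrCA.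
  by rewrite mulrACA mulrA fe mulrAC [n%:R * _]mulrC -!mulrA; congr (_ * (_ * _)); rewrite mulrC.
rewrite eW in h1.
have h2 : `|n%:R * (lnm 1 / lnm d) * W - n%:R * Dst| <= A * C.
  rewrite /Dst -mulrA -mulrBr -mulrBr.
  have g0 : 0 < lnm 1 / lnm d by rewrite divr_gt0.
  rewrite normrM normrM (gtr0_norm g0) ger0_norm//.
  apply: (@le_trans _ _ (n%:R * (lnm 1 / lnm d * (w c.+1 * (c.+1%:R * C))))).
    by apply: ler_wpM2l => //; rewrite ler_pM2l//; exact: entropy_steps.
  rewrite (_ : _ * _ = n%:R * (lnm 1 / lnm d * w c.+1) * c.+1%:R * C); last by ring.
  apply: ler_wpM2r => //.
  have L0 : 0 < lam c.+1 by apply: ($lam_gt0).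
  have hl : lnm 1 / lnm d * w c.+1 <= lam c.+1.
    rewrite lam_weight ler_pM2r ?($weight_gt0)//.
    by rewrite -fe ler_piMl ?gerBl ?invr_ge0// ltW// ($lam_factor_gt0).
  have c0 : 1 <= c.+1%:R :> R by rewrite ler1n.
  apply: le_trans (lam_dec c.+1 isT).
  apply: (@le_trans _ _ (c.+1%:R * lam c.+1 * c.+1%:R)).
    apply: ler_wpM2r => //; apply: ler_pM => //; last by rewrite ler_nat.
    by rewrite mulr_ge0 ?ltW// ($weight_gt0).
  rewrite mulrC mulrA mulrC ler_pM2l// -expr2; exact: ler_weXn2l.
have r1 : 1 <= Num.sqrt n%:R :> R by rewrite -[leLHS]sqrtr1 ler_wsqrtr// ler1n.
have AC : A * C <= A * C * Num.sqrt n%:R by rewrite ler_peMr// mulr_ge0// ltW.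
apply: le_trans (ler_distD (n%:R * (lnm 1 / lnm d) * W) _ _) _.
rewrite /info_err mulrDl; apply: lerD; last exact: le_trans h2 AC.
by apply: le_trans h1 _; rewrite mulrA -natrM.
Qed.

Variables (mu P : probability (SigmaB d m) R).
Hypotheses (mu_beta : forall u, word_prob R d q m mu u = beta u) (hP : is_P_mu R d q m mu P).
#[local] Set Default Proof Using "All".
Local Notation p n x := (fine (P (ideal_ball R d m n x))).
Local Notation M := (scale_len R d m).
Local Notation wd := (Defs.word R d q m).
Local Notation spt := (subseq_pt d q m).

Lemma ideal_ball_prob n x :
  p n x = \prod_(1 <= i < (M n).+1 | ~~ (q %| i)%N) beta (wd (dep i n) (spt i x)).
Proof.
rewrite ($ideal_ballE A lam_dec).
rewrite (chains_ball_prob R d q m hq mu hd hm hmd P hP (M n) (dep ^~ n))//; last first.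
  by move=> i i1 y u; exact: ($depth_det A lam_dec).
by apply: eq_bigr => i _.
Qed.

(** The sign of th selects the side of the deviation. Points whose ball has mass 0 are included,
    because [ln 0 = 0] would hide them. *)
Definition deviation (th eps : R) (n : nat) : set (SigmaB d m) :=
  [set x | p n x = 0 \/ `|th| * eps * n%:R <= th * (ln (p n x) + n%:R * Dst)].

Lemma deviation_det th eps n x u : agree d m (M n) x u ->
  deviation th eps n x -> deviation th eps n u.
Proof.
move=> xu; rewrite /deviation /=.
have -> : p n x = p n u.
  rewrite !ideal_ball_prob big_nat_cond [RHS]big_nat_cond; apply: eq_bigr => i.
  move=> /andP[/andP[i1 iM] _]; congr beta.
  apply/esym/($depth_det A lam_dec) => // l; rewrite (chain_lenP q hq)// => hl.
  by apply: xu; have := expn_gt0 q l; lia.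
by [].
Qed.

(** Markov's inequality for the product of [beta ^ th] along the chains, with [moment_le] on each
    chain. The constant 16 is 4 from [moment_le] times 4 from [depth_sq_sum_le]. *)
Lemma deviation_prob th eps n : (1 <= n)%N ->
  fine (P (deviation th eps n)) <=
  expR (`|th| * info_err * Num.sqrt n%:R - `|th| * eps * n%:R + 16 * th ^+ 2 * C ^+ 2 * A * n%:R).
Proof.
move=> n1; pose F (i : nat) (u : seq nat) : R := expR (th * ln (beta u)).
pose c := expR (`|th| * eps * n%:R - th * (n%:R * Dst)).
have c0 : 0 < c by exact: expR_gt0.
apply: le_trans (markov_fin_det R d q m hq mu hd hm hmd P hP (M n) (dep ^~ n) _ (deviation th eps n) F c _ c0 _ _) _.
- by move=> i i1 y u; exact: ($depth_det A lam_dec).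
- by move=> x u xu; exact: deviation_det.
- by move=> i u; exact: expR_ge0.
- move=> x dx nz.
  have pos i : (1 <= i < (M n).+1)%N && ~~ (q %| i)%N -> 0 < beta (wd (dep i n) (spt i x)).
    move=> /andP[hi qi]; rewrite lt_neqAle beta_ge0 andbT eq_sym -mu_beta.
    by apply: nz => //; lia.
  have px : 0 < p n x.
    by rewrite ideal_ball_prob big_nat_cond; apply: prodr_gt0.
  case: dx => [p0|dx]; first by rewrite p0 ltxx in px.
  rewrite /F -expR_sum -mulr_sumr.
  have -> : \sum_(1 <= i < (M n).+1 | ~~ (q %| i)%N) ln (beta (wd (dep i n) (spt i x))) = ln (p n x).
    rewrite -[LHS]expRK expR_sum ideal_ball_prob; congr ln.
    by rewrite big_nat_cond [RHS]big_nat_cond; apply: eq_bigr => i hi; rewrite lnK// posrE pos.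
  by rewrite ler_expR; lra.
have -> : \prod_(1 <= i < (M n).+1 | ~~ (q %| i)%N) \sum_(u <- words (m 1) (dep i n)) word_prob R d q m mu u * F i u =
   \prod_(1 <= i < (M n).+1 | ~~ (q %| i)%N) \sum_(u <- words (m 1) (dep i n)) beta u * F i u.
  by apply: eq_bigr => i _; apply: eq_bigr => u _; rewrite mu_beta.
have H1 i : \sum_(u <- words (m 1) (dep i n)) beta u * F i u <=
    expR (- th * H (dep i n) + 4 * th ^+ 2 * C ^+ 2 * (dep i n)%:R ^+ 2).
  apply: moment_le; [exact: beta_ge0| |exact: C_ge0|].
    by rewrite (sum_words_const _ _ _ beta_sum) beta_nil.
  by move=> u un; exact: ln_beta.
apply: (@le_trans _ _ (c^-1 * \prod_(1 <= i < (M n).+1 | ~~ (q %| i)%N)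
    expR (- th * H (dep i n) + 4 * th ^+ 2 * C ^+ 2 * (dep i n)%:R ^+ 2))).
  apply: ler_wpM2l; first by rewrite invr_ge0 ltW.
  apply: ler_prod => i _; rewrite H1 andbT; apply: sumr_ge0 => u _.
  by rewrite mulr_ge0 ?beta_ge0// expR_ge0.
rewrite -expR_sum big_split /= -mulr_sumr -mulr_sumr /c -expRN -expRD ler_expR.
have := entropy_mean n n1; set S := \sum_(1 <= i < _ | _) H _ => hS.
have := $% depth_sq_sum_le n (M n) n1 ($lam1_scale n); set Q := \sum_(1 <= i < _ | _) _ => hQ.
have f1 : 4 * th ^+ 2 * C ^+ 2 * Q <= 16 * th ^+ 2 * C ^+ 2 * A * n%:R.
  rewrite (_ : 16 * _ * _ * _ * _ = 4 * th ^+ 2 * C ^+ 2 * (4 * A * n%:R)); last by ring.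
  by apply: ler_wpM2l => //; rewrite mulr_ge0 ?sqr_ge0// mulr_ge0 ?sqr_ge0.
have f2 : - th * (S - n%:R * Dst) <= `|th| * info_err * Num.sqrt n%:R.
  rewrite -mulrA; apply: le_trans (ler_norm _) _; rewrite normrM normrN.
  by apply: ler_wpM2l.
lra.
Qed.

Lemma measurable_deviation th eps n : measurable (deviation th eps n).
Proof. by apply: (@measurable_fin_det d m _ (M n)) => x u xu; exact: deviation_det. Qed.

(** The condition on th makes the quadratic term at most half of [|th| eps n], and AM-GM bounds the
    square-root term by a quarter of it plus a constant; the remaining quarter is the rate of a
    convergent geometric series. *)
Lemma deviation_limsup (th eps : R) : 0 < eps -> 0 < `|th| -> 32 * `|th| * C ^+ 2 * A <= eps ->
  P (lim_sup_set (deviation th eps)) = 0%E.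
Proof.
move=> e0 th0 small; apply: lim_sup_set_cvg0; first by move=> n; exact: measurable_deviation.
pose B := expR (`|th| * info_err ^+ 2 / eps); pose rho := expR (- (`|th| * eps / 4)).
have rho0 : 0 < rho by exact: expR_gt0.
have rho1 : rho < 1 by rewrite expR_lt1 oppr_lt0 divr_gt0// mulr_gt0.
have bound n : fine (P (deviation th eps n)) <= B * rho ^+ n.
  case: n => [|n].
    rewrite expr0 mulr1; apply: (@le_trans _ _ 1).
      by rewrite -lee_fin fineK ?fin_num_measure ?probability_le1//; exact: measurable_deviation.
    by rewrite -expR0 ler_expR divr_ge0 ?(ltW e0)// mulr_ge0 ?sqr_ge0.
  apply: le_trans (deviation_prob th eps n.+1 isT) _.
  rewrite /rho -expRM_natl -expRD ler_expR.
  set x := n.+1%:R; set s := Num.sqrt x.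
  have ex : x = s ^+ 2 by rewrite sqr_sqrtr.
  have e1 : 16 * th ^+ 2 * C ^+ 2 * A * x <= `|th| * eps / 2 * x.
    apply: ler_wpM2r => //; rewrite -[th ^+ 2]real_normK ?num_real//.
    rewrite (_ : 16 * _ * _ * _ = `|th| * (32 * `|th| * C ^+ 2 * A) / 2); last by field.
    by rewrite ler_pM2r ?invr_gt0// ler_pM2l.
  (* AM-GM *)
  have e2 : info_err * s <= eps / 4 * x + info_err ^+ 2 / eps.
    rewrite ex -subr_ge0.
    have -> : eps / 4 * s ^+ 2 + info_err ^+ 2 / eps - info_err * s =
       (eps / 2 * s - info_err) ^+ 2 / eps by field; rewrite gt_eqF.
    by rewrite divr_ge0 ?sqr_ge0 ?ltW.
  have e3 := ler_wpM2l (ltW th0) e2.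
  rewrite mulrDr [_ * (info_err ^+ 2 / eps)]mulrA in e3; move: e1 e3.
  move: (`|th| * info_err ^+ 2 / eps) (16 * th ^+ 2 * C ^+ 2 * A * x) => y v; lra.
apply: (@le_lt_trans _ _ (B * (1 - rho)^-1)%:E); last exact: ltry.
apply: lime_le; first by apply: is_cvg_nneseries => n _ _; exact: measure_ge0.
apply: nearW => n.
apply: (@le_trans _ _ (series (geometric B rho) n)%:E); last first.
  by rewrite lee_fin geometric_le_lim ?expR_ge0// gtr0_norm.
rewrite /series /= -sumEFin; apply: lee_sum => k _.
rewrite -[leLHS]fineK ?fin_num_measure//; first by rewrite lee_fin; exact: bound.
exact: measurable_deviation.
Qed.

Lemma ideal_ball_ae : {ae P, forall x : SigmaB d m, forall e : R, 0 < e -> exists n0 : nat,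
  forall n, (n0 <= n)%N -> 0 < p n x /\ `|ln (p n x) + n%:R * Dst| <= e * n%:R}.
Proof.
have A0 := A_gt0 R lam A $lam_gt0 lam_dec.
(* The size of th that [deviation_limsup] allows for eps = 1/(k+1), up to the summand 1, which keeps
   the denominator positive when C = 0. *)
pose th (k : nat) : R := k.+1%:R^-1 / (32 * (C ^+ 2 * A + 1)).
have CA : 0 <= C ^+ 2 * A by rewrite mulr_ge0 ?sqr_ge0 ?ltW.
have k0 (k : nat) : 0 < k.+1%:R^-1 :> R by rewrite invr_gt0.
have th0 k : 0 < th k by rewrite divr_gt0// mulr_gt0// ltr_wpDl.
have small k : 32 * th k * C ^+ 2 * A <= k.+1%:R^-1.
  rewrite (_ : 32 * _ * _ * _ = k.+1%:R^-1 * (C ^+ 2 * A / (C ^+ 2 * A + 1))); last first.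
    rewrite /th -[_ * C ^+ 2 * A]mulrA; move: (C ^+ 2 * A) CA (k.+1%:R^-1) => y y0 z.
    by field; rewrite gt_eqF// ltr_wpDl.
  rewrite ler_piMr ?(ltW (k0 k))// ler_pdivrMr ?ltr_wpDl// mul1r.
  by rewrite lerDl.
have ae0 k : {ae P, forall x, ~ (lim_sup_set (deviation (th k) k.+1%:R^-1) `|`
    lim_sup_set (deviation (- th k) k.+1%:R^-1)) x}.
  have ms s : measurable (lim_sup_set (deviation s k.+1%:R^-1)).
    apply: bigcap_measurable => [|n _]; first by exists 0%N.
    by apply: bigcup_measurable => j _; exact: measurable_deviation.
  have z s : `|s| = th k -> P (lim_sup_set (deviation s k.+1%:R^-1)) = 0%E.
    by move=> es; apply: deviation_limsup; rewrite ?es.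
  exists (lim_sup_set (deviation (th k) k.+1%:R^-1) `|` lim_sup_set (deviation (- th k) k.+1%:R^-1)).
  split; [exact: measurableU| |by move=> x /= /contrapT].
  have zp := z (th k) (gtr0_norm (th0 k)).
  have zn := z (- th k) (etrans (normrN _) (gtr0_norm (th0 k))).
  apply: etrans _ zp; exact: measureU0 (ms _) (ms _) zn.
apply: filterS (ae_foralln ae0) => x hx e e0.
have [k ke] : exists k : nat, k.+1%:R^-1 <= e.
  exists (Num.truncn e^-1); rewrite -[leRHS]invrK lef_pV2 ?posrE ?invr_gt0//.
  exact/ltW/truncnS_gt.
have nl s : `|s| = th k -> exists n, forall j, (n <= j)%N -> ~ deviation s k.+1%:R^-1 j x.
  move=> es; apply: contrapT => h; apply: (hx k).
  have ls : lim_sup_set (deviation s k.+1%:R^-1) x.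
    move=> n _; apply: contrapT => h'; apply: h; exists n => j nj dj; apply: h'.
    by exists j.
  move: es; have [s0|s0] := leP 0 s.
    by rewrite ger0_norm// => <-; left.
  by rewrite ltr0_norm// => <-; right; rewrite opprK.
have [n1 h1] := nl (th k) (gtr0_norm (th0 k)).
have [n2 h2] := nl (- th k) (etrans (normrN _) (gtr0_norm (th0 k))).
exists (n1 + n2)%N => n hn.
have {}h1 := h1 n (leq_trans (leq_addr _ _) hn).
have {}h2 := h2 n (leq_trans (leq_addl _ _) hn).
have pn : p n x != 0 by apply/eqP => p0; apply: h1; left.
split; first by rewrite lt_neqAle eq_sym pn fine_ge0// measure_ge0.
have {}h1 : th k * (ln (p n x) + n%:R * Dst) < th k * (k.+1%:R^-1 * n%:R).
  by rewrite ltNge; apply/negP => h; apply: h1; right; rewrite gtr0_norm// -mulrA.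
have {}h2 : th k * (- (ln (p n x) + n%:R * Dst)) < th k * (k.+1%:R^-1 * n%:R).
  by rewrite ltNge; apply/negP => h; apply: h2; right; rewrite normrN gtr0_norm// -mulrA mulNr -mulrN.
rewrite !ltr_pM2l// in h1 h2.
have ken : k.+1%:R^-1 * n%:R <= e * n%:R by apply: ler_wpM2r.
move: h1 h2 ken; move: (ln _ + _) (k.+1%:R^-1 * n%:R) (e * _) => y z v h1 h2 ken.
by rewrite ler_norml; apply/andP; split; lra.
Qed.

Lemma P_mu_exact_dimensional :
  exact_dimensional R d m P (omega R d q m 1 * log_ R (m d) (t_empty R d q m Omega t)).
Proof.
have l1 := $lnm1_gt0; have ld := $lnmd_gt0.
apply: filterS ideal_ball_ae => x hx.
have -> : omega R d q m 1 * log_ R (m d) (t_empty R d q m Omega t) = Dst / lnm 1.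
  rewrite /Dst ($tree_sum_nil) ($omega_1) /log_; move: (ln (t_empty _ _ _ _ _ _)) (lnm 1) l1 (lnm d) ld.
  by move=> v y y0 z z0; field; rewrite !gt_eqF.
apply/cvgrPdist_le => e e0; pose e' := e * lnm 1 / 2.
have e'0 : 0 < e' by rewrite divr_gt0// mulr_gt0.
have [n0 h0] := hx e' e'0.
(* Cost of passing from n + d to n; it is bounded, hence below [e' n] for large n. *)
pose r := d%:R * (`|Dst| + e').
have r0 : 0 <= r by rewrite mulr_ge0// addr_ge0// ltW.
exists (n0 + (Num.truncn (r / e')).+2)%N => // n /= hn.
have nn0 : (n0 <= n)%N by lia.
have [_ u] := h0 n nn0; have [pd0 l] := h0 (n + d)%N (leq_trans nn0 (leq_addr _ _)).
have n_gt0 : 0 < n%:R :> R by rewrite ltr0n; lia.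
have rn : r <= n%:R * e'.
  rewrite -ler_pdivrMr//; apply: le_trans (ltW (truncnS_gt (r / e'))) _.
  by rewrite ler_nat; apply: leq_trans hn; rewrite addnS ltnW// ltnS leq_addl.
have [s1 s2] := $Bn_ideal n x.
have mI k : measurable (ideal_ball R d m k x : set (SigmaB d m)).
  by rewrite ($ideal_ballE A lam_dec); apply: (measurable_chains_ball R d q m hq mu hd hm hmd P hP) => i i1 y z; exact: ($depth_det A lam_dec).
have mB : measurable (Bn R d m n x : set (SigmaB d m)) by exact: $measurable_Bn.
have le1 : p (n + d) x <= fine (P (Bn R d m n x)).
  by apply: fine_le; rewrite ?fin_num_measure// le_measure ?inE.
have le2 : fine (P (Bn R d m n x)) <= p n x.
  by apply: fine_le; rewrite ?fin_num_measure// le_measure ?inE.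
have b0 : 0 < fine (P (Bn R d m n x)) by exact: lt_le_trans le1.
have {}le1 : ln (p (n + d) x) <= ln (fine (P (Bn R d m n x))) by rewrite ler_ln ?posrE.
have {}le2 : ln (fine (P (Bn R d m n x))) <= ln (p n x) by rewrite ler_ln ?posrE// (lt_le_trans b0).
move: le1 le2; rewrite /log_; set lb := ln (fine (P (Bn R d m n x))) => le1 le2.
have -> : Dst / lnm 1 - - (n%:R^-1 * (lb / lnm 1)) = (lb + n%:R * Dst) / (n%:R * lnm 1).
  by move: (lnm 1) l1 (n%:R) n_gt0 => y y0 z z0; field; rewrite !gt_eqF.
rewrite normrM normfV [`|n%:R * _|]gtr0_norm ?mulr_gt0// ler_pdivrMr ?mulr_gt0//.
have -> : e * (n%:R * lnm 1) = e' * n%:R + n%:R * e' by rewrite /e'; field.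
have rE : r = d%:R * `|Dst| + e' * d%:R by rewrite /r mulrDr [e' * _]mulrC.
have dD : - (d%:R * `|Dst|) <= d%:R * Dst <= d%:R * `|Dst|.
  by rewrite -ler_norml normrM ger0_norm.
move: u l; rewrite natrD !mulrDl mulrDr !ler_norml => /andP[u1 u2] /andP[v1 v2].
case/andP: dD => d1 d2; rewrite rE in rn.
by apply/andP; split; lra.
Qed.



End LawOfLargeNumbers.

(** * Hausdorff dimension *)

(* [x0] pads the lists, so that the first [k] of them have at least [k] entries. *)
Lemma enumerate_lists (R : realType) (T : eqType) (x0 : T) (L : nat -> seq T) (f : T -> R) :
  f x0 = 0 -> (forall C, 0 <= f C) -> exists U : nat -> T,
  [/\ forall i, U i = x0 \/ exists j, U i \in L j, forall j C, C \in L j -> exists i, U i = C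
    & forall k, \sum_(0 <= i < k) f (U i) <= \sum_(0 <= j < k) \sum_(C <- L j) f C].
Proof.
move=> f0 f_ge0; pose F k := flatten [seq rcons (L j) x0 | j <- iota 0 k].
have FD k l : F (k + l)%N = F k ++ flatten [seq rcons (L j) x0 | j <- iota k l].
  by rewrite /F iotaD map_cat flatten_cat add0n.
have sF k : (k <= size (F k))%N.
  elim: k => // k IH; rewrite -addn1 FD size_cat leq_add//=.
  by rewrite cats0 size_rcons.
have nF k l i : (i < size (F k))%N -> (k <= l)%N -> nth x0 (F l) i = nth x0 (F k) i.
  by move=> ik kl; rewrite -(subnKC kl) FD nth_cat ik.
exists (fun i => nth x0 (F i.+1) i); split.
- move=> i; have : nth x0 (F i.+1) i \in F i.+1 by apply: mem_nth; exact: sF.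
  move=> /flattenP[s /mapP[j _ ->]]; rewrite mem_rcons inE => /orP[/eqP ->|h]; first by left.
  by right; exists j.
- move=> j C Cj; have CF : C \in F j.+1.
    apply/flattenP; exists (rcons (L j) x0); last by rewrite mem_rcons inE Cj orbT.
    by apply/mapP; exists j => //; rewrite mem_iota add0n ltnSn.
  exists (index C (F j.+1)); rewrite -[RHS](nth_index x0 CF).
  have := CF; rewrite -index_mem; move: (index C _) => i iF.
  by have [h|h] := leqP i.+1 j.+1; [apply/esym/nF|apply: nF => //; exact: ltnW].
- move=> k; rewrite (eq_big_nat _ _ (F2 := fun i => f (nth x0 (F k) i))); last first.
    by move=> i /andP[_ ik]; rewrite -(nF i.+1 k)//; exact: sF.
  apply: (@le_trans _ _ (\sum_(C <- F k) f C)).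
    rewrite [leRHS](big_nth x0) [leRHS](@big_cat_nat _ _ _ k)//= lerDl; apply: sumr_ge0 => i _; exact: f_ge0.
  rewrite big_flatten big_map /index_iota subn0 le_eqVlt; apply/orP; left; apply/eqP.
  by apply: eq_bigr => j _; rewrite -cats1 big_cat big_seq1 f0; exact: addr0.
Qed.

Section Billingsley.
Variables (R : realType) (d q : nat) (m : nat -> nat).
Hypotheses (hd : (2 <= d)%N) (hq : (2 <= q)%N)
  (hm : forall k, (1 <= k < d)%N -> (m k.+1 <= m k)%N) (hmd : (2 <= m d)%N).
#[local] Set Default Proof Using "hd hq hm hmd".
Local Notation "$ l" := (l R d q m hd hq hm hmd) (at level 0).
Local Notation Sg := (Sigma d m).
Local Notation Ln := (ln (m 1)%:R : R).
Local Notation B := (Bn R d m).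
Local Notation rad n := ((m 1)%:R ^- n : R).
Local Notation dist := (dist R d m).
Local Notation diam := (diam R d m).
Local Notation scale n := (scale_len R d m (n + d)).

Lemma L_comp_mono k n n' : (k <= d)%N -> (n <= n')%N -> (L_comp R m k n <= L_comp R m k n')%N.
Proof.
move=> kd nn; elim: k kd => [//|k IH] kd; have {}IH := IH (ltnW kd).
rewrite !($L_compS) /L_; case: eqP => // /eqP k0.
have k1 : (1 <= k)%N by lia.
have g0 : 0 < gamma R m k.+1.
  by rewrite divr_gt0// ($lnm_gt0) ?kd ?k1 //= ltnW.
have le : (L_comp R m k n)%:R / gamma R m k.+1 <= (L_comp R m k n')%:R / gamma R m k.+1 :> R.
  by rewrite ler_pM2r ?invr_gt0// ler_nat.
have p0 x : 0 <= Num.ceil (x%:R / gamma R m k.+1).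
  by rewrite ceil_ge0 (lt_le_trans _ (_ : 0 <= _)) ?ltrN10// divr_ge0// ltW.
by rewrite -lez_nat !gez0_abs//; apply: ceil_le.
Qed.

Lemma L_comp0 k : L_comp R m k 0 = 0%N.
Proof.
by elim: k => [//|k IH]; rewrite ($L_compS) IH /L_; case: eqP => // _; rewrite mul0r ceil0.
Qed.

Lemma Bn0 x u : B 0 x u.
Proof. by move=> k i _; rewrite L_comp0 => /andP[i1 i0]; lia. Qed.

Lemma Bn_sym n x u : B n x u -> B n u = B n x.
Proof.
move=> xu; apply/seteqP; split=> z h k i kd hi; first by rewrite h// xu.
by rewrite h// xu.
Qed.

Lemma Bn_nested n n' x : (n <= n')%N -> B n' x `<=` B n x.
Proof.
move=> nn u h k i kd /andP[i1 iL]; apply: h; rewrite ?kd// i1 (leq_trans iL)//.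
by apply: L_comp_mono nn; case/andP: kd.
Qed.

Lemma m1_gt1 : 1 < (m 1)%:R :> R.
Proof. by rewrite ltr1n; apply: (m_ge2 d q m hd hq hm hmd) => //; lia. Qed.

Lemma Ln_gt0 : 0 < Ln. Proof. exact: ln_gt0 m1_gt1. Qed.

Lemma radE n : rad n = expR (- (n%:R * Ln)).
Proof.
have m0 := lt_trans ltr01 m1_gt1.
by rewrite expRN expRM_natl lnK// posrE.
Qed.

Lemma rad_gt0 n : 0 < rad n. Proof. by rewrite radE expR_gt0. Qed.

Lemma rad_le n n' : (rad n' <= rad n) = (n <= n')%N.
Proof. by rewrite !radE ler_expR lerN2 ler_pM2r ?Ln_gt0// ler_nat. Qed.

Lemma rad_small e : 0 < e -> exists n, rad n < e.
Proof.
move=> e0; exists (Num.truncn (- ln e / Ln)).+1.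
rewrite radE -[ltRHS]lnK ?posrE// ltr_expR ltrNl -ltr_pdivrMr ?Ln_gt0//.
exact: truncnS_gt.
Qed.

Lemma dist_le n x u : B n x u -> dist x u <= rad n.
Proof.
move=> xu; apply: ge_inf; last by exists n.
by exists 0 => _ [k _ <-]; exact/ltW/rad_gt0.
Qed.

Lemma dist_ge0 x u : 0 <= dist x u.
Proof.
apply: lb_le_inf; first by exists (rad 0), 0%N => //; exact: Bn0.
by move=> _ [k _ <-]; exact/ltW/rad_gt0.
Qed.

Lemma dist_Bn n x u : dist x u <= rad n -> B n x u.
Proof.
case: n => [_|n h]; first exact: Bn0.
apply: contrapT => nB; suff : rad n <= rad n.+1 by rewrite rad_le ltnn.
apply: le_trans h; apply: lb_le_inf; first by exists (rad 0), 0%N => //; exact: Bn0.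
move=> _ [k xu <-]; rewrite rad_le leqNgt; apply/negP => nk.
by apply: nB; exact: Bn_nested nk _ xu.
Qed.

Lemma dist_le1 x u : dist x u <= 1.
Proof. by have := dist_le 0 x u (Bn0 x u); rewrite expr0 invr1. Qed.

Lemma diam_le (U : set Sg) c : 0 <= c -> (forall x y, U x -> U y -> dist x y <= c) -> diam U <= c.
Proof.
move=> c0 h; have [[x Ux]|U0] := pselect (U !=set0).
  apply: ge_sup; first by exists (dist x x), x, x.
  by move=> _ [y [z [Uy Uz ->]]]; exact: h.
rewrite /Defs.diam (_ : [set r | _] = set0) ?sup0//.
by apply/seteqP; split=> // r [y [z [Uy _ _]]]; apply: U0; exists y.
Qed.

Lemma dist_le_diam (U : set Sg) x y : U x -> U y -> dist x y <= diam U.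
Proof.
move=> Ux Uy; apply: ub_le_sup; last by exists x, y.
by exists 1 => _ [z [v [_ _ ->]]]; exact: dist_le1.
Qed.

Lemma diam_ge0 (U : set Sg) : 0 <= diam U.
Proof.
have [[x Ux]|U0] := pselect (U !=set0).
  by apply: le_trans (dist_le_diam U x x Ux Ux); exact: dist_ge0.
rewrite /Defs.diam (_ : [set r | _] = set0) ?sup0//.
by apply/seteqP; split=> // r [y [z [Uy _ _]]]; apply: U0; exists y.
Qed.

Lemma diam_Bn n x : diam (B n x) <= rad n.
Proof.
apply: diam_le; first exact/ltW/rad_gt0.
by move=> y z xy xz; apply: dist_le; rewrite (Bn_sym _ _ _ xy).
Qed.

Lemma diam_pow_ge0 s U : 0 <= diam_pow R d m s U.
Proof. by rewrite /diam_pow; case: asboolP => // _; exact: powR_ge0. Qed.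

Variables (nu : probability (SigmaB d m) R) (D : R).
Hypotheses (D_ge0 : 0 <= D) (nuD : exact_dimensional R d m nu D).
#[local] Set Default Proof Using "hd hq hm hmd D_ge0 nuD".
Local Notation p n x := (fine (nu (B n x))).

Lemma mB n x : measurable (B n x : set (SigmaB d m)).
Proof using hd hq hm hmd. exact: $measurable_Bn. Qed.

Lemma p_ge0 n x : 0 <= p n x.
Proof using hd hq hm hmd. by rewrite fine_ge0// measure_ge0. Qed.

Lemma p_le1 n x : p n x <= 1.
Proof using hd hq hm hmd.
by rewrite -lee_fin fineK ?fin_num_measure ?probability_le1//; exact: mB.
Qed.

Lemma Bn_det_center n x u : agree d m (scale n) x u -> B n u = B n x.
Proof using hd hq hm hmd. by move=> xu; apply: Bn_sym; exact: ($Bn_det) xu _. Qed.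

Lemma measurable_ball_prob n (Q : R -> Prop) :
  measurable ([set x | Q (p n x)] : set (SigmaB d m)).
Proof using hd hq hm hmd.
by apply: (@measurable_fin_det d m _ (scale n)) => x u xu; rewrite /= (Bn_det_center n x u xu).
Qed.

(** The ball [B n x] depends on finitely many positions of x, so for each n the points with a null
    ball form a finite union of cylinders, each inside a null ball. *)
Lemma null_ball : nu [set x | exists n, p n x = 0] = 0%E.
Proof using hd hq hm hmd.
have mZ n : measurable ([set x | p n x = 0] : set (SigmaB d m)).
  exact: (measurable_ball_prob n (fun y => y = 0)).
have Z0 n : nu [set x | p n x = 0] = 0%E.
  rewrite -[LHS]fineK ?fin_num_measure//; congr (_%:E).
  rewrite (fin_det_prob R d m nu _ (scale n))//; last first.
    by move=> x u xu; rewrite /= (Bn_det_center n x u xu).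
  rewrite big_seq big1// => v vn; case: asboolP => /= [h|_]; last by rewrite mulr0.
  rewrite mulr1; apply/eqP; rewrite eq_le fine_ge0 ?measure_ge0// andbT -h.
  apply: fine_le; rewrite ?fin_num_measure//; [exact: measurable_pcyl|exact: mB|].
  apply: le_measure; rewrite ?inE; [exact: measurable_pcyl|exact: mB|].
  move=> u hu; apply: ($Bn_det n _ (dword d m v)) => //.
  by apply/pwordP; rewrite dwordK// -(size_words _ _ _ vn).
have -> : [set x | exists n, p n x = 0] = \bigcup_n [set x | p n x = 0].
  by apply/seteqP; split=> x; [move=> [n h]; exists n|move=> [n _ h]; exists n].
apply: measure_negligible; first exact: bigcup_measurable.
apply: negligible_bigcup => n; exists [set x | p n x = 0]; split; [exact: mZ|exact: Z0|by []].
Qed.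

(** Null balls are removed explicitly: as [ln 0 = 0], the limit alone would not exclude them when D
    = 0. *)
Lemma typical_set : exists E : set (SigmaB d m), [/\ measurable E, nu E = 1%E &
  forall x, E x -> (forall n, 0 < p n x) /\
   forall e, 0 < e -> exists n0, forall n, (n0 <= n)%N ->
     expR (- (n%:R * Ln * (D + e))) <= p n x <= expR (- (n%:R * Ln * (D - e)))].
Proof.
have [A [mA A0 hA]] := nuD.
pose Z := [set x : SigmaB d m | exists n, p n x = 0].
have mZ : measurable Z.
  have -> : Z = \bigcup_n [set x | p n x = 0].
    by apply/seteqP; split=> x; [move=> [n h]; exists n|move=> [n _ h]; exists n].
  by apply: bigcup_measurable => n _; exact: (measurable_ball_prob n (fun y => y = 0)).
have AZ0 : nu (A `|` Z) = 0%E.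
  by apply: etrans _ A0; exact: measureU0 mA mZ null_ball.
exists (~` (A `|` Z)); split; first exact/measurableC/measurableU.
  by rewrite probability_setC ?AZ0 ?sube0//; exact: measurableU.
move=> x /not_orP[Ax Zx].
have pp n : 0 < p n x.
  by rewrite lt_neqAle p_ge0 andbT eq_sym; apply/eqP => h; apply: Zx; exists n.
split=> // e e0.
have /cvgrPdist_le : (fun n : nat => - (n%:R^-1 * log_ R (m 1) (p n x))) @ \oo --> D.
  by apply: contrapT => h; apply: Ax; exact: hA.
move=> /(_ e e0) [n0 _ h]; exists n0.+1 => n hn; have L0 := Ln_gt0.
have n_gt0 : 0 < n%:R :> R by rewrite ltr0n; lia.
have := h n (ltnW hn); rewrite /log_ /=.
have -> : D - - (n%:R^-1 * (ln (p n x) / Ln)) = (n%:R * Ln * D + ln (p n x)) / (n%:R * Ln).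
  move: (ln (p n x)) => y; move: Ln L0 (n%:R) n_gt0 => L L0' z z0.
  by field; rewrite !gt_eqF.
rewrite normrM normfV [`|n%:R * _|]gtr0_norm ?mulr_gt0// ler_pdivrMr ?mulr_gt0// ler_norml.
move=> /andP[h1 h2].
rewrite -[p n x]lnK ?posrE ?pp// !ler_expR; apply/andP; split; lra.
Qed.

Definition light_set (s : R) (N : nat) : set (SigmaB d m) :=
  [set x | forall n, (N <= n)%N -> p n x <= expR (- (n%:R * Ln * s))].

Lemma measurable_light_set s N : measurable (light_set s N).
Proof using hd hq hm hmd.
have -> : light_set s N = \bigcap_(n in [set n | (N <= n)%N]) [set x | p n x <= expR (- (n%:R * Ln * s))].
  by apply/seteqP; split=> x h n /h.
apply: bigcap_measurable; first by exists N => /=.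
by move=> n _; exact: (measurable_ball_prob n (fun y => y <= _)).
Qed.

(* [V] is a ball of radius comparable to [diam U]. *)
Lemma light_set_cover s N (U : set Sg) : 0 <= s -> diam U <= rad N ->
  exists V : set (SigmaB d m), [/\ measurable V, U `&` light_set s N `<=` V &
    (nu V <= (expR (Ln * s) * diam_pow R d m s U)%:E)%E].
Proof using hd hq hm hmd.
move=> s0 UN; have [[x [Ux Gx]]|empty] := pselect (U `&` light_set s N !=set0); last first.
  exists set0; split => //; first by move=> y Uy; case: empty; exists y.
  by rewrite measure0 lee_fin mulr_ge0 ?expR_ge0 ?diam_pow_ge0.
have UB n : diam U <= rad n -> U `<=` B n x.
  by move=> h u Uu; apply: dist_Bn; apply: le_trans h; exact: dist_le_diam.
have Udp : diam_pow R d m s U = diam U `^ s.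
  by rewrite /diam_pow asboolF// => U0; rewrite U0 in Ux.
have pE n : nu (B n x) = (p n x)%:E by rewrite fineK ?fin_num_measure//; exact: mB.
have L0 := Ln_gt0.
(* For diameter 0 no radius is comparable to that of U: the case s = 0 relies on [0 ^ 0 = 1], and s
   > 0 on the intersection of all balls around x being null. *)
have := diam_ge0 U; rewrite le_eqVlt => /orP[/eqP z|dpos].
  have UBn n : U `<=` B n x by apply: UB; rewrite -z ltW// rad_gt0.
  have [es|sn0] := eqVneq s 0.
    exists (B N x); split; [exact: mB|by move=> u [Uu _]; exact: UBn|].
    by rewrite Udp es powRr0 mulr0 expR0 mulr1 pE lee_fin p_le1.
  exists (\bigcap_n B n x); split.
  - by apply: bigcap_measurable => [|n _]; [exists 0%N|exact: mB].
  - by move=> u [Uu _] n _; exact: UBn.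
  rewrite Udp -z powR0// mulr0; apply/lee_addgt0Pr => e e0; rewrite add0e.
  have sp : 0 < s by rewrite lt_neqAle eq_sym sn0.
  have [n hn] : exists n, (N <= n)%N /\ expR (- (n%:R * Ln * s)) <= e.
    exists (N + (Num.truncn (- ln e / (Ln * s))).+1)%N; split; first exact: leq_addr.
    rewrite -[leRHS]lnK ?posrE// ler_expR lerNl -mulrA -ler_pdivrMr ?mulr_gt0//.
    by apply: le_trans (ltW (truncnS_gt _)) _; rewrite ler_nat leq_addl.
  apply: (@le_trans _ _ (nu (B n x))).
    apply: le_measure; rewrite ?inE; [|exact: mB|by move=> u; apply].
    by apply: bigcap_measurable => [|k _]; [exists 0%N|exact: mB].
  by rewrite pE lee_fin (le_trans (Gx n _)) ?hn//; case: hn.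
(* The ball to be chosen has radius below [m_1 diam U], whence the factor
   [m_1^s = expR (Ln * s)]. *)
have ex : exists n, rad n < diam U by exact: rad_small.
case: (ex_minnP ex) => -[|n] h hmin.
  by move: UN; rewrite leNgt => /negP[]; apply: le_lt_trans h; rewrite rad_le.
have nU : diam U <= rad n by rewrite leNgt; apply/negP => /hmin; rewrite ltnn.
have Nn : (N <= n)%N by rewrite leqNgt -rad_le -ltNge (lt_le_trans h).
exists (B n x); split; [exact: mB|by move=> u [Uu _]; exact: UB|].
rewrite pE lee_fin (le_trans (Gx n Nn))// Udp.
apply: (@le_trans _ _ (expR (Ln * s) * rad n.+1 `^ s)); last first.
  by apply: ler_wpM2l; [exact: expR_ge0|apply: ge0_ler_powR => //; rewrite ?nnegrE ltW// rad_gt0].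
have -> : rad n.+1 `^ s = expR (- (n.+1%:R * Ln * s)) by rewrite radE -expRM mulNr.
by rewrite -expRD ler_expR -natr1; lra.
Qed.

(** Mass distribution principle: were some s < D admissible for E, it would have covers with
    arbitrarily small sum of [diam^s], and by [light_set_cover] this sum bounds the positive mass of
    a light set. *)
Lemma measure_dim_ge : (D%:E <= measure_dim R d m nu)%E.
Proof.
apply: le_ereal_inf_tmp => _ [E [mE E1] <-]; apply: le_ereal_inf_tmp => _ [s [s0 Hs] <-].
rewrite lee_fin leNgt; apply/negP => sD.
have [T [mT T1 hT]] := typical_set.
have TG : T `<=` \bigcup_N light_set s N.
  move=> x /hT[_ /(_ (D - s))]; rewrite subr_gt0 => /(_ sD)[n0 h]; exists n0 => // n /h /andP[_].
  by rewrite subKr.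
have [N GN] : exists N, nu (light_set s N) != 0%E.
  apply: contrapT => h.
  have : nu (\bigcup_N light_set s N) = 0%E.
    apply: measure_negligible.
      by apply: bigcup_measurable => n _; exact: measurable_light_set.
    apply: negligible_bigcup => n; exists (light_set s n); split => //.
      exact: measurable_light_set.
    by apply/eqP/negPn/negP => h'; apply: h; exists n.
  have : (nu T <= nu (\bigcup_N light_set s N))%E.
    apply: le_measure; rewrite ?inE//.
    by apply: bigcup_measurable => n _; exact: measurable_light_set.
  by rewrite T1 => /[swap] ->; rewrite lee_fin ler10.
set G := light_set s N in GN; have mG : measurable G by exact: measurable_light_set.
have c0 : (0 < nu G)%E by rewrite lt_neqAle eq_sym GN measure_ge0.
pose c := fine (nu G); have cE : nu G = c%:E by rewrite fineK// fin_num_measure.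
rewrite cE lte_fin in c0.
have : (hausdorff_pre R d m s (rad N) E < (c * expR (- (Ln * s)))%:E)%E.
  apply: (@le_lt_trans _ _ 0%E); last by rewrite lte_fin mulr_gt0// expR_gt0.
  by rewrite -Hs; apply: ereal_sup_ubound; exists (rad N) => //; exact: rad_gt0.
move=> /ereal_inf_lt[_ [U [EU dU] <-] Usum].
have [V hV] := choice (fun i => light_set_cover s N (U i) s0 (dU i)).
have : (nu G <= \sum_(i <oo) nu (V i))%E.
  have mV : measurable (\bigcup_i V i) by apply: bigcup_measurable => i _; case: (hV i).
  have -> : nu G = nu (G `&` E).
    have nE : nu (G `\` E) = 0%E.
      apply/eqP; rewrite eq_le measure_ge0 andbT.
      apply: (@le_trans _ _ (nu (~` E))); last by rewrite probability_setC ?E1 ?subee.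
      by apply: le_measure; rewrite ?inE; [exact: measurableD|exact: measurableC|move=> x []].
    apply: etrans (measureDI nu mG mE) _.
    by rewrite [X in (X + _)%E]nE add0e.
  apply: (@measure_sigma_subadditive _ _ _ nu) => //.
  - by move=> i; case: (hV i).
  - exact: measurableI.
  - by move=> x [Gx /EU[i _ Ui]]; exists i => //; case: (hV i) => _ h _; exact: h.
apply/negP; rewrite -ltNge cE.
apply: (@le_lt_trans _ _ (\sum_(i <oo) ((expR (Ln * s))%:E * (diam_pow R d m s (U i))%:E))%E).
  apply: lee_nneseries => i; first by move=> _ _; exact: measure_ge0.
  by move=> _; case: (hV i) => _ _ h; rewrite -EFinM.
rewrite nneseriesZl; last by move=> i _; rewrite lee_fin diam_pow_ge0.
have : ((expR (Ln * s))%:E * (\sum_(i <oo) (diam_pow R d m s (U i))%:E) <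
   (expR (Ln * s))%:E * (c * expR (- (Ln * s)))%:E)%E.
  by rewrite lte_pmul2l// lte_fin expR_gt0.
by rewrite -EFinM mulrCA -expRD subrr expR0 mulr1.
Qed.

(** The centres [dword v] suffice, as a ball depends on finitely many positions of its centre.
    Removing repetitions makes the balls of the list pairwise disjoint. *)
Definition heavy_balls (a : R) (n : nat) : seq (set Sg) :=
  undup [seq B n (dword d m v) | v <- words (nletters d m) (scale n)
    & expR (- (n%:R * a)) <= p n (dword d m v)].

Lemma mem_heavy_balls a n x : expR (- (n%:R * a)) <= p n x -> B n x \in heavy_balls a n.
Proof using hd hq hm hmd.
move=> h; rewrite mem_undup; apply/mapP; exists (pword d m (scale n) x).
  rewrite mem_filter pword_words andbT.
  by rewrite (Bn_det_center n x)//; exact: dword_pword.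
by apply/esym/Bn_det_center; exact: dword_pword.
Qed.

Lemma heavy_ballsP a n C : C \in heavy_balls a n ->
  exists2 x, C = B n x & expR (- (n%:R * a)) <= p n x.
Proof using.
by rewrite mem_undup => /mapP[v]; rewrite mem_filter => /andP[h _] ->; exists (dword d m v).
Qed.

(** The balls of the list are disjoint, so their masses, each at least [exp (- n a)], add up to at
    most 1. *)
Lemma size_heavy_balls a n : (size (heavy_balls a n))%:R <= expR (n%:R * a).
Proof using hd hq hm hmd.
have : \sum_(C <- heavy_balls a n) fine (nu C) <= 1.
  have e C : C \in heavy_balls a n -> fine (nu C) =
      \sum_(v <- words (nletters d m) (scale n)) fine (nu (pcyl d m v)) * (`[< C (dword d m v) >])%:R.
    move=> /heavy_ballsP[x -> _]; rewrite (fin_det_prob R d m nu _ (scale n))//; first exact: mB.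
    by move=> y u yu; exact: $Bn_det.
  rewrite big_seq (eq_bigr _ e) -big_seq exchange_big /=.
  have {2}<- : \sum_(v <- words (nletters d m) (scale n)) fine (nu (pcyl d m v)) = 1.
    have := fin_det_prob R d m nu setT (scale n) measurableT (fun _ _ _ _ => I).
    move=> h; transitivity (fine (nu setT)); last by rewrite probability_setT.
    by rewrite h; apply: eq_bigr => v _; rewrite asboolT// mulr1.
  apply: ler_sum => v _; rewrite -mulr_sumr ler_piMr ?fine_ge0 ?measure_ge0//.
  rewrite big_seq (eq_bigr (fun C => (C == B n (dword d m v))%:R)); last first.
    move=> C /heavy_ballsP[x -> _]; congr (nat_of_bool _)%:R; apply/asboolP/eqP => [h|->//].
    by rewrite (Bn_sym _ _ _ h).
  have count (r : seq (set Sg)) y : (\sum_(C <- r) (C == y) = count_mem y r)%N.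
    by elim: r => [|z r IH]; rewrite ?big_nil// big_cons IH.
  by rewrite -big_seq -natr_sum -[1]/(1%:R) ler_nat count count_uniq_mem ?undup_uniq ?leq_b1.
have : \sum_(C <- heavy_balls a n) expR (- (n%:R * a)) <= \sum_(C <- heavy_balls a n) fine (nu C).
  by rewrite big_seq [leRHS]big_seq; apply: ler_sum => C /heavy_ballsP[x -> h].
rewrite big_const_seq count_predT iter_addr addr0 => h1 h2; have := le_trans h1 h2.
by rewrite -[_ *+ _]mulr_natl expRN ler_pdivrMr ?expR_gt0// mul1r.
Qed.

Lemma expR_small (a c : R) : 0 < a -> 0 < c -> exists n0, forall n, (n0 <= n)%N -> expR (- (n%:R * a)) <= c.
Proof using.
move=> a0 c0; exists (Num.truncn (- ln c / a)).+1 => n hn.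
rewrite -[leRHS]lnK ?posrE// ler_expR lerNl -ler_pdivrMr//.
by apply: le_trans (ltW (truncnS_gt _)) _; rewrite ler_nat.
Qed.

(** The heavy balls of index at least n0 cover the typical set. With threshold [D + e/2] against the
    exponent [D + e], those of index n contribute at most [m_1^(- n e / 2)], the terms of a
    geometric series. *)
Lemma measure_dim_le : (measure_dim R d m nu <= D%:E)%E.
Proof.
apply/lee_addgt0Pr => e e0; rewrite -EFinD; set s := D + e.
have s_gt0 : 0 < s by rewrite ltr_wpDl.
have L0 := Ln_gt0.
have [E [mE E1 hE]] := typical_set.
apply: ereal_inf_le; exists (hausdorff_dim R d m E); first by exists E.
apply: ereal_inf_lbound; exists s => //; split; first exact: ltW.
have pre_ge0 eps : (0 <= hausdorff_pre R d m s eps E)%E.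
  apply: le_ereal_inf_tmp => _ [U _ <-]; apply: nneseries_ge0 => i _ _.
  by rewrite lee_fin diam_pow_ge0.
apply/eqP; rewrite eq_le; apply/andP; split; last first.
  by apply: le_trans (pre_ge0 1) _; apply: ereal_sup_ubound; exists 1 => //=.
apply: ge_ereal_sup => _ [eps eps0 <-]; apply/lee_addgt0Pr => c c0; rewrite add0e.
pose rho := expR (- (e / 2 * Ln)).
have rho0 : 0 < rho by exact: expR_gt0.
have rho1 : rho < 1 by rewrite expR_lt1 oppr_lt0 mulr_gt0// divr_gt0.
have e20 : 0 < e / 2 * Ln by rewrite mulr_gt0// divr_gt0.
have cr0 : 0 < c * (1 - rho) by rewrite mulr_gt0// subr_gt0.
(* n1 makes the tail of the geometric series at most c, and n2 the diameters at most eps. *)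
have [n1 h1] := expR_small (e / 2 * Ln) (c * (1 - rho)) e20 cr0.
have [n2 h2] := expR_small Ln eps L0 eps0.
pose n0 := (n1 + n2)%N; pose a := Ln * (D + e / 2).
pose L j := heavy_balls a (n0 + j).
have dp0 : diam_pow R d m s set0 = 0 by rewrite /diam_pow asboolT.
have [U [U_in U_all U_sum]] := enumerate_lists R (set Sg) set0 L _ dp0 (diam_pow_ge0 s).
have Ldiam j C : C \in L j -> diam C <= rad (n0 + j)%N.
  by move=> /heavy_ballsP[x -> _]; exact: diam_Bn.
apply: ereal_inf_le; exists (\sum_(i <oo) (diam_pow R d m s (U i))%:E)%E.
  exists U => //; split.
    move=> x /hE[_ /(_ (e / 2))]; rewrite divr_gt0// => /(_ isT)[k hk].
    have /U_all[i Ui] : B (n0 + k)%N x \in L k.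
      apply: mem_heavy_balls; have /andP[+ _] := hk (n0 + k)%N (leq_addl _ _).
      by rewrite /a mulrA.
    by exists i => //; rewrite Ui.
  move=> i; case: (U_in i) => [->|[j Uj]].
    by apply: diam_le; [exact: ltW|].
  apply: le_trans (Ldiam _ _ Uj) _; rewrite radE; apply: h2.
  by rewrite /n0 -addnA addnCA leq_addr.
apply: lime_le; first by apply: is_cvg_nneseries => i _ _; rewrite lee_fin diam_pow_ge0.
apply: nearW => k; rewrite sumEFin lee_fin; apply: le_trans (U_sum k) _.
have level j : \sum_(C <- L j) diam_pow R d m s C <= rho ^+ n0 * rho ^+ j.
  apply: (@le_trans _ _ (\sum_(C <- L j) expR (- ((n0 + j)%:R * Ln * s)))).
    rewrite big_seq [leRHS]big_seq; apply: ler_sum => C Cj; rewrite /diam_pow.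
    case: asboolP => _; first exact: expR_ge0.
    have r0 := ltW (rad_gt0 (n0 + j)).
    rewrite -mulNr expRM -radE; apply: ge0_ler_powR; [exact: ltW|
      by rewrite nnegrE diam_ge0|by rewrite nnegrE|exact: Ldiam].
  rewrite big_const_seq count_predT iter_addr addr0 -[_ *+ _]mulr_natl.
  apply: (@le_trans _ _ (expR ((n0 + j)%:R * a) * expR (- ((n0 + j)%:R * Ln * s)))).
    by apply: ler_wpM2r; [exact: expR_ge0|exact: size_heavy_balls].
  rewrite -expRD -exprD /rho -expRM_natl ler_expR /a /s le_eqVlt; apply/orP; left; apply/eqP.
  by move: Ln (n0 + j)%N => l n; field.
apply: (@le_trans _ _ (\sum_(0 <= j < k) rho ^+ n0 * rho ^+ j)).
  by apply: ler_sum => j _; exact: level.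
apply: (@le_trans _ _ (rho ^+ n0 / (1 - rho))).
  apply: (geometric_le_lim k); rewrite ?exprn_ge0 ?(ltW rho0)// gtr0_norm//.
rewrite ler_pdivrMr ?subr_gt0// /rho -expRM_natl mulrN; apply: h1; exact: leq_addr.
Qed.

Lemma measure_dim_exact : measure_dim R d m nu = D%:E.
Proof. by apply/eqP; rewrite eq_le measure_dim_le measure_dim_ge. Qed.

End Billingsley.

(** * The maximizing measure *)

Section Maximizer.
Variables (R : realType) (d q : nat) (m : nat -> nat).
Hypotheses (hd : (2 <= d)%N) (hq : (2 <= q)%N)
  (hm : forall k, (1 <= k < d)%N -> (m k.+1 <= m k)%N) (hmd : (2 <= m d)%N).
Variables (Omega : set (Sigma d m)) (t : seq nat -> R).
Hypothesis Omega0 : Omega !=set0.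
Local Notation Pref := (Pref R d q m Omega).
Hypothesis t_sol : forall X, size X = N_ R d q m -> Pref X -> tree_solution R d q m Omega X t.
Hypothesis cOmega : closed Omega.
#[local] Set Default Proof Using "hd hq hm hmd Omega0 t_sol cOmega".
Local Notation "$ l" := (l R d q m hd hq hm hmd) (at level 0).
Local Notation "$! l" := (l R d q m hd hq hm hmd Omega t Omega0 t_sol) (at level 0).
Local Notation w := (weight R d q m).
Local Notation lnm k := (ln (m k)%:R : R).
Local Notation Z := (tree_sum R d q m Omega t).
Local Notation K := (tree_sum_bound R d q m).
Local Notation beta := (tree_weight R Pref w Z).
Local Notation rank := (pair_rank R d q m).
Local Notation "$$ l" := (l R (m 1) Pref w Z K (Pref_nil R d q m Omega Omega0)
  ($Pref_rcons_w Omega)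
  ($Pref_rcons_lt1 Omega) $weight_gt0 $weight_le ($tree_sum_ge1 Omega t t_sol)
  ($tree_sum_le Omega t t_sol) ($tree_sum_rec Omega t t_sol)) (at level 0).

Lemma Pref_words u : Pref u -> u \in words (m 1) (size u).
Proof. by move=> [x _ <-]; rewrite ($size_word); exact: word_words R d q m hq hd hm hmd _ _. Qed.

Definition max_S : R := w 1 * ln (Z [::]) / lnm d.

Section Competitor.
Variable nu : probability (SigmaB d m) R.
Hypothesis nu1 : nu Omega = 1%E.
Local Notation a := (word_prob R d q m nu).

Lemma word_prob_wentropy_ge0 n : 0 <= wentropy R (m 1) a n.
Proof using All.
exact: $$ wentropy_ge0 a ($word_prob_nil nu) ($word_prob_ge0 nu) ($word_prob_sum nu)
  ($word_prob_out Omega Omega0 nu nu1 cOmega) n.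
Qed.

Lemma S_cvg_competitor : (partial_S R d q m nu (rank p) / lnm d)%:E @[p --> \oo] --> S_ R d q m Omega nu.
Proof using All. exact: $S_cvg Omega Omega0 nu nu1 cOmega word_prob_wentropy_ge0. Qed.

Lemma S_le n : (1 <= n)%N ->
  (S_ R d q m Omega nu <=
   ((w 1 * ln (Z [::]) - (w n - w n.+1) * relative_entropy R (m 1) Pref w Z a n) / lnm d)%:E)%E.
Proof using All.
move=> n1; rewrite -(cvg_lim _ S_cvg_competitor)//; apply: lime_le; first by apply/cvg_ex; eexists; exact: S_cvg_competitor.
exists n.+1 => // p /= np; rewrite lee_fin ler_pM2r ?invr_gt0 ?($lnmd_gt0)//.
apply: ($$ entropy_sum_le a ($word_prob_nil nu) ($word_prob_ge0 nu) ($word_prob_sum nu)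
  ($word_prob_out Omega Omega0 nu nu1 cOmega)).
by rewrite n1 (leq_trans _ ($pair_rank_ge p))//; case: p np.
Qed.

Lemma S_le_max : (S_ R d q m Omega nu <= max_S%:E)%E.
Proof using All.
apply: le_trans (S_le 1 isT) _; rewrite lee_fin ler_pM2r ?invr_gt0 ?($lnmd_gt0)// gerBl.
rewrite mulr_ge0 ?subr_ge0 ?($weight_le)//.
exact: $$ relative_entropy_ge0 a ($word_prob_nil nu) ($word_prob_ge0 nu) ($word_prob_sum nu)
  ($word_prob_out Omega Omega0 nu nu1 cOmega) 1.
Qed.

(** At a length where the weight drops, attaining the bound forces relative entropy 0, hence a =
    beta. Such lengths are unbounded, and shorter words follow by summing over their extensions. *)
Lemma S_max_word_prob : (max_S%:E <= S_ R d q m Omega nu)%E -> forall u, a u = beta u.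
Proof using All.
move=> hS.
have strict p : (1 <= p)%N -> exists2 n, (p <= n)%N & w n.+1 < w n.
  move=> p1; have [sd s1] := $s_of_le p.
  have v : valid R d q m p (s_of R d q m p).-1 by rewrite /valid p1 prednK// leqnn/=; lia.
  have e := $pair_E p _ v; exists (rank p + (d - (s_of R d q m p).-1))%N.
    by have := $pair_rank_ge p; lia.
  by apply: ($weight_lt) e _ _ => //; lia.
have level n : (1 <= n)%N -> w n.+1 < w n -> forall u, size u = n -> a u = beta u.
  move=> n1 wn u su; have [Pu|nP] := pselect (Pref u); last first.
    by rewrite tree_weight_out// ($word_prob_out Omega Omega0 nu nu1 cOmega).
  apply: ($$ relative_entropy_eq0 a ($word_prob_nil nu) ($word_prob_ge0 nu) ($word_prob_sum nu)
    ($word_prob_out Omega Omega0 nu nu1 cOmega) n); last by rewrite -su; exact: Pref_words.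
  apply/eqP; rewrite eq_le; apply/andP; split; last first.
    exact: $$ relative_entropy_ge0 a ($word_prob_nil nu) ($word_prob_ge0 nu) ($word_prob_sum nu)
      ($word_prob_out Omega Omega0 nu nu1 cOmega) n.
  have := le_trans hS (S_le n n1); rewrite lee_fin ler_pM2r ?invr_gt0 ?($lnmd_gt0)//.
  by rewrite lerBrDr gerDl pmulr_rle0 ?subr_gt0.
move=> u; have [n] := strict (size u).+1 isT; move=> un wn.
have n1 : (1 <= n)%N by lia.
have {}level := level n n1 wn.
have down k v : (size v + k = n)%N -> a v = beta v.
  elim: k v => [|k IH] v sv; first by apply: level; lia.
  rewrite ($word_prob_sum nu) ($! beta_sum); apply: eq_bigr => c _; apply: IH.
  by rewrite size_rcons; lia.
by apply: (down (n - size u)%N); lia.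
Qed.

End Competitor.

Section Optimum.
Variable mu : probability (SigmaB d m) R.
Hypotheses (mu1 : mu Omega = 1%E) (mu_beta : forall u, word_prob R d q m mu u = beta u).

(** For beta only the boundary term separates the partial sums from the maximum; it is at most the
    weight of index I + 1 times [(I + 1) ln K], and a decay of the weights like [1 / j^2] sends it
    to 0. *)
Lemma S_ge_max : (max_S%:E <= S_ R d q m Omega mu)%E.
Proof using All.
have ld := $lnmd_gt0; have C0 : 0 <= ln K := $! C_ge0.
have [A hA] := $weight_decay.
apply/lee_addgt0Pr => e e0; rewrite -leeBlDr// -EFinB.
rewrite -(cvg_lim _ (S_cvg_competitor mu mu1))//.
apply: lime_ge; first by apply/cvg_ex; eexists; exact: S_cvg_competitor mu mu1.
exists (Num.truncn (A * ln K / (e * lnm d))).+2 => // p /= hp; rewrite lee_fin.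
set I := rank p; rewrite /max_S lerBlDr -lerBlDl -mulrBl ler_pdivrMr//.
have -> : partial_S R d q m mu I = \sum_(1 <= n < I.+1) (w n - w n.+1) * wentropy R (m 1) beta n.
  apply: eq_bigr => n _; congr (_ * - _); apply: eq_bigr => u _.
  by rewrite mu_beta.
rewrite ($$ entropy_sum_identity beta ($! beta_nil) ($! beta_ge0) ($! beta_sum) ($! beta_out)).
rewrite [X in _ - (_ - X)]big1 ?subr0; last first.
  by move=> j _; rewrite /relative_entropy big1 ?mulr0// => u _; rewrite subrr mulr0.
rewrite subKr.
have /andP[_ T1] := $$ tail_term_bounds beta ($! beta_nil) ($! beta_ge0) ($! beta_sum) ($! beta_out) I.
have w0 : 0 < w I.+1 by apply: ($weight_gt0).
apply: le_trans (ler_wpM2l (ltW w0) T1) _.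
have j0 : 0 < I.+1%:R :> R by [].
have j1 : 1 <= I.+1%:R :> R by rewrite ler1n.
have h1 : w I.+1 * I.+1%:R * I.+1%:R <= A.
  apply: le_trans (hA I.+1 isT); rewrite -mulrA -expr2 ler_pM2l//.
  exact: ler_weXn2l.
have hI : A * ln K / (e * lnm d) <= I.+1%:R.
  apply: le_trans (ltW (truncnS_gt _)) _; rewrite ler_nat.
  by apply: leq_trans (leq_trans _ ($pair_rank_ge p)) (leqnSn I); case: p hp I w0 T1 j0 j1 h1.
rewrite ler_pdivrMr ?mulr_gt0// in hI.
rewrite mulrA -(ler_pM2r j0); apply: (@le_trans _ _ (A * ln K)).
  by rewrite mulrAC; apply: ler_wpM2r.
by apply: le_trans hI _; rewrite mulrC.
Qed.

End Optimum.

Lemma t_empty_ge1 : 1 <= t_empty R d q m Omega t.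
Proof.
by rewrite -($tree_sum_nil); apply: ($tree_sum_ge1) => //; exact: Pref_nil R d q m Omega Omega0.
Qed.

Lemma maximizer_exists : exists mu : probability (SigmaB d m) R,
  [/\ is_maximizer R d q m Omega mu,
    forall nu : probability (SigmaB d m) R, is_maximizer R d q m Omega nu ->
      forall A : set (SigmaB d m), measurable A -> nu A = mu A &
    forall u, word_prob R d q m mu u = beta u].
Proof.
have [mu [mu_cyl mu1]] := $measure_of_weights Omega cOmega beta ($! beta_nil) ($! beta_ge0)
  ($! beta_sum) ($! beta_out).
have mu_beta u : word_prob R d q m mu u = beta u by rewrite /word_prob mu_cyl.
have Smu := S_ge_max mu mu1 mu_beta.
exists mu; split => //.
  by split=> // nu nu1; apply: le_trans (S_le_max nu nu1) Smu.
move=> nu [nu1 nu_max]; apply: ($chi_cyl_unique) => u.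
rewrite !($word_probE) mu_beta; congr (_%:E).
by apply: S_max_word_prob => //; apply: le_trans Smu _; exact: nu_max.
Qed.

End Maximizer.

Theorem theorem3p2 (R : realType) (d q : nat) (m : nat -> nat)
    (hd : (2 <= d)%N) (hq : (2 <= q)%N)
    (hm : forall k, (1 <= k < d)%N -> (m k.+1 <= m k)%N) (hmd : (2 <= m d)%N)
    (Omega : set (Sigma d m)) (Omega0 : Omega !=set0) (cOmega : closed Omega) :
  (forall X : seq nat,
     size X = N_ R d q m -> Pref R d q m Omega X ->
     exists2 t : seq nat -> R,
       tree_solution R d q m Omega X t &
       forall t' : seq nat -> R, tree_solution R d q m Omega X t' ->
         forall w, Gamma R d q m Omega X w -> t' w = t w)
  /\
  (forall t : seq nat -> R,
     (forall X : seq nat, size X = N_ R d q m -> Pref R d q m Omega X ->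
        tree_solution R d q m Omega X t) ->
     exists mu : probability (SigmaB d m) R,
       [/\ is_maximizer R d q m Omega mu,
           forall nu : probability (SigmaB d m) R,
             is_maximizer R d q m Omega nu ->
             forall A : set (SigmaB d m), measurable A -> nu A = mu A,
           forall (l : nat) (w : seq nat),
             size w = (N_ R d q m + l * d)%N -> Pref R d q m Omega w ->
             mu (cyl R d q m Omega w) = (mu_cyl R d q m Omega t l w)%:E &
           (exists P : probability (SigmaB d m) R, is_P_mu R d q m mu P) /\
           forall P : probability (SigmaB d m) R, is_P_mu R d q m mu P ->
             exact_dimensional R d m P
               (omega R d q m 1 * log_ R (m d) (t_empty R d q m Omega t)) /\
             measure_dim R d m P =
               (omega R d q m 1 * log_ R (m d) (t_empty R d q m Omega t))%:E]).
Proof.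
split=> [X sX PX|t t_sol].
  have [t ht] := tree_solution_exists R d q m hd hq hm hmd Omega X.
  exists t => // t' ht' w Gw.
  exact: (tree_solution_unique R d q m hd hq hm hmd Omega X t t').
have [mu [mu_max mu_unique mu_beta]] :=
  maximizer_exists R d q m hd hq hm hmd Omega t Omega0 t_sol cOmega.
have mu1 : mu Omega = 1%E by case: mu_max.
exists mu; split=> //.
  move=> l w sw Pw; rewrite (word_prob_cyl R d q m hd hq hm hmd Omega Omega0 mu mu1 cOmega).
  by rewrite mu_beta (mu_cylE R d q m hd hq hm hmd Omega t t_sol l).
split; first exact: P_mu_exists.
move=> P hP.
have [A hA] := weight_decay R d q m hd hq hm hmd.
have hlam j : (1 <= j)%N -> lam R d q m j * j%:R ^+ 6 <= lam_factor R d q m * A.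
  move=> j1; rewrite -mulrA; apply: ler_wpM2l; last exact: hA.
  exact/ltW/(lam_factor_gt0 R d q m hd hq hm hmd).
have ed := P_mu_exact_dimensional R d q m hd hq hm hmd Omega t Omega0 t_sol _ hlam mu P mu_beta hP.
split=> //; apply: (measure_dim_exact R d q m hd hq hm hmd) => //.
(* The passage from local dimension to Hausdorff dimension assumes a nonnegative value, which comes
   from [t_empty >= 1]. *)
rewrite (omega_1 R d q m hd hq hm hmd); apply: mulr_ge0.
  exact/ltW/(weight_gt0 R d q m hd hq hm hmd).
rewrite divr_ge0 ?ln_ge0//; last by rewrite ler1n; lia.
exact: t_empty_ge1 R d q m hd hq hm hmd Omega t Omega0 t_sol cOmega.
Qed.
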